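(* Assume (A.1), (A.2), (A.3), (A.4). In addition, assume that the matrix $P^2$ is irreducible and that there exists a constant $\kappa>0$ such that for all $x,y\in[0,1]^d$ and $i\in E$, $$\sum_{u\in\mathcal V,\ u\perp x-y}\big|p(x,i,u)-p(y,i,u)\big|+\sum_{u\in\mathcal V}\big(p(x,i,u)-p(y,i,u)\big)\,\mathrm{sgn}\big(\langle x-y,u\rangle\big)\le-\kappa|x-y|_1,$$ where $\mathrm{sgn}(r)=r/|r|$ for $r\ne0$ and $\mathrm{sgn}(0)=0$. For $i\in E$ and $m\ge1$ define $T^i_m=\min\{t>0:\mathbb P^i_0(\tau^{(m)}>t)\le e^{-1}\}$. Then, for every $i\in E$ and every sequence $(x_m)_{m\ge1}$ of starting points in $G$, with $mx_m\in\mathbb Z^d$ for all $m$ and $x_m\to x\in G$ as $m\to\infty$, the law of $\tau^{(m)}/T^i_m$ under $\mathbb P^i_{x_m}$ converges weakly, as $m\to\infty$, to the exponential law of mean $1$.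
   Context: Notation: $|\cdot|$ is the Euclidean norm, $|\cdot|_1$ the $\ell^1$ norm, $\langle\cdot,\cdot\rangle$ the Euclidean scalar product. Model. Let $d\ge1$, $E$ a finite set, $(e_i)_{1\le i\le d}$ the canonical basis and $\mathcal V=\{e_1,-e_1,\dots,e_d,-e_d\}$. $(\xi_n)_{n\ge0}$ is a Markov chain on $E$ with transition matrix $P$. For $x\in\mathbb R^d$, $i\in E$, $p(x,i,\cdot)$ is a probability on $\mathcal V$. $(U_n)_{n\ge0}$ are i.i.d. uniform on $(0,1)$, independent of $(\xi_n)$, and $f(x,i,\cdot):(0,1)\to\mathcal V$ is the inverse of the cumulative distribution function of $p(x,i,\cdot)$ (for a fixed order on $\mathcal V$), so $\mathbb P\{f(x,i,U_n)=v\}=p(x,i,v)$. For an integer $m\ge1$, with $\Pi^{(m)}$ the projection onto $[0,m]^d$, the reflected walk is $X_{n+1}=(2\Pi^{(m)}-\mathrm{Id})(X_n+f(X_n/m,\xi_n,U_n))$, $X_0\in\mathbb Z^d\cap[0,m]^d$, also written $X^{(m)}$. The process $\bar X^{(m)}$ is the continuous process with $\bar X^{(m)}_{n/m}=X^{(m)}_n/m$ for $n\in\mathbb N$, linearly interpolated on each $[n/m,(n+1)/m]$. $\mathbb P^i_x$ means $\bar X_0^{(m)}=x$ and $\xi_0=i$. Assumptions. (A.1) There is a finite $K$ with $|p(x,i,v)-p(y,i,v)|\le K|x-y|$ for all $x,y\in\mathbb R^d$, $i\in E$, $v\in\mathcal V$. (A.2) $p(x,i,v)>0$ for all $x\in\mathbb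 R^d$, $i\in E$, $v\in\mathcal V$. (A.3) $P$ is irreducible on $E$; $\mu$ is its unique invariant probability measure. Reflected differential equation. For $x\in\partial[0,1]^d$, $\mathcal N(x)=\{v\in\mathbb R^d:|v|=1,\ v_\ell=0\text{ if }x_\ell\in(0,1),\ v_\ell\le0\text{ if }x_\ell=0,\ v_\ell\ge0\text{ if }x_\ell=1\}$. With $\bar f(x)=\sum_{v\in\mathcal V}v\sum_{i\in E}\mu(i)p(x,i,v)$, for $x_0\in[0,1]^d$ the path $(\chi^{x_0}_t)_{t\ge0}$ with values in $[0,1]^d$ is the unique solution of the RDE $\chi_t=x_0+\int_0^t\bar f(\chi_s)ds-k_t$, where $k$ is continuous of bounded variation on bounded sets, $k_t=\int_0^tn_s\,d|k|_s$, $|k|_t=\int_0^t\mathbf 1_{\{\chi_s\in\partial[0,1]^d\}}d|k|_s$, $n_s\in\mathcal N(\chi_s)$. Deadlock. Fix $\ell\in(0,d)$, $G=\{x\in[0,1]^d:|x|_1<\ell\}$, $\partial G=\{x\in[0,1]^d:|x|_1=\ell\}$, $\bar G=G\cup\partial G$, $\partial G^{(m)}=\{x\in(m^{-1}\mathbb Z^d)\cap[0,1]^d:|x|_1=m^{-1}\lfloor m\ell\rfloor\}$. Deadlock time: $\tau^{(m)}=\inf\{t\ge0:\bar X^{(m)}_t\in\partial G^{(m)}\}$. (A.4): $0$ is the unique equilibrium point of the RDE; it is stable and attracts $\bar G$, that is, for all $x_0\in\bar G$ and $t>0$, $\chi^{x_0}_t\in G$, and $\lim_{t\to\infty}\chi^{x_0}_t=0$.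 *)

(* Defs.v *)
From HB Require Import structures.
From mathcomp Require Import all_boot all_order all_algebra.
From mathcomp Require Import all_classical all_reals all_analysis.

Set Implicit Arguments.
Unset Strict Implicit.
Unset Printing Implicit Defensive.

Import Order.TTheory GRing.Theory Num.Theory.
Import numFieldNormedType.Exports.

Local Open Scope classical_set_scope.
Local Open Scope ring_scope.

(* R^d is 'rV[R]_d. The library norm on matrices is the
   sup norm, so the Euclidean and l^1 norms are defined here. *)

Section Euclidean.
Context {R : realType} {d : nat}.
Implicit Types x y v : 'rV[R]_d.

Definition dotp x y : R := \sum_j x 0 j * y 0 j.
Definition enorm x : R := Num.sqrt (dotp x x).
Definition l1norm x : R := \sum_j `|x 0 j|.

Definition cube x := forall j, 0 <= x 0 j <= 1.
Definition cube_boundary x := cube x /\ exists j, x 0 j = 0 \/ x 0 j = 1.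

Definition integral_vector x := forall j, x 0 j \is a Num.int.

(* Unit outward normals to the cube at x. *)
Definition unit_normal x v :=
  enorm v = 1 /\
  forall j, [/\ 0 < x 0 j < 1 -> v 0 j = 0,
                x 0 j = 0 -> v 0 j <= 0 &
                x 0 j = 1 -> 0 <= v 0 j].

(* (true, j) stands for e_j and (false, j) for - e_j. *)
Definition dir (v : bool * 'I_d) : 'rV[R]_d :=
  (if v.1 then 1 else -1) *: delta_mx 0 v.2.

(* Total variation on [0, t], relative to the Euclidean norm: the vector
   version of the library's [total_variation]. *)
Definition path_variation (k : R -> 'rV[R]_d) (t : R) : \bar R :=
  ereal_sup [set (\sum_(0 <= n < size s)
                    enorm (k (nth t (0 :: s) n.+1) - k (nth t (0 :: s) n)))%:E
            | s in itv_partition 0 t].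

(* chi_t = x0 + int_0^t b(chi_s) ds - k_t for t >= 0. The function |k| is
   extended by 0 to negative times, so that d|k| is a Stieltjes measure on R. *)
Definition rde_solution (b : 'rV[R]_d -> 'rV[R]_d) (x0 : 'rV[R]_d)
    (chi : R -> 'rV[R]_d) :=
  (forall t : R, 0 <= t -> cube (chi t)) /\
  exists (k : R -> 'rV[R]_d) (absk : cumulative R R) (n : R -> 'rV[R]_d),
    let dk := lebesgue_stieltjes_measure absk in
    [/\ {within `[0, +oo[, continuous k},
        (forall t, (absk t)%:E = path_variation k (Num.max 0 t)),
        (forall (t : R) j, 0 <= t ->
           chi t 0 j = x0 0 j
             + \int[lebesgue_measure]_(s in `[0, t]) (b (chi s) 0 j)
             - k t 0 j) &
        [/\ (forall j, measurable_fun (`[0, +oo[ : set (measurableTypeR R))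
               (fun s => n s 0 j)),
            (forall s, 0 <= s -> cube_boundary (chi s) ->
               unit_normal (chi s) (n s)),
            (forall (t : R) j, 0 <= t ->
               (k t 0 j)%:E = (\int[dk]_(s in `[0%R, t]) (n s 0 j)%:E)%E) &
            (forall t : R, 0 <= t ->
               (absk t)%:E = (\int[dk]_(s in `[0%R, t])
                  (\1_[set r | cube_boundary (chi r)] s)%:E)%E)]].

End Euclidean.

Section Chain.
Context {R : realType} {E : finType}.
Implicit Types (P : E -> E -> R) (mu : E -> R).

Definition stochastic P :=
  (forall i j, 0 <= P i j) /\ (forall i, \sum_j P i j = 1).

Definition transition_mx P : 'M[R]_#|E| :=
  \matrix_(a, b) P (enum_val a) (enum_val b).

Definition irreducible_mx n (A : 'M[R]_n) :=
  forall a b, exists k : nat, 0 < (A ^+ k) a b.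

Definition invariant_probability P mu :=
  [/\ forall i, 0 <= mu i, \sum_i mu i = 1 &
      forall j, \sum_i mu i * P i j = mu j].

End Chain.

Section Walk.
Context {R : realType} {d : nat} {E : finType}.
Local Notation V := (bool * 'I_d)%type.
Implicit Types (p : 'rV[R]_d -> E -> V -> R) (le : rel V).

Definition jump_law p :=
  forall x i, (forall v, 0 <= p x i v) /\ \sum_v p x i v = 1.

Definition jump_lipschitz p :=
  exists K : R, forall x y i v, `|p x i v - p y i v| <= K * enorm (x - y).

Definition drift p (mu : E -> R) (x : 'rV[R]_d) : 'rV[R]_d :=
  \sum_v (\sum_i mu i * p x i v) *: dir v.

Definition order_cdf le (q : V -> R) (v : V) : R := \sum_(w | le w v) q w.

(* f(x, i, u): the le-least v whose distribution function value is >= u. Such a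
   v exists whenever u <= 1, so the value 0 is never taken for u in (0,1). *)
Definition jump le p (x : 'rV[R]_d) (i : E) (u : R) : 'rV[R]_d :=
  if [pick v | (u <= order_cdf le (p x i) v) &&
       [forall w, (u <= order_cdf le (p x i) w) ==> le v w]] is Some v
  then dir v else 0.

(* Euclidean projection onto the box [0,m]^d acts coordinatewise. *)
Definition box_proj (m : nat) (x : 'rV[R]_d) : 'rV[R]_d :=
  \row_j Num.min m%:R (Num.max 0 (x 0 j)).

Definition reflect (m : nat) (x : 'rV[R]_d) : 'rV[R]_d :=
  2%:R *: box_proj m x - x.

Context {Omega : Type}.
Implicit Types (xi : nat -> Omega -> E) (U : nat -> Omega -> R).

Fixpoint walk le p xi U (m : nat) (x0 : 'rV[R]_d) (n : nat) (w : Omega)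
    : 'rV[R]_d :=
  if n is n'.+1 then
    let X := walk le p xi U m x0 n' w in
    reflect m (X + jump le p (m%:R^-1 *: X) (xi n' w) (U n' w))
  else x0.

(* Here x is the starting point of the rescaled process, i.e. X_0 = m x. *)
Definition scaled_walk le p xi U (m : nat) (x : 'rV[R]_d) (t : R) (w : Omega)
    : 'rV[R]_d :=
  let n := Num.truncn (m%:R * t) in
  let X k := m%:R^-1 *: walk le p xi U m (m%:R *: x) k w in
  X n + (m%:R * t - n%:R) *: (X n.+1 - X n).

Definition target (m : nat) (l : R) (x : 'rV[R]_d) :=
  [/\ integral_vector (m%:R *: x), cube x &
      l1norm x = m%:R^-1 * (Num.floor (m%:R * l))%:~R].

Definition deadlock_time le p xi U (m : nat) (l : R) (x : 'rV[R]_d)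
    (w : Omega) : \bar R :=
  ereal_inf [set t%:E | t in
    [set t : R | 0 <= t /\ target m l (scaled_walk le p xi U m x t w)]].

End Walk.

Section Probability.
Context {R : realType} {disp : measure_display} {Omega : measurableType disp}.
Implicit Types Pr : probability Omega R.

Definition markov_chain (E : finType) Pr (xi : nat -> Omega -> E)
    (P : E -> E -> R) (i : E) :=
  [/\ forall n e, measurable (xi n @^-1` [set e]),
      Pr (xi 0%N @^-1` [set i]) = 1%E &
      forall n (e : nat -> E),
        Pr (\bigcap_(k in `I_n.+2) (xi k @^-1` [set e k])) =
        (Pr (\bigcap_(k in `I_n.+1) (xi k @^-1` [set e k]))
           * (P (e n) (e n.+1))%:E)%E].

Definition iid_uniform Pr (U : nat -> Omega -> R) :=
  [/\ forall n, measurable_fun setT (U n),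
      forall n (B : set R), measurable B ->
        Pr (U n @^-1` B) = uniform_prob (@ltr01 R) B &
      forall n (B : nat -> set R), (forall k, measurable (B k)) ->
        Pr (\bigcap_(k in `I_n) (U k @^-1` B k)) =
        (\prod_(k < n) Pr (U k @^-1` B k))%E].

(* The sigma-algebras generated by the two processes are independent. *)
Definition independent_processes (E : finType) Pr
    (xi : nat -> Omega -> E) (U : nat -> Omega -> R) :=
  forall A B : set Omega,
    <<s [set C | exists n e, C = xi n @^-1` [set e]] >> A ->
    <<s [set C | exists n (D : set R), measurable D /\ C = U n @^-1` D] >> B ->
    Pr (A `&` B) = (Pr A * Pr B)%E.

(* Weak convergence to nu of the laws of the [0,+oo]-valued variables Y_m. The
   test function 1 shows that no mass is lost where Y_m is infinite. *)
Definition cvg_in_law Pr (Y : nat -> Omega -> \bar R)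
    (nu : set (measurableTypeR R) -> \bar R) :=
  forall g : R -> R, continuous g -> (exists M, forall r, `|g r| <= M) ->
    (\int[Pr]_(w in [set w | Y m w \is a fin_num]) (g (fine (Y m w)))%:E)%E
      @[m --> \oo] --> (\int[nu]_r (g r)%:E)%E.

(* The infimum is a minimum as soon as it is positive and the set is nonempty,
   by right-continuity of the tail of tau. *)
Definition tail_quantile Pr (tau : Omega -> \bar R) : R :=
  inf [set t : R | 0 < t /\
         (Pr [set w | (t%:E < tau w)%E] <= (expR (- 1))%:E)%E].

End Probability.

(* Main.v *)
Require Import Defs.
From mathcomp Require Import all_boot all_order all_algebra.
From mathcomp Require Import all_classical all_reals all_analysis.
From mathcomp Require Import measurable_realfun lra ring.
Import Order.TTheory GRing.Theory Num.Theory.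
Import numFieldNormedType.Exports.
Local Open Scope classical_set_scope.
Local Open Scope ring_scope.

Set Implicit Arguments.
Unset Strict Implicit.
Unset Printing Implicit Defensive.

(** Measure time in steps, and let sigma be the first step at which the walk is
    on the target level |X|_1 = floor (m l); then tau = sigma / m.  The pair
    (position, environment) is a Markov chain with finitely many successors at
    each state, and the theorem is the classical statement that an exit time
    which is much longer than the relaxation time is asymptotically exponential,
    because the chain forgets its past before it exits.  The memory is lost at
    the atom (0, i), a single state at which the chain starts afresh, so that no
    comparison between different starting points is needed.

    Two time scales are separated.  On the one hand, reaching the target takes at
    least exp (c m) steps, with high probability (slow_exit).  On the other hand,
    for every b > 0, the chain meets the atom or the target within exp (b m) steps,
    from any starting point, with a probability that tends to one (atom_fast).

    Both rest on one Lyapunov function (lyapunov), which is where the contraction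
    hypothesis enters.  The l^1 norm itself is not a supermartingale: its drift is
    perturbed by the reflection at the faces x_j = 0 and by the environment.  The
    first effect disappears when |x_j| is replaced by a function that is quadratic
    below a small macroscopic level eps; the price is of order eps, because the
    contraction inequality between 0 and the point obtained from x by deleting its
    small coordinates bounds exactly the resulting weighted drift by - kappa |x|_1
    plus the same weighted drift at 0 (weighted_drift).  The second effect is
    removed by a corrector, a solution of the Poisson equation of the environment
    (poisson_equation), which replaces the drift at 0 by its average against mu;
    this average is nonpositive in every coordinate, since 0 is an equilibrium of
    the reflected equation (drift_origin_le0).  The exponential of the corrected
    norm then decreases in mean, at a constant rate, outside of any ball of radius
    delta m, which gives both an exit time exponential in m and a return to this
    ball in O(m) steps.  From a point of the ball the atom is reached by at most
    delta m downward steps, followed by oscillations between 0 and a neighbour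
    during which the environment travels to i; an even number of steps must bring
    it there, and this is what the irreducibility of P^2 provides.  As delta is
    arbitrary, these trials succeed with a probability larger than exp (- b m).

    Write f_m(n) for the probability that sigma > n from the atom.  Restarting at
    the atom yields f_m(n + k) = f_m(n) f_m(k) + o(1) uniformly in n and k
    (surv_submul, surv_supmul, almost_multiplicative), hence
    f_m(s N_m) -> exp (- s) as soon as f_m(N_m) -> exp (-1) (exponential_limit).
    The starting point x_m is treated in the same way, and the convergence of the
    tails gives weak convergence (weak_convergence_of_tails). *)

(** * Survival probabilities of a Markov chain with finitely many successors *)

Section Survival.
Context {R : realFieldType} {T : Type} {B : finType}.
Variables (q : T -> B -> R) (st : T -> B -> T).
Hypothesis q_ge0 : forall z b, 0 <= q z b.
Hypothesis q_sum1 : forall z, \sum_b q z b = 1.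
Implicit Types (S : T -> bool) (F G : T -> R) (D : T -> Prop).

Definition avg F z : R := \sum_b q z b * F (st z b).

(** The probability, from z, that the chain avoids S at the times 0, ..., n. *)
Fixpoint surv S n z : R :=
  if S z then 0 else if n is n'.+1 then avg (surv S n') z else 1.

Lemma le_avg F G z : (forall b, F (st z b) <= G (st z b)) -> avg F z <= avg G z.
Proof. by move=> FG; apply: ler_sum => b _; rewrite ler_wpM2l. Qed.

Lemma avg_affine F a c z : avg (fun y => a * F y + c) z = a * avg F z + c.
Proof.
rewrite /avg mulr_sumr -[c in RHS]mul1r -(q_sum1 z) mulr_suml -big_split /=.
by apply: eq_bigr => b _; ring.
Qed.

Lemma avg_cst c z : avg (fun=> c) z = c.
Proof. by rewrite /avg -mulr_suml q_sum1 mul1r. Qed.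

Lemma avg_scale F a z : avg (fun y => a * F y) z = a * avg F z.
Proof. by rewrite /avg mulr_sumr; apply: eq_bigr => b _; ring. Qed.

Lemma avgD F G z : avg (fun y => F y + G y) z = avg F z + avg G z.
Proof. by rewrite /avg -big_split /=; apply: eq_bigr => b _; ring. Qed.

Lemma avgB F G z : avg (fun y => F y - G y) z = avg F z - avg G z.
Proof. by rewrite /avg -sumrB /=; apply: eq_bigr => b _; ring. Qed.

Lemma surv_in S n z : S z -> surv S n z = 0.
Proof. by case: n => [|n] /= ->. Qed.

Lemma surv0 S z : ~~ S z -> surv S 0 z = 1.
Proof. by move=> /= /negPf ->. Qed.

Lemma survS S n z : ~~ S z -> surv S n.+1 z = avg (surv S n) z.
Proof. by move=> /= /negPf ->. Qed.

Lemma surv_itv S n z : 0 <= surv S n z <= 1.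
Proof.
elim: n z => [|n IH] z /=; case: ifP => // _; rewrite ?lexx ?ler01//.
rewrite -{1}(avg_cst 0 z) -(avg_cst 1 z).
by rewrite !le_avg// => b; case/andP: (IH (st z b)).
Qed.

Lemma surv_ge0 S n z : 0 <= surv S n z.
Proof. by case/andP: (surv_itv S n z). Qed.

Lemma surv_le1 S n z : surv S n z <= 1.
Proof. by case/andP: (surv_itv S n z). Qed.

Lemma survS_le S n z : surv S n.+1 z <= surv S n z.
Proof.
elim: n z => [|n IH] z.
  have [Sz|Sz] := boolP (S z); first by rewrite !surv_in.
  by rewrite surv0// surv_le1.
have [Sz|Sz] := boolP (S z); first by rewrite !surv_in.
by rewrite !(survS _ Sz) le_avg.
Qed.

Lemma surv_anti S n k z : (n <= k)%N -> surv S k z <= surv S n z.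
Proof.
move=> /subnK <-; elim: (k - n)%N => [|j IH]; first by rewrite add0n.
by rewrite addSn (le_trans (survS_le _ _ _)).
Qed.

Lemma surv_sub S S' n z : (forall y, S y -> S' y) -> surv S' n z <= surv S n z.
Proof.
move=> SS'; elim: n z => [|n IH] z /=.
  by case: (boolP (S z)) => [/SS' ->//|_]; case: ifP.
case: (boolP (S z)) => [/SS' ->//|_]; case: ifP => _; last by apply: le_avg.
by rewrite -{1}(avg_cst 0 z) le_avg// => b; rewrite surv_ge0.
Qed.

Section Domain.
Variables (D : T -> Prop).
Hypothesis D_st : forall z b, D z -> D (st z b).

(** Markov property at time n. *)
Lemma surv_mul S k beta : (forall z, D z -> surv S k z <= beta) ->
  forall n z, D z -> surv S (n + k) z <= beta * surv S n z.
Proof.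
move=> Hk; elim=> [|n IH] z Dz.
  have [Sz|Sz] := boolP (S z); first by rewrite !surv_in// mulr0.
  by rewrite add0n surv0// mulr1 Hk.
have [Sz|Sz] := boolP (S z); first by rewrite !surv_in// mulr0.
rewrite addSn !(survS _ Sz) -avg_scale; apply: le_avg => b.
exact: IH (D_st b Dz).
Qed.

Lemma surv_iter S k beta : (forall z, D z -> surv S k z <= beta) ->
  forall j z, D z -> surv S (j * k) z <= beta ^+ j.
Proof.
move=> Hk; elim=> [|j IH] z Dz; first by rewrite mul0n expr0 surv_le1.
have beta_ge0 : 0 <= beta by apply: le_trans (Hk z Dz); exact: surv_ge0.
rewrite mulSn addnC (le_trans (surv_mul Hk _ Dz))// exprS ler_wpM2l//.
exact: IH.
Qed.

(* T has no decidable equality; the atom a is seen through a predicate whose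
   elements have the same survival probabilities as a. *)
Variables (S At : T -> bool) (a : T).
Hypothesis At_a : forall z n, At z -> surv S n z = surv S n a.
Let f n := surv S n a.
Let SA z := S z || At z.

(** Either the atom is met before time n, and the chain must then survive for k
    more steps from it, or neither S nor the atom is met before time n. *)
Lemma surv_le_atom n k z : surv S (n + k) z <= f k + surv SA n z.
Proof.
elim: n z => [|n IH] z.
  have [Sz|Sz] := boolP (S z); first by rewrite surv_in// addr_ge0 ?surv_ge0.
  have [Az|Az] := boolP (At z).
    by rewrite At_a// lerDl surv_ge0.
  rewrite [X in _ + X]surv0 ?negb_or ?Sz//.
  by rewrite (le_trans (surv_le1 _ _ _))// lerDr surv_ge0.
have [Sz|Sz] := boolP (S z); first by rewrite surv_in// addr_ge0 ?surv_ge0.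
have [Az|Az] := boolP (At z).
  rewrite At_a// -[leLHS]addr0 lerD ?surv_ge0// surv_anti// leq_addl//.
rewrite addSn survS// (survS (S := SA)) ?negb_or ?Sz//.
rewrite -[f k](avg_cst _ z) -avgD; apply: le_avg => b; exact: IH.
Qed.

(** The difference on the left is the probability that the atom is met before
    time n without prior exit; from then on, surviving for k steps suffices. *)
Lemma surv_ge_atom n k z : (surv S n z - surv SA n z) * f k <= surv S k z.
Proof.
have sub m y : surv SA m y <= surv S m y.
  by apply: surv_sub => w Sw; rewrite /SA Sw.
elim: n k z => [|n IH] k z.
  have [Sz|Sz] := boolP (S z); first by rewrite !surv_in /SA ?Sz// subrr mul0r.
  have [Az|Az] := boolP (At z).
    rewrite [surv SA _ _]surv_in /SA ?Az ?orbT// subr0 [leRHS]At_a//.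
    by rewrite ler_piMl ?surv_le1 ?surv_ge0.
  by rewrite !surv0 /SA ?negb_or ?Sz// subrr mul0r surv_ge0.
have [Sz|Sz] := boolP (S z); first by rewrite !surv_in /SA ?Sz// subrr mul0r.
have [Az|Az] := boolP (At z).
  rewrite [surv SA _ _]surv_in /SA ?Az ?orbT// subr0 [leRHS]At_a//.
  by rewrite ler_piMl ?surv_le1 ?surv_ge0.
case: k => [|k].
  rewrite [leRHS]surv0// mulr_ile1 ?subr_ge0 ?surv_ge0 ?surv_le1//.
  by rewrite lerBlDr (le_trans (surv_le1 _ _ _))// lerDl surv_ge0.
rewrite (survS _ Sz) (survS (S := SA)) ?negb_or ?Sz// (survS _ Sz) -avgB.
rewrite mulrC -avg_scale; apply: le_avg => b; rewrite mulrC.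
apply: le_trans (IH k (st z b)).
by rewrite ler_wpM2l ?subr_ge0// survS_le.
Qed.

Variables (r : nat) (eps : R).
Hypothesis atom_fast : forall z, D z -> surv SA r z <= eps.

(** After time n, wait at most r steps for the atom, then forget the past. *)
Lemma surv_submul n k z : D z ->
  surv S (n + (r + k)) z <= (f k + eps) * surv S n z.
Proof.
apply: surv_mul => y Dy.
by rewrite (le_trans (surv_le_atom _ _ _))// lerD2l atom_fast.
Qed.

(** A chain that survives until n + r has met the atom between n and n + r, up to
    an event of probability at most eps; survival for k more steps from there
    implies survival until n + k. *)
Lemma surv_supmul n k z : D z ->
  f k * (surv S (n + r) z - eps * surv S n z) <= surv S (n + k) z.
Proof.
elim: n z => [|n IH] z Dz.
  have [Sz|Sz] := boolP (S z); first by rewrite !surv_in// mulr0 subr0 mulr0.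
  rewrite !add0n (surv0 Sz) mulr1 (le_trans _ (surv_ge_atom r k z))// mulrC.
  by rewrite ler_wpM2r ?surv_ge0// lerD2l lerN2 atom_fast.
have [Sz|Sz] := boolP (S z); first by rewrite !surv_in// mulr0 subr0 mulr0.
rewrite !addSn !(survS _ Sz) -avg_scale -avgB -avg_scale.
apply: le_avg => b; exact: IH (D_st b Dz).
Qed.

End Domain.
End Survival.

(** * From approximate multiplicativity to the exponential law *)

Section AlmostMultiplicative.
Context {R : realFieldType}.
Variables (f : nat -> R) (r S : nat) (e : R).
Hypothesis e_ge0 : 0 <= e.
Hypothesis f_itv : forall n, 0 <= f n <= 1.
Hypothesis f_anti : forall n k, (n <= k)%N -> f k <= f n.
Hypothesis f_sub : forall n k, f (n + (r + k)) <= (f k + e) * f n.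
Hypothesis f_sup : forall n k, f k * (f (n + r) - e * f n) <= f (n + k).
Hypothesis f_long : 1 - e <= f S.

(** For n < r this follows from the survival until S; otherwise it is [f_sup] at
    n - r and k + r, with f (k + r) close to one. *)
Lemma slowly_varying n k : (k + r <= S)%N -> f n - 2 * e <= f (n + k).
Proof.
have e0 := e_ge0; move=> krS; have fS : 1 - e <= f (k + r) by rewrite (le_trans f_long) ?f_anti.
have [nr|rn] := ltnP n r.
  have : f (k + r) <= f (n + k) by rewrite f_anti// addnC leq_add2l ltnW.
  by have /andP[_ fn1] := f_itv n => ?; lra.
have := f_sup (n - r) (k + r).
have -> : (n - r + (k + r) = n + k)%N by rewrite addnCA subnK// addnC.
rewrite subnK//.
have /andP[_ f1] := f_itv (n - r); have /andP[fn0 _] := f_itv n.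
have /andP[fk0 _] := f_itv (n + k); have /andP[_ fk1] := f_itv (k + r).
have ef : e * f (n - r) <= e by rewrite ler_piMr.
have [fn_le|fn_gt] := leP (f n) e; first by lra.
move=> sup; suff : (1 - e) * (f n - e) <= f (n + k).
  have : 0 <= e * (1 - f n) by rewrite mulr_ge0// subr_ge0; case/andP: (f_itv n).
  have : 0 <= e * e by rewrite mulr_ge0.
  by nra.
apply: le_trans sup; apply: le_trans (_ : f (k + r) * (f n - e) <= _).
  by rewrite ler_wpM2r// subr_ge0 ltW.
by rewrite ler_wpM2l ?lerD2l ?lerN2//; case/andP: (f_itv (k + r)).
Qed.

(** The shifts by r in [f_sub] and [f_sup] cost little by slow variation. *)
Lemma almost_multiplicative n k : (r + r <= S)%N ->
  `|f (n + k) - f n * f k| <= 3 * e.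
Proof.
have e0 := e_ge0; move=> rrS; have /andP[fn0 fn1] := f_itv n; have /andP[fk0 fk1] := f_itv k.
rewrite ler_distl; apply/andP; split.
  have := f_sup n k; have := slowly_varying n rrS.
  have : e * f n <= e by rewrite ler_piMr.
  move=> ef slow sup; have : f k * (f n - 3 * e) <= f (n + k); last by nra.
  by apply: le_trans sup; rewrite ler_wpM2l//; lra.
have := f_sub n k; have := slowly_varying (n + k) rrS.
rewrite -addnA (addnC k) => slow sub.
have : e * f n <= e by rewrite ler_piMr.
by nra.
Qed.

End AlmostMultiplicative.

Section ExponentialLimit.
Context {R : realType}.

Lemma expRN_lipschitz (a b : R) : 0 <= a -> a <= b ->
  expR (- a) - (b - a) <= expR (- b).
Proof.
move=> a0 ab; have -> : - b = - a + - (b - a) by ring.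
rewrite expRD; have := expR_ge1Dx (- (b - a)).
have : expR (- a) <= 1 by rewrite -[X in _ <= X]expR0 ler_expR oppr_le0.
have := expR_gt0 (- a); have : 0 <= b - a by rewrite subr_ge0.
by nra.
Qed.

Variables (f : nat -> nat -> R) (N : nat -> nat).
Hypothesis f_itv : forall m n, 0 <= f m n <= 1.
Hypothesis f_anti : forall m n k, (n <= k)%N -> f m k <= f m n.
Hypothesis f_mul : forall e : R, 0 < e ->
  \forall m \near \oo, forall n k, `|f m (n + k) - f m n * f m k| <= e.
Hypothesis f_slow : forall (e : R) (c : nat), 0 < e ->
  \forall m \near \oo, forall n, f m n - e <= f m (n + c).
Hypothesis f_N : f m (N m) @[m --> \oo] --> expR (-1 : R).

Lemma almost_power e : 0 < e -> forall j, \forall m \near \oo,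
  forall n, `|f m (j.+1 * n) - f m n ^+ j.+1| <= e.
Proof.
move=> e0 j; have e'0 : 0 < e / j.+1%:R by rewrite divr_gt0.
near=> m => n.
have mul : forall n k, `|f m (n + k) - f m n * f m k| <= e / j.+1%:R.
  by near: m; exact: f_mul.
suff : forall i, `|f m (i.+1 * n) - f m n ^+ i.+1| <= i%:R * (e / j.+1%:R).
  move=> /(_ j) /le_trans; apply; rewrite mulrCA ger_pMr//.
  by rewrite ler_pdivrMr// mul1r ler_nat.
elim=> [|i IH]; first by rewrite mul1n expr1 subrr normr0 mul0r.
have -> : f m (i.+2 * n) - f m n ^+ i.+2 =
  (f m (i.+1 * n + n) - f m (i.+1 * n) * f m n)
  + (f m (i.+1 * n) - f m n ^+ i.+1) * f m n.
  by rewrite mulSn addnC [in RHS]mulrBl -exprSr; ring.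
rewrite (le_trans (ler_normD _ _))// -(natr1 i) [leRHS]mulrDl mul1r addrC lerD//.
rewrite normrM (le_trans _ IH)// ler_piMr// ger0_norm; by case/andP: (f_itv m n).
Unshelve. all: by end_near. Qed.

(** The (q+1)-st power of this sequence is close to f m (N m), up to the remainder
    of the division, which slow variation makes negligible. *)
Lemma root_limit (q : nat) : f m (N m %/ q.+1) @[m --> \oo] --> expR (- q.+1%:R^-1 : R).
Proof.
set b := expR _; have b0 : 0 < b ^+ q by rewrite exprn_gt0// expR_gt0.
have bq : b ^+ q.+1 = expR (-1).
  by rewrite /b -expRM_natl mulrN mulfV.
apply/cvgrPdist_le => e e0; have e'0 : 0 < e * b ^+ q / 3 by rewrite divr_gt0 ?mulr_gt0.
near=> m.
set n := (N m %/ q.+1)%N; set a := f m n.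
have pow : `|f m (q.+1 * n) - a ^+ q.+1| <= e * b ^+ q / 3.
  by rewrite /a; move: n @a; near: m; exact: almost_power.
have slow : f m (q.+1 * n) - e * b ^+ q / 3 <= f m (q.+1 * n + q.+1).
  by move: n @a pow => n _ _; move: (q.+1 * n)%N; near: m; exact: f_slow.
have lim : `|expR (- 1) - f m (N m)| <= e * b ^+ q / 3.
  by near: m; move/cvgrPdist_le: f_N; exact.
have up : f m (N m) <= f m (q.+1 * n).
  by apply: f_anti; rewrite mulnC leq_divM.
have low : f m (q.+1 * n + q.+1) <= f m (N m).
  by apply: f_anti; rewrite -mulnSr mulnC ltnW// ltn_ceil.
have close : `|b ^+ q.+1 - a ^+ q.+1| <= e * b ^+ q.
  move: pow slow lim; rewrite bq !ler_distl; lra.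
have a0 : 0 <= a by case/andP: (f_itv m n).
rewrite -(ler_pM2r b0) (le_trans _ close)// subrXX normrM ler_wpM2l//.
rewrite ger0_norm; last first.
  by rewrite sumr_ge0// => i _; rewrite mulr_ge0 ?exprn_ge0// expR_ge0.
rewrite big_ord_recl /= subn0 expr0 mulr1 lerDl sumr_ge0// => i _.
by rewrite mulr_ge0 ?exprn_ge0// expR_ge0.
Unshelve. all: by end_near. Qed.

Lemma multiple_limit (q j : nat) :
  f m (j.+1 * (N m %/ q.+1)) @[m --> \oo] --> expR (- (j.+1%:R / q.+1%:R) : R).
Proof.
have powlim : f m (N m %/ q.+1) ^+ j.+1 @[m --> \oo] --> expR (- (j.+1%:R / q.+1%:R) : R).
  rewrite -mulrN expRM_natl.
  elim: (j) => [|i IH]; first by under eq_fun do rewrite expr1; rewrite expr1; exact: root_limit.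
  under eq_fun do rewrite exprS; rewrite exprS; apply: cvgM IH; exact: root_limit.
apply/cvgrPdist_le => e e0; have e'0 : 0 < e / 2 by rewrite divr_gt0.
near=> m.
have H : `|f m (j.+1 * (N m %/ q.+1)) - f m (N m %/ q.+1) ^+ j.+1| <= e / 2.
  by move: (N m %/ q.+1)%N; near: m; exact: almost_power.
have H' : `|expR (- (j.+1%:R / q.+1%:R)) - f m (N m %/ q.+1) ^+ j.+1| <= e / 2.
  by near: m; move/cvgrPdist_le : powlim; exact.
by move: H H'; rewrite !ler_distl; lra.
Unshelve. all: by end_near. Qed.

(** By monotonicity the value at s N is squeezed between those at the multiples j
    and j + 1 of N / q, where j / q approximates s from below. *)
Lemma exponential_limit (s : R) : 0 <= s ->
  f m (Num.truncn (s * (N m)%:R)) @[m --> \oo] --> expR (- s).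
Proof.
move=> s0; apply/cvgrPdist_le => e e0.
pose q := Num.truncn (2 / e).
have q_e : q.+1%:R^-1 <= e / 2 :> R.
  rewrite -(invf_div 2 e) lef_pV2 ?posrE ?divr_gt0//; exact/ltW/truncnS_gt.
pose j := Num.truncn (s * q.+1%:R).
have sq0 : 0 <= s * q.+1%:R by rewrite mulr_ge0.
have jle : j%:R / q.+1%:R <= s by rewrite ler_pdivrMr// truncn_le.
have jgt : s <= j.+1%:R / q.+1%:R by rewrite ler_pdivlMr//; exact/ltW/truncnS_gt.
have jS : j.+1%:R / q.+1%:R = j%:R / q.+1%:R + q.+1%:R^-1 :> R.
  by rewrite -(natr1 j) mulrDl mul1r.
have j0 : 0 <= j%:R / q.+1%:R :> R by rewrite divr_ge0.
have upper_near : \forall m \near \oo,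
    f m (j * (N m %/ q.+1)) <= expR (- (j%:R / q.+1%:R)) + e / 2.
  case: (j) => [|i].
    apply: nearW => m; rewrite mul0r oppr0 expR0.
    by have /andP[_] := f_itv m (0 * (N m %/ q.+1))%N; lra.
  move/cvgrPdist_le: (@multiple_limit q i) => /(_ (e / 2)).
  rewrite divr_gt0// => /(_ isT); apply: filterS => m.
  by rewrite ler_distl; lra.
near=> m.
have trunc_le : (j * (N m %/ q.+1) <= Num.truncn (s * (N m)%:R))%N.
  rewrite truncn_ge_nat ?mulr_ge0// natrM.
  rewrite (@le_trans _ _ (j%:R * ((N m)%:R / q.+1%:R)))//.
    by rewrite ler_wpM2l// ler_pdivlMr// -natrM ler_nat leq_divM.
  by rewrite mulrCA mulrC ler_wpM2r.
have trunc_ge : (Num.truncn (s * (N m)%:R) <= j.+1 * (N m %/ q.+1) + j.+1)%N.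
  rewrite -mulnSr -(ler_nat R); apply: (@le_trans _ _ (s * (N m)%:R)); rewrite ?truncn_le ?mulr_ge0// natrM.
  rewrite (@le_trans _ _ (j.+1%:R * ((N m)%:R / q.+1%:R)))//.
    by rewrite mulrCA [leRHS]mulrC ler_wpM2r.
  rewrite ler_wpM2l// ler_pdivrMr// -natrM ler_nat ltnW// ltn_ceil//.
have lowlim : `|expR (- (j.+1%:R / q.+1%:R)) - f m (j.+1 * (N m %/ q.+1))| <= e / 4.
  near: m; move: (@multiple_limit q j) => /cvgrPdist_le; apply.
  by rewrite divr_gt0.
have slow : f m (j.+1 * (N m %/ q.+1)) - e / 4 <= f m (j.+1 * (N m %/ q.+1) + j.+1).
  by move: (j.+1 * (N m %/ q.+1))%N; near: m; apply: f_slow; rewrite divr_gt0.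
have low := f_anti m trunc_ge.
have up := f_anti m trunc_le.
have L1 := expRN_lipschitz j0 jle.
have L2 := expRN_lipschitz s0 jgt.
have uplim : f m (j * (N m %/ q.+1)) <= expR (- (j%:R / q.+1%:R)) + e / 2.
  by near: m; exact: upper_near.
move: lowlim uplim L1 L2 slow low up jS q_e jle jgt.
move: (j%:R / q.+1%:R : R) (j.+1%:R / q.+1%:R : R) (q.+1%:R^-1 : R) => A B C.
rewrite !ler_distl => /andP[? ?] *; apply/andP; split; lra.
Unshelve. all: by end_near. Qed.

End ExponentialLimit.

(** * Weak convergence from the convergence of tails *)

Section StepApproximation.
Context {R : realType} {disp : measure_display} {Omega : measurableType disp}.
Variables (Pr : probability Omega R) (Y : Omega -> \bar R).
Hypothesis Y_gtNy : forall w, (-oo < Y w)%E.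

Definition upper (s : R) : set Omega := [set w | (s%:E < Y w)%E].
Definition tail (s : R) : R := fine (Pr (upper s)).

Hypothesis measurable_upper : forall s : R, measurable (upper s).

Lemma measurable_Y : measurable_fun setT Y.
Proof.
apply: (measurability _ (ErealGenOInfty.measurableE R)) => // _ [_ [x ->] <-].
rewrite setTI (_ : _ @^-1` _ = upper x); first exact: measurable_upper.
by apply/seteqP; split => w /=; rewrite /upper /= in_itv/= andbT.
Qed.

Definition above s : Omega -> R := \1_(upper s).

Lemma above_integrable s : Pr.-integrable setT (EFin \o above s).
Proof. exact/integrable_indic/measurable_upper. Qed.

Lemma Rintegral_above s : (\int[Pr]_w above s w)%R = tail s.
Proof. by rewrite /Rintegral integral_indic ?setIT//; exact: measurable_upper. Qed.

Lemma cst_integrable (c : R) : Pr.-integrable setT (EFin \o cst c).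
Proof. exact: finite_measure_integrable_cst. Qed.

Lemma Rintegral_cst1 (c : R) : (\int[Pr]_w (cst c w))%R = c.
Proof.
by apply: etrans (mulr1 c); rewrite Rintegral_cst//; congr (_ * _); rewrite -[RHS]/(fine 1%E) -(probability_setT Pr).
Qed.

Lemma integrable_scale (c : R) (F : Omega -> R) :
  Pr.-integrable setT (EFin \o F) -> Pr.-integrable setT (EFin \o (fun w => c * F w)).
Proof.
move=> iF; rewrite (_ : _ \o _ = (fun w => c%:E * (EFin \o F) w)%E).
  exact: integrableZl.
by apply/funext => w /=; rewrite EFinM.
Qed.

Lemma integrable_add (F G : Omega -> R) :
  Pr.-integrable setT (EFin \o F) -> Pr.-integrable setT (EFin \o G) ->
  Pr.-integrable setT (EFin \o (fun w => F w + G w)).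
Proof. by move=> iF iG; rewrite (_ : _ \o _ = ((EFin \o F) \+ (EFin \o G)))//; exact: integrableD. Qed.

Variables (t c : nat -> R).

Definition step n w : R := \sum_(k < n) c k * (above (t k) w - above (t k.+1) w).

Lemma step_integrable n : Pr.-integrable setT (EFin \o step n) /\
  (\int[Pr]_w step n w)%R = \sum_(k < n) c k * (tail (t k) - tail (t k.+1)).
Proof.
have stepS m : step m.+1 =
    (fun w => step m w + c m * (above (t m) w + (-1) * above (t m.+1) w)).
  by apply/funext => w; rewrite /step big_ord_recr/= mulN1r.
have iB m : Pr.-integrable setT
    (EFin \o (fun w => above (t m) w + (-1) * above (t m.+1) w)).
  by apply: integrable_add; [|apply: integrable_scale]; exact: above_integrable.
elim: n => [|n [iS IH]].
  rewrite (_ : step 0 = cst 0); last by apply/funext => w; rewrite /step big_ord0.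
  by rewrite Rintegral_cst1 big_ord0; split => //; exact: cst_integrable.
rewrite stepS; split.
  by apply: integrable_add => //; exact: integrable_scale.
rewrite RintegralD//; last exact: integrable_scale.
rewrite IH RintegralZl// RintegralD//; last 2 first.
- exact: above_integrable.
- by apply: integrable_scale; exact: above_integrable.
rewrite RintegralZl//; last exact: above_integrable.
by rewrite !Rintegral_above big_ord_recr /= mulN1r.
Qed.

Variables (g : R -> R) (M e : R).
Hypothesis g_cont : continuous g.
Hypothesis g_bound : forall r, `|g r| <= M.
Hypothesis e_ge0 : 0 <= e.
Hypothesis t0 : t 0%N = 0.
Hypothesis t_mono : forall k, t k <= t k.+1.

Let D : set Omega := [set w | Y w \is a fin_num].

Let mD : measurable D.
Proof.
have -> : D = setT `&` [set w | Y w \is a fin_num] by rewrite setTI.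
exact: emeasurable_fin_num measurable_Y.
Qed.

Definition observed (w : Omega) : R := if Y w \is a fin_num then g (fine (Y w)) else 0.

Lemma observed_bound w : `|observed w| <= M.
Proof.
rewrite /observed; case: (_ \is a _); first exact: g_bound.
by rewrite normr0 (le_trans _ (g_bound 0)).
Qed.

Lemma observed_integrable : Pr.-integrable setT (EFin \o observed).
Proof.
apply: measurable_bounded_integrable => //.
- by rewrite (le_lt_trans (probability_le1 _ _))// ltry.
- rewrite (_ : observed = (g \o fine \o Y) \_ D); last first.
    apply/funext => w; rewrite /observed patchE; case: ifPn => h.
      by rewrite mem_set.
    by rewrite memNset//; exact/negP.
  apply/(measurable_restrictT _ mD); apply: measurable_funTS.
  apply: measurableT_comp; last exact: measurable_Y.
  apply: measurableT_comp; last exact: fine_measurable.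
  exact: continuous_measurable_fun.
- exists M; split; first exact: num_real.
  by move=> x Mx w _; exact: le_trans (observed_bound w) (ltW Mx).
Qed.

Lemma integral_observed :
  (\int[Pr]_(w in D) (g (fine (Y w)))%:E = (\int[Pr]_w observed w)%R%:E)%E.
Proof.
rewrite /Rintegral fineK; last exact: integrable_fin_num observed_integrable.
rewrite [LHS]integral_mkcond; apply: eq_integral => w _.
rewrite patchE /observed; case: ifPn.
  by rewrite inE /D /= => ->.
by rewrite notin_setE /D /= => /negP/negPf ->.
Qed.

Lemma aboveE s w r : Y w = r%:E -> above s w = (s < r)%R%:R.
Proof. by move=> Yw; rewrite /above indicE; congr (nat_of_bool _)%:R; apply/idP/idP; rewrite inE /upper /= Yw lte_fin. Qed.

Lemma step_close n w r : Y w = r%:E -> 0 < r -> r <= t n ->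
  (forall k x, (k < n)%N -> t k < x -> x <= t k.+1 -> `|g x - c k| <= e) ->
  `|g r - step n w| <= e.
Proof.
move=> Yw r0; elim: n => [|n IH] rt osc; first by move: r0; rewrite ltNge -t0 rt.
rewrite /step big_ord_recr /= !(aboveE _ Yw).
have [rtn|rtn] := leP r (t n).
  rewrite ltNge (le_trans rtn (t_mono n)) subrr mulr0 addr0.
  by apply: IH => // k x kn; apply: osc; rewrite ltnS ltnW.
rewrite ltNge rt subr0 mulr1 big1 ?add0r; first exact: osc.
move=> k _; rewrite !(aboveE _ Yw).
have tr j : (j <= n)%N -> t j < r.
  move=> jn; apply: le_lt_trans rtn; move: jn.
  by apply: (homo_leq (r := fun x y => x <= y)) => //; exact: le_trans.
by rewrite !tr ?subrr ?mulr0// ltnW.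
Qed.

(** On 0 < Y <= t n the step function is within e of the integrand; elsewhere it
    vanishes, and the integrand is bounded by M. *)
Lemma observed_step n w :
  (forall k x, (k < n)%N -> t k < x -> x <= t k.+1 -> `|g x - c k| <= e) ->
  `|observed w - step n w| <= e + (M * (1 + (-1) * above 0 w) + M * above (t n) w).
Proof.
move=> osc; have M0 : 0 <= M by rewrite (le_trans _ (g_bound 0)).
have e0 := e_ge0.
have i01 s : 0 <= above s w <= 1 by rewrite /above indicE; case: (_ \in _); rewrite ?lexx ?ler01.
have nn : 0 <= M * (1 + (-1) * above 0 w) + M * above (t n) w.
  have /andP[? ?] := i01 0; have /andP[? ?] := i01 (t n).
  by rewrite addr_ge0// mulr_ge0//; lra.
have tn0 j : 0 <= t j by elim: j => [|j IH]; rewrite ?t0// (le_trans IH).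
rewrite /observed; case: (boolP (Y w \is a fin_num)) => [Yfin|Yinf]; last first.
  have Yoo : Y w = +oo%E by move: Yinf (Y_gtNy w); case: (Y w).
  have i1 s : above s w = 1 by rewrite /above indicE mem_set// /upper /= Yoo ltry.
  rewrite /step big1 ?subrr ?normr0; first exact: addr_ge0.
  by move=> k _; rewrite !i1 subrr mulr0.
have Yw : Y w = (fine (Y w))%:E by rewrite fineK.
move: (fine (Y w)) Yw => r Yw.
have [rpos|rnpos] := ltP 0 r; last first.
  rewrite /step big1 ?subr0.
    rewrite !(aboveE _ Yw) !ltNge rnpos (le_trans rnpos)//= !mulr0 !addr0 mulr1.
    by rewrite (le_trans (g_bound r))// lerDr.
  by move=> k _; rewrite !(aboveE _ Yw) !ltNge !(le_trans rnpos)//= subrr mulr0.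
have [rt|rt] := leP r (t n).
  by rewrite (le_trans (step_close Yw rpos rt osc))// lerDl.
have tr j : (j <= n)%N -> t j < r.
  move=> jn; apply: le_lt_trans rt; move: jn.
  by apply: (homo_leq (r := fun x y => x <= y)) => //; exact: le_trans.
rewrite /step big1 ?subr0.
  rewrite !(aboveE _ Yw) rpos rt mulr1 subrr mulr0 add0r mulr1.
  by rewrite (le_trans (g_bound r))// lerDr.
by move=> k _; rewrite !(aboveE _ Yw) !tr ?subrr ?mulr0// ltnW.
Qed.

(** The integral of the step function only involves tails, so that two variables
    with close tails have close integrals. *)
Lemma integral_step n :
  (forall k x, (k < n)%N -> t k < x -> x <= t k.+1 -> `|g x - c k| <= e) ->
  `|(\int[Pr]_w observed w)%R - \sum_(k < n) c k * (tail (t k) - tail (t k.+1))|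
    <= e + (M * (1 - tail 0) + M * tail (t n)).
Proof.
move=> osc; have [iS <-] := step_integrable n.
pose err w := cst e w + ((M * (cst 1 w + (-1) * above 0 w)) + M * above (t n) w).
have i2 : Pr.-integrable setT (EFin \o (fun w => (-1) * above 0 w)).
  exact/integrable_scale/above_integrable.
have i1 : Pr.-integrable setT (EFin \o (fun w => cst 1 w + (-1) * above 0 w)).
  by apply: integrable_add => //; exact: cst_integrable.
have i3 : Pr.-integrable setT (EFin \o (fun w => M * above (t n) w)).
  exact/integrable_scale/above_integrable.
have i4 := integrable_scale M i1.
have i5 := integrable_add i4 i3.
have i6 := integrable_add (cst_integrable e) i5.
have errE : (\int[Pr]_w err w)%R = e + (M * (1 - tail 0) + M * tail (t n)).
  rewrite RintegralD//; last exact: cst_integrable.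
  rewrite Rintegral_cst1 RintegralD// !RintegralZl//; last exact: above_integrable.
  rewrite RintegralD//; last exact: cst_integrable.
  rewrite Rintegral_cst1 RintegralZl//; last exact: above_integrable.
  by rewrite !Rintegral_above mulN1r.
rewrite -errE ler_distl; apply/andP; split.
  rewrite lerBlDr -RintegralD//; last exact: observed_integrable.
  apply: le_Rintegral => //.
    by apply: integrable_add => //; exact: observed_integrable.
  by move=> w _; have := observed_step w osc; rewrite ler_distl lerBlDr => /andP[].
rewrite -RintegralD//; apply: le_Rintegral => //.
- exact: observed_integrable.
- exact: integrable_add.
- by move=> w _; have := observed_step w osc; rewrite ler_distl => /andP[].
Qed.

End StepApproximation.
Section WeakConvergence.
Context {R : realType}.

(** Uniform continuity at the points of [0, A]; y may leave the interval. *)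
Lemma heine_cantor (g : R -> R) (A e : R) : continuous g -> 0 < e ->
  exists2 d : R, 0 < d & forall x y, 0 <= x <= A -> `|x - y| <= d -> `|g x - g y| <= e.
Proof.
move=> g_cont e0; have e20 : 0 < e / 2 by rewrite divr_gt0.
have cov := (@compact_near_coveringP R `[0, A]).1 (@segment_compact R 0 A).
pose P (d x : R) := forall y, `|x - y| <= d -> `|g x - g y| <= e.
have : \forall d \near (0 : R)^'+, `[0, A] `<=` P d.
  apply: cov => x _.
  have /cvgrPdist_lt/(_ _ e20) := g_cont x.
  case/nbhs_ballP => r /= r0 gr.
  have r20 : 0 < r / 2 by rewrite divr_gt0.
  near=> x' d => y x'y.
  have xx' : `|x - x'| < r / 2 by near: x'; exists (r / 2).
  have dr : d < r / 2 by near: d; exact: nbhs_right_lt.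
  have gx' : `|g x - g x'| < e / 2.
    by apply: gr; rewrite /ball /= (lt_trans xx')// gtr_pMr// invf_lt1// ltr1n.
  have gy : `|g x - g y| < e / 2.
    apply: gr; rewrite /ball /=.
    have -> : x - y = (x - x') + (x' - y) by ring.
    rewrite (le_lt_trans (ler_normD _ _))// (splitr r) ltrD//.
    exact: le_lt_trans dr.
  have -> : g x' - g y = (g x - g y) - (g x - g x') by ring.
  rewrite (le_trans (ler_normB _ _))// (splitr e) lerD// ltW//.
move=> H; near (0 : R)^'+ => d.
have d0 : 0 < d by near: d; exact: nbhs_right_gt.
exists d => // x y x0A; apply: (_ : `[0, A] `<=` P d); last by rewrite /= in_itv.
by near: d.
Unshelve. all: by end_near. Qed.

Let Pexp : probability (measurableTypeR R) R :=
  exponential_distribution_exponential_prob__canonical__probability_measure_Probability (@ltr01 R).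

Lemma measurable_upperR (s : R) : measurable (upper (@EFin R) s : set (measurableTypeR R)).
Proof.
rewrite (_ : upper _ _ = `]s, +oo[%classic); first exact: measurable_itv.
by apply/seteqP; split => x; rewrite /upper /= in_itv /= andbT lte_fin.
Qed.

Lemma tail_exponential_gt0 (s : R) : 0 < s -> tail Pexp (@EFin R) s = expR (- s).
Proof.
move=> s0; have mU := measurable_upperR s.
have PC := probability_setC Pexp mU.
have E : Pexp (~` upper (@EFin R) s) = (1 - (expR (- s))%:E)%E.
  have -> : - s = - 1 * s by rewrite mulN1r.
  rewrite -exponential_prob_itv0c//.
  have -> : Pexp (~` upper (@EFin R) s) = exponential_prob 1 (~` upper (@EFin R) s) by [].
  rewrite /exponential_prob [LHS]integral_mkcond [RHS]integral_mkcond.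
  apply: eq_integral => x _; rewrite !patchE.
  have -> : (x \in ~` upper (@EFin R) s) = (x <= s).
    by apply/idP/idP; rewrite inE /upper /= lte_fin leNgt => /negP.
  have -> : (x \in `[0, s]%classic) = (0 <= x <= s).
    by apply/idP/idP; rewrite inE /= in_itv.
  have [x0|x0] := leP 0 x => //=.
  by case: ifP => // _; rewrite lt0_exponential_pdf.
have F : Pexp (upper (@EFin R) s) \is a fin_num by rewrite fin_num_measure.
move: PC E; rewrite /tail; move: F; case: (Pexp (upper _ s)) => // r _ -> /=.
by rewrite -!EFinB => -[]; lra.
Qed.

Lemma tail_le1 {disp} {Omega : measurableType disp} (Pr : probability Omega R) Y s :
  measurable (upper Y s) -> 0 <= tail Pr Y s <= 1.
Proof.
move=> mU; rewrite /tail fine_ge0//= -lee_fin fineK ?fin_num_measure//.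
exact: probability_le1.
Qed.

Lemma tail_exponential (s : R) : 0 <= s -> tail Pexp (@EFin R) s = expR (- s).
Proof.
rewrite le_eqVlt => /orP[/eqP<-|]; last exact: tail_exponential_gt0.
rewrite oppr0 expR0.
have /andP[_ t1] := tail_le1 Pexp (measurable_upperR 0).
apply/eqP; rewrite eq_le t1 /=; apply/ler_addgt0Pr => e e0.
have : tail Pexp (@EFin R) e <= tail Pexp (@EFin R) 0.
  rewrite /tail fine_le ?fin_num_measure//; try exact: measurable_upperR.
  apply: le_measure; rewrite ?inE; try exact: measurable_upperR.
  by move=> x; rewrite /upper /=; apply: lt_trans; rewrite lte_fin.
rewrite tail_exponential_gt0//; have := expR_ge1Dx (- e); lra.
Qed.

Theorem weak_convergence_of_tails {disp} {Omega : measurableType disp}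
    (Pr : probability Omega R) (Y : nat -> Omega -> \bar R) :
  (\forall m \near \oo, (forall w, (-oo < Y m w)%E) /\
                        forall s, measurable (upper (Y m) s)) ->
  (forall s : R, 0 <= s -> tail Pr (Y m) s @[m --> \oo] --> expR (- s)) ->
  cvg_in_law Pr Y (exponential_prob 1).
Proof.
move=> Yreg Ytail g g_cont [M g_bound].
have M0 : 0 <= M by rewrite (le_trans _ (g_bound 0)).
have Ey (w : measurableTypeR R) : (-oo < w%:E)%E by exact: ltNyr.
have limE : (\int[exponential_prob 1]_r (g r)%:E)%E
    = ((\int[Pexp]_w observed (@EFin R) g w)%R)%:E.
  rewrite -(integral_observed Pexp measurable_upperR g_cont g_bound).
  by congr integral; apply/seteqP; split.
rewrite limE.
suff : (\int[Pr]_w observed (Y m) g w)%R @[m --> \oo] --> (\int[Pexp]_w observed (@EFin R) g w)%R.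
  move=> cv; have cvE : ((\int[Pr]_w observed (Y m) g w)%R)%:E @[m --> \oo]
      --> ((\int[Pexp]_w observed (@EFin R) g w)%R)%:E by apply: cvg_EFin; [exact: nearW|exact: cv].
  apply: cvg_trans cvE; apply: near_eq_cvg; near=> m.
  have [Y1 Y2] : (forall w, (-oo < Y m w)%E) /\ forall s, measurable (upper (Y m) s).
    by near: m.
  by rewrite (integral_observed Pr Y2 g_cont g_bound).
apply/cvgrPdist_le => eps eps0.
have e0 : 0 < eps / 8 by rewrite divr_gt0.
have e0' := ltW e0.
pose A := M / (eps / 16) : R.
have A0 : 0 <= A by rewrite divr_ge0// divr_ge0// ltW.
have MA : M * expR (- A) <= eps / 16.
  have MA : M <= eps / 16 * expR A.
    apply: le_trans (_ : eps / 16 * (1 + A) <= _).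
      by rewrite mulrDr mulr1 /A mulrCA mulfV ?mulr1 ?gt_eqF ?divr_gt0// lerDr ltW ?divr_gt0.
    by rewrite ler_wpM2l ?expR_ge1Dx// ltW ?divr_gt0.
  by rewrite expRN ler_pdivrMr ?expR_gt0.
have [d' d'0 unif'] := @heine_cantor g (A + 1) (eps / 8) g_cont e0.
pose d := Num.min d' 1.
have d0 : 0 < d by rewrite lt_min d'0 ltr01.
have d1 : d <= 1 by rewrite ge_min lexx orbT.
have unif x y : 0 <= x <= A + 1 -> `|x - y| <= d -> `|g x - g y| <= eps / 8.
  by move=> xA xy; apply: unif' => //; rewrite (le_trans xy)// ge_min lexx.
pose n := (Num.truncn (A / d)).+1.
pose t (k : nat) := k%:R * d.
have t0 : t 0%N = 0 by rewrite /t mul0r.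
have t_mono k : t k <= t k.+1 by rewrite /t ler_pM2r// ler_nat.
have t_ge0 k : 0 <= t k by rewrite mulr_ge0// ltW.
have tnA : A <= t n by rewrite -ler_pdivrMr// ltW// truncnS_gt.
have tn_le k : (k < n)%N -> t k.+1 <= A + 1.
  move=> kn; rewrite /t -(natr1 k) mulrDl mul1r lerD// -ler_pdivlMr//.
  apply: le_trans (_ : (Num.truncn (A / d))%:R <= _); first by rewrite ler_nat -ltnS.
  by rewrite truncn_le divr_ge0// ltW.
have tosc k x : (k < n)%N -> t k < x -> x <= t k.+1 -> `|g x - g (t k.+1)| <= eps / 8.
  move=> kn tx xt; rewrite distrC; apply: unif; first by rewrite t_ge0 tn_le.
  rewrite ger0_norm ?subr_ge0//.
  by move: tx; rewrite /t -(natr1 k) mulrDl mul1r; lra.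
pose c k := g (t k.+1).
pose Sm m := \sum_(k < n) c k * (tail Pr (Y m) (t k) - tail Pr (Y m) (t k.+1)).
pose Sl := \sum_(k < n) c k * (expR (- t k) - expR (- t k.+1)).
have Scvg : Sm m @[m --> \oo] --> Sl.
  rewrite /Sm /Sl; elim: n {tnA tosc tn_le Sm Sl} => [|j IH].
    by rewrite big_ord0; under eq_fun do rewrite big_ord0; exact: cvg_cst.
  rewrite big_ord_recr /=; under eq_fun do rewrite big_ord_recr /=.
  apply: cvgD IH _; apply: cvgM; first exact: cvg_cst.
  by apply: cvgB; exact: Ytail.
have expstep : `|(\int[Pexp]_w observed (@EFin R) g w)%R - Sl| <= eps / 8 + (M * (1 - 1) + M * expR (- t n)).
  have := integral_step Pexp Ey measurable_upperR g_cont g_bound e0' t0 t_mono (c := c) tosc.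
  rewrite (tail_exponential (lexx 0)) tail_exponential// oppr0 expR0.
  by under eq_bigr do rewrite !tail_exponential//.
have Mtn : M * expR (- t n) <= eps / 16.
  by rewrite (le_trans _ MA)// ler_wpM2l// ler_expR lerN2.
have T0 : M * (1 - tail Pr (Y m) 0) @[m --> \oo] --> M * (1 - 1).
  apply: cvgM; first exact: cvg_cst.
  apply: cvgB; first exact: cvg_cst.
  by rewrite -[X in _ --> X]expR0 -[X in expR X]oppr0; exact: Ytail.
have Tn : M * tail Pr (Y m) (t n) @[m --> \oo] --> M * expR (- t n).
  by apply: cvgM; [exact: cvg_cst | exact: Ytail].
near=> m.
have [Y1 Y2] : (forall w, (-oo < Y m w)%E) /\ forall s, measurable (upper (Y m) s).
  by near: m.
have := integral_step Pr Y1 Y2 g_cont g_bound e0' t0 t_mono (c := c) tosc.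
have : `|Sl - Sm m| <= eps / 8 by near: m; move/cvgrPdist_le : Scvg; exact.
have : `|M * (1 - 1) - M * (1 - tail Pr (Y m) 0)| <= eps / 8.
  by near: m; move/cvgrPdist_le : T0; exact.
have : `|M * expR (- t n) - M * tail Pr (Y m) (t n)| <= eps / 8.
  by near: m; move/cvgrPdist_le : Tn; exact.
move: expstep Mtn; rewrite -/(Sm m) subrr mulr0 !ler_distl.
move=> /andP[? ?] ? /andP[? ?] /andP[? ?] /andP[? ?] /andP[? ?].
by apply/andP; split; lra.
Unshelve. all: by end_near. Qed.

End WeakConvergence.

(** * The law of the walk *)

Lemma measure_fin_partition {R : realType} {disp} {Omega : measurableType disp}
  (Pr : probability Omega R) (B : finType) (F : B -> set Omega) :
  (forall b, measurable (F b)) -> trivIset setT F ->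
  Pr (\bigcup_b F b) = (\sum_b Pr (F b))%E.
Proof.
move=> mF tF; rewrite measure_fin_bigcup//; last exact: finite_finset.
rewrite (_ : [set: B] = [set` index_enum B]); last first.
  by apply/seteqP; split => // b _ /=; rewrite mem_index_enum.
by rewrite -fsbig_seq// index_enum_uniq.
Qed.

Section JumpIndex.
Context {R : realType} {d : nat}.
Local Notation V := (bool * 'I_d)%type.
Variables (le : rel V).
Hypotheses (le_total : total le) (le_trans : transitive le) (le_anti : antisymmetric le).

Definition jump_index (q : V -> R) (u : R) : option V :=
  [pick v | (u <= order_cdf le q v) &&
       [forall w, (u <= order_cdf le q w) ==> le v w]].

Definition odir (o : option V) : 'rV[R]_d := if o is Some v then dir v else 0.

Lemma jumpE (E : finType) (p : 'rV[R]_d -> E -> V -> R) x i u :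
  jump le p x i u = odir (jump_index (p x i) u).
Proof. by rewrite /jump /jump_index; case: pickP. Qed.

(** Uniqueness of the least element: the choice made by [pick] is irrelevant. *)
Lemma jump_index_Some q u v : jump_index q u = Some v <->
  u <= order_cdf le q v /\ forall w, u <= order_cdf le q w -> le v w.
Proof.
rewrite /jump_index; case: pickP => [w /andP[uw /forallP minw]|none].
  split=> [[<-]|[uv minv]].
    by split => // w' uw'; have := minw w'; rewrite uw'.
  congr Some; apply: le_anti; rewrite minv// andbT.
  by have := minw v; rewrite uv.
split=> // -[uv minv]; have := none v; rewrite uv /=.
by move/negbT/negP => []; apply/forallP => w; apply/implyP; exact: minv.
Qed.

Lemma measurable_jump_index q o :
  measurable ([set u | jump_index q u = o] : set (measurableTypeR R)).
Proof.
have mSome v : measurable ([set u | jump_index q u = Some v] : set (measurableTypeR R)).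
  rewrite (_ : [set _ | _] = `]-oo, order_cdf le q v]%classic `&`
     \bigcap_(w in [set w | ~~ le v w]) `]order_cdf le q w, +oo[%classic).
    apply: measurableI; first exact: measurable_itv.
    apply: fin_bigcap_measurable; first exact: finite_finset.
    by move=> w _; exact: measurable_itv.
  apply/seteqP; split => u /=.
    move/jump_index_Some => [uv minv]; split; first by rewrite in_itv.
    move=> w /= vw; rewrite in_itv /= andbT ltNge; apply/negP => uw.
    by move: vw; rewrite minv.
  rewrite in_itv /= => -[uv minv]; apply/jump_index_Some; split => // w uw.
  apply/negPn/negP => vw; have := minv w vw; rewrite /= in_itv /= andbT.
  by rewrite ltNge uw.
case: o => [v|]; first exact: mSome.
rewrite (_ : [set _ | _] = ~` \bigcup_v [set u | jump_index q u = Some v]).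
  by apply: measurableC; apply: fin_bigcup_measurable => //; exact: finite_finset.
apply/seteqP; split => u /=; first by move=> jN [v _ /=]; rewrite jN.
by case E : (jump_index q u) => [v|//] => H; exfalso; apply: H; exists v.
Qed.

Definition oprob (q : V -> R) (o : option V) : R := if o is Some v then q v else 0.

Lemma uniform_ge_width (a b : R) : 0 <= a -> a <= b -> b <= 1 ->
  uniform_prob (@ltr01 R) `]a, b]%classic = (b - a)%:E.
Proof.
move=> a0 ab b1; rewrite /uniform_prob integral_uniform_pdf setIidl; last first.
  by move=> x /=; rewrite !in_itv /= => /andP[/ltW ? ?]; apply/andP; split; lra.
rewrite (eq_integral (fun=> 1%E)); last first.
  move=> x; rewrite inE /= in_itv /= => /andP[ax xb].
  by rewrite /uniform_pdf subr0 invr1 ifT//; apply/andP; split; lra.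
rewrite integral_cst//= mul1e lebesgue_measure_itv /= lte_fin.
case: ltP => [_|ba]; first by rewrite EFinB.
by rewrite (_ : b = a) ?subrr//; apply/eqP; rewrite eq_le ba ab.
Qed.

(** Each value v of the jump is taken on a set that contains an interval of
    length q v; the lengths sum to one, so none of the inclusions can be strict
    in measure. *)
Lemma jump_index_law q : (forall v, 0 <= q v) -> \sum_v q v = 1 ->
  forall o, uniform_prob (@ltr01 R) [set u | jump_index q u = o] = (oprob q o)%:E.
Proof.
move=> q0 q1.
pose F v := order_cdf le q v.
have Uf A : measurable (A : set (measurableTypeR R)) ->
  uniform_prob (@ltr01 R) A \is a fin_num by move=> mA; exact: fin_num_measure.
pose J o := [set u | jump_index q u = o].
have mJ o : measurable (J o : set (measurableTypeR R)) by exact: measurable_jump_index.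
pose L o := fine (uniform_prob (@ltr01 R) (J o)).
have LE o : uniform_prob (@ltr01 R) (J o) = (L o)%:E by rewrite /L fineK ?Uf.
have F1 v : F v <= 1.
  by rewrite -q1 /F /order_cdf [leRHS](bigID (le^~ v)) /= lerDl sumr_ge0.
have Fq v : 0 <= F v - q v.
  rewrite /F /order_cdf (bigD1 v) /=; last by case/orP: (le_total v v).
  by rewrite addrAC subrr add0r sumr_ge0.
have Lge v : q v <= L (Some v).
  have -> : q v = F v - (F v - q v) by ring.
  rewrite -lee_fin -LE -uniform_ge_width//; last by rewrite gerBl.
  apply: le_measure; rewrite ?inE; [exact: measurable_itv|exact: mJ|].
  move=> u /=; rewrite in_itv /= => /andP[Fu uF]; apply/jump_index_Some; split => // w uw.
  case/orP: (le_total v w) => // wv; have [->|nvw] := eqVneq w v.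
    by case/orP: (le_total v v).
  have : F w <= F v - q v.
    rewrite /F /order_cdf [X in _ <= X - _](bigD1 v) /=; last by case/orP: (le_total v v).
    rewrite [leRHS]addrAC subrr add0r big_mkcond [leRHS]big_mkcond /=.
    apply: ler_sum => w' _; case: ifPn => [w'w|_]; last by case: ifP.
    rewrite (le_trans w'w wv) /=; case: eqVneq => // w'v; move: w'w; rewrite w'v => vw.
    by case/eqP: nvw; apply/le_anti/andP; split.
  by move=> Fwv; have := lt_le_trans (lt_le_trans Fu uw) Fwv; rewrite ltxx.
have Lge0 : 0 <= L None by rewrite /L fine_ge0.
have Lsum : L None + \sum_v L (Some v) = 1.
  have <- : \sum_o L o = L None + \sum_v L (Some v).
    rewrite (bigD1 None) //=; congr (_ + _).
    rewrite (reindex_omap Some id) /=; last by case.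
    by apply: eq_bigl => v; rewrite eqxx.
  apply: EFin_inj; rewrite -sumEFin; under eq_bigr do rewrite -LE.
  have := @measure_fin_partition R _ _ (uniform_prob (@ltr01 R)) _ J mJ.
  move=> <-; last by move=> o o' _ _ [u [/= <- <-]].
  rewrite (_ : \bigcup_o J o = setT); first exact: probability_setT.
  by apply/seteqP; split => // u _; exists (jump_index q u).
have Leq v : L (Some v) = q v.
  apply/eqP; rewrite eq_le Lge andbT leNgt; apply/negP => lt_v.
  have : \sum_w q w < \sum_w L (Some w).
    rewrite (bigD1 v) //= [ltRHS](bigD1 v) //= ltr_leD// ler_sum// => w _; exact: Lge.
  by rewrite q1; lra.
move=> o; rewrite LE; congr _%:E; case: o => [v|] /=; first exact: Leq.
by move: Lsum; under eq_bigr do rewrite Leq; rewrite q1; lra.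
Qed.

End JumpIndex.
Section Bridge.
Context {R : realType} {d : nat} {E : finType} {disp : measure_display}
  {Omega : measurableType disp}.
Local Notation V := (bool * 'I_d)%type.
Variables (p : 'rV[R]_d -> E -> V -> R) (P : E -> E -> R) (le : rel V).
Variables (Pr : probability Omega R) (xi : nat -> Omega -> E) (U : nat -> Omega -> R) (i0 : E).
Hypothesis p_law : jump_law p.
Hypotheses (le_total : total le) (le_trans : transitive le) (le_anti : antisymmetric le).
Hypothesis xi_markov : markov_chain Pr xi P i0.
Hypothesis U_iid : iid_uniform Pr U.
Hypothesis xi_U_indep : independent_processes Pr xi U.
Variables (m : nat) (x0 : 'rV[R]_d).

Definition walk_kernel (z : 'rV[R]_d * E) (b : V * E) : R :=
  p (m%:R^-1 *: z.1) z.2 b.1 * P z.2 b.2.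

Definition walk_move (z : 'rV[R]_d * E) (b : V * E) : 'rV[R]_d * E :=
  (Defs.reflect m (z.1 + dir b.1), b.2).

(** The position of the walk along a prescribed sequence of jump indices; the
    index None stands for the null event that no jump is selected. *)
Fixpoint pos (o : nat -> option V) k : 'rV[R]_d :=
  if k is k'.+1 then Defs.reflect m (pos o k' + odir (o k')) else x0.

Definition jumps (e : nat -> E) (o : nat -> option V) k : set R :=
  [set u | jump_index le (p (m%:R^-1 *: pos o k) (e k)) u = o k].

Definition xi_cyl n (e : nat -> E) : set Omega :=
  \bigcap_(k in `I_n.+1) (xi k @^-1` [set e k]).

Definition U_cyl n e o : set Omega := \bigcap_(k in `I_n) (U k @^-1` jumps e o k).

Definition cyl n e o : set Omega := xi_cyl n e `&` U_cyl n e o.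

Lemma measurable_jumps e o k : measurable (jumps e o k : set (measurableTypeR R)).
Proof. exact: measurable_jump_index. Qed.

Lemma measurable_cyl n e o : measurable (cyl n e o).
Proof.
have [mxi _ _] := xi_markov; have [mU _ _] := U_iid.
apply: measurableI.
  by apply: fin_bigcap_measurable; [exact: finite_II | move=> k _; exact: mxi].
apply: fin_bigcap_measurable; [exact: finite_II | move=> k _].
by rewrite -[X in measurable X]setTI; apply: mU => //; exact: measurable_jumps.
Qed.

Lemma Pr_cyl n e o : Pr (cyl n e o) = (Pr (xi_cyl n e) * Pr (U_cyl n e o))%E.
Proof.
apply: xi_U_indep.
  apply: (@fin_bigcap_measurable _ (g_sigma_algebraType _)); first exact: finite_II.
  by move=> k _; apply: sub_gen_smallest; exists k, (e k).
apply: (@fin_bigcap_measurable _ (g_sigma_algebraType _)); first exact: finite_II.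
move=> k _; apply: sub_gen_smallest; exists k, (jumps e o k); split => //.
exact: measurable_jumps.
Qed.

(** One step of the chain: the new jump depends on a fresh uniform variable, and
    the law of the environment is Markov. *)
Lemma Pr_cylS n e o : Pr (cyl n.+1 e o) =
  (Pr (cyl n e o) *
   (oprob (p (m%:R^-1 *: pos o n) (e n)) (o n) * P (e n) (e n.+1))%:E)%E.
Proof.
have [_ _ step] := xi_markov; have [_ Uunif Uind] := U_iid.
have mJ k := measurable_jumps e o k.
rewrite !Pr_cyl.
have -> : Pr (xi_cyl n.+1 e) = (Pr (xi_cyl n e) * (P (e n) (e n.+1))%:E)%E.
  exact: step.
have -> : Pr (U_cyl n.+1 e o) = (Pr (U_cyl n e o) *
    (oprob (p (m%:R^-1 *: pos o n) (e n)) (o n))%:E)%E.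
  rewrite /U_cyl !Uind// big_ord_recr /=; congr (_ * _)%E.
  have [q0 q1] := p_law (m%:R^-1 *: pos o n) (e n).
  by rewrite Uunif; [exact: (jump_index_law le_total le_trans le_anti q0 q1) | exact: mJ].
rewrite EFinM.
by rewrite muleACA [in X in (_ * X)%E]muleC.
Qed.

Definition update {T} (f : nat -> T) a b k : T := if k == a then b else f k.

Lemma pos_update o n b k : (k <= n)%N -> pos (update o n b) k = pos o k.
Proof.
elim: k => //= k IH kn; rewrite IH ?(ltnW kn)//.
by rewrite /update ltn_eqF.
Qed.

Definition extend n e o (b : option V * E) : set Omega :=
  cyl n.+1 (update e n.+1 b.2) (update o n b.1).

Lemma extendE n e o b : extend n e o b = cyl n e o `&`
  [set w | xi n.+1 w = b.2 /\
     jump_index le (p (m%:R^-1 *: pos o n) (e n)) (U n w) = b.1].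
Proof.
rewrite /extend /cyl /xi_cyl /U_cyl; apply/seteqP; split => w /=.
  move=> [Hxi HU]; split; split.
  - by move=> k kn /=; have := Hxi k (ltnW kn); rewrite /= /update ltn_eqF.
  - move=> k kn /=; have := HU k (ltnW kn); rewrite /jumps /= pos_update ?(ltnW kn)//.
    by rewrite /update !ltn_eqF// ltnS ltnW.
  - by have := Hxi n.+1 (ltnSn _); rewrite /= /update eqxx.
  - have := HU n (ltnSn _); rewrite /jumps /= pos_update// /update eqxx.
    by rewrite ltn_eqF.
move=> [[Hxi HU] [Hx HJ]]; split => k /=; rewrite ltnS.
  rewrite leq_eqVlt => /orP[/eqP->|kn]; first by rewrite /update eqxx.
  by rewrite /update ltn_eqF//; exact: Hxi.
rewrite leq_eqVlt => /orP[/eqP->|kn].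
  by rewrite /jumps /= pos_update// /update eqxx ltn_eqF.
have := HU k kn; rewrite /jumps /= pos_update ?(ltnW kn)//.
by rewrite /update !ltn_eqF// ltnS ltnW.
Qed.

Variable S : 'rV[R]_d -> bool.

Definition avoids n k : set Omega :=
  [set w | forall j, (n <= j <= n + k)%N -> ~~ S (walk le p xi U m x0 j w)].

Lemma walk_cyl n e o w : cyl n e o w -> forall k, (k <= n)%N ->
  walk le p xi U m x0 k w = pos o k.
Proof.
move=> [Hxi HU]; elim=> //= k IH kn; rewrite IH ?(ltnW kn)// jumpE.
have := Hxi k; rewrite /= ltnS (ltnW kn) => /(_ isT) ->.
by have := HU k kn; rewrite /jumps /= => ->.
Qed.

Lemma avoidsS n k w : avoids n k.+1 w <->
  ~~ S (walk le p xi U m x0 n w) /\ avoids n.+1 k w.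
Proof.
rewrite /avoids /=; split=> [H|[H0 H] j].
  split; first by apply: H; rewrite leqnn leq_addr.
  by move=> j /andP[nj jk]; apply: H; rewrite (ltnW nj) -addSnnS.
rewrite leq_eqVlt => /andP[/orP[/eqP<-//|nj] jk].
by apply: H; rewrite nj addSnnS.
Qed.

(** Markov property at the end of a cylinder; by induction on the number k of
    remaining steps, decomposing according to the first of them. *)
Lemma cyl_avoids n k e o :
  measurable (cyl n e o `&` avoids n k) /\
  Pr (cyl n e o `&` avoids n k) =
    (Pr (cyl n e o) * (surv walk_kernel walk_move (fun z => S z.1) k (pos o n, e n))%:E)%E.
Proof.
elim: k n e o => [|k IH] n e o.
  have [Sn|Sn] := boolP (S (pos o n)).
    rewrite surv_in// mule0 (_ : _ `&` _ = set0) ?measure0//.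
    apply/seteqP; split => // w [Cw] /(_ n); rewrite leqnn leq_addr => /(_ isT).
    by rewrite (walk_cyl Cw)// Sn.
  rewrite surv0// mule1 (_ : _ `&` _ = cyl n e o).
    by split => //; exact: measurable_cyl.
  apply/seteqP; split => [w []//|w Cw]; split => // j.
  by rewrite addn0 -eqn_leq => /eqP <-; rewrite (walk_cyl Cw).
have [Sn|Sn] := boolP (S (pos o n)).
  rewrite surv_in// mule0 (_ : _ `&` _ = set0) ?measure0//.
  apply/seteqP; split => // w [Cw] /(_ n); rewrite leqnn leq_addr => /(_ isT).
  by rewrite (walk_cyl Cw)// Sn.
pose F b := extend n e o b `&` avoids n.+1 k.
have FE : cyl n e o `&` avoids n k.+1 = \bigcup_b F b.
  apply/seteqP; split => w.
    move=> [Cw /avoidsS[_ Aw]].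
    exists (jump_index le (p (m%:R^-1 *: pos o n) (e n)) (U n w), xi n.+1 w) => //.
    by split => //; rewrite extendE; split.
  move=> [b _ [Cbw Aw]]; move: Cbw; rewrite extendE => -[Cw _].
  by split => //; apply/avoidsS; split => //; rewrite (walk_cyl Cw).
have mF b : measurable (F b) by case: (IH n.+1 (update e n.+1 b.2) (update o n b.1)).
have tF : trivIset setT F.
  move=> b b' _ _ [w [[+ _] [+ _]]]; rewrite !extendE => -[_ [/= h1 h2]] [_ [h3 h4]].
  by case: b b' h1 h2 h3 h4 => [? ?] [? ?] /= <- <- <- <-.
have PF b : Pr (F b) = (Pr (cyl n e o) * (
    oprob (p (m%:R^-1 *: pos o n) (e n)) b.1 * P (e n) b.2 *
    surv walk_kernel walk_move (fun z => S z.1) k (Defs.reflect m (pos o n + odir b.1), b.2))%:E)%E.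
  have [_ ->] := IH n.+1 (update e n.+1 b.2) (update o n b.1).
  rewrite Pr_cylS.
  have -> : Pr (cyl n (update e n.+1 b.2) (update o n b.1)) = Pr (cyl n e o).
    congr (Pr _); apply/seteqP; split => w [Hxi HU]; split => j jn.
    - by have := Hxi j jn; rewrite /= /update ltn_eqF.
    - have := HU j jn; rewrite /jumps /= pos_update ?(ltnW jn)// /update !ltn_eqF// ltnS ltnW//.
    - by have := Hxi j jn; rewrite /= /update ltn_eqF.
    - have := HU j jn; rewrite /jumps /= pos_update ?(ltnW jn)// /update !ltn_eqF// ltnS ltnW//.
  rewrite -muleA -EFinM /= !pos_update// {1 2 3 4 5 6}/update !eqxx !(ltn_eqF (ltnSn _)).
  by [].
rewrite FE; split.
  by apply: fin_bigcup_measurable; [exact: finite_finset | move=> b _; exact: mF].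
rewrite measure_fin_partition//; under eq_bigr do rewrite PF.
have Cfin : Pr (cyl n e o) \is a fin_num by rewrite fin_num_measure//; exact: measurable_cyl.
rewrite -(fineK Cfin); under eq_bigr do rewrite -EFinM.
rewrite sumEFin -mulr_sumr -EFinM; congr (_ * _)%:E.
rewrite survS// /avg.
rewrite (eq_bigr (fun b : option V * E =>
  (fun o' e' => oprob (p (m%:R^-1 *: pos o n) (e n)) o' * P (e n) e' *
   surv walk_kernel walk_move (fun z => S z.1) k (Defs.reflect m (pos o n + odir o'), e')) b.1 b.2))//.
rewrite -(pair_bigA _ (fun o' e' => oprob (p (m%:R^-1 *: pos o n) (e n)) o' * P (e n) e' *
   surv walk_kernel walk_move (fun z => S z.1) k (Defs.reflect m (pos o n + odir o'), e'))) /=.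
rewrite (bigD1 None) //= big1 ?add0r; last by move=> e' _; rewrite !mul0r.
rewrite (reindex_omap Some id) /=; last by case.
rewrite [RHS](eq_bigr (fun b : V * E => (fun v e' => p (m%:R^-1 *: pos o n) (e n) v * P (e n) e' *
   surv walk_kernel walk_move (fun z => S z.1) k (Defs.reflect m (pos o n + dir v), e')) b.1 b.2))//.
rewrite -[RHS](pair_bigA _ (fun v e' => p (m%:R^-1 *: pos o n) (e n) v * P (e n) e' *
   surv walk_kernel walk_move (fun z => S z.1) k (Defs.reflect m (pos o n + dir v), e'))) /=.
by apply: eq_bigl => v; rewrite eqxx.
Qed.

(** First step analysis computes the law of the first visit to S. *)
Theorem Pr_avoids k : measurable (avoids 0 k) /\
  Pr (avoids 0 k) = (surv walk_kernel walk_move (fun z => S z.1) k (x0, i0))%:E.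
Proof.
have [mxi x1 _] := xi_markov.
have cyl0 i : cyl 0 (fun=> i) (fun=> None) = xi 0%N @^-1` [set i].
  apply/seteqP; split => w; first by move=> [/(_ 0%N isT)].
  by move=> h; split => -[].
pose F i := cyl 0 (fun=> i) (fun=> None) `&` avoids 0 k.
have FE : avoids 0 k = \bigcup_i F i.
  apply/seteqP; split => w; last by move=> [i _ []].
  by move=> Aw; exists (xi 0%N w) => //; split => //; rewrite cyl0.
have mF i : measurable (F i) by case: (cyl_avoids 0 k (fun=> i) (fun=> None)).
have tF : trivIset setT F.
  by move=> i j _ _ [w [[+ _] [+ _]]]; rewrite !cyl0 => /= -> .
rewrite FE; split.
  by apply: fin_bigcup_measurable; [exact: finite_finset | move=> b _; exact: mF].
rewrite measure_fin_partition// (bigD1 i0) //= big1 ?adde0.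
  by have [_ ->] := cyl_avoids 0 k (fun=> i0) (fun=> None); rewrite cyl0 x1 mul1e.
move=> i ii0; have [_ ->] := cyl_avoids 0 k (fun=> i) (fun=> None).
rewrite cyl0 (_ : Pr _ = 0%E) ?mul0e//.
apply/eqP; rewrite eq_le measure_ge0 andbT.
have <- : Pr (~` (xi 0%N @^-1` [set i0])) = 0%E.
  by rewrite probability_setC// x1 subee.
apply: le_measure; rewrite ?inE//; first exact: measurableC.
by move=> w /= -> /eqP; rewrite (negPf ii0).
Qed.

End Bridge.

(** * Reflection on the lattice and the deadlock time *)

Section Lattice.
Context {R : realType} {d : nat}.
Local Notation V := (bool * 'I_d)%type.

Lemma int_norm_lt1 (x : R) : x \is a Num.int -> `|x| < 1 -> x = 0.
Proof.
case/intrP => z ->; rewrite -intr_norm -[X in _ < X]/(1%:~R) ltr_int.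
by case: z => [[|n]|n].
Qed.

Definition sgv (v : V) : R := if v.1 then 1 else -1.

Lemma dirE (v : V) j : dir v 0 j = sgv v * (j == v.2)%:R :> R.
Proof. by rewrite /dir !mxE eqxx. Qed.

Lemma add_dirE (X : 'rV[R]_d) (v : V) j :
  (X + dir v) 0 j = X 0 j + sgv v * (j == v.2)%:R.
Proof. by rewrite mxE dirE. Qed.

Definition lattice (m : nat) (X : 'rV[R]_d) :=
  integral_vector X /\ forall j, 0 <= X 0 j <= m%:R.

Lemma reflectE (m : nat) (y : 'rV[R]_d) j :
  Defs.reflect m y 0 j = 2%:R * Num.min m%:R (Num.max 0 (y 0 j)) - y 0 j.
Proof. by rewrite /Defs.reflect /box_proj !mxE. Qed.

Lemma reflect_inside (m : nat) (x : R) : 0 <= x <= m%:R ->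
  2%:R * Num.min m%:R (Num.max 0 x) - x = x.
Proof. by case/andP => x0 xm; rewrite max_r// min_r//; ring. Qed.

(** On the lattice a step is only reflected when it leaves the box from one of its
    faces, and it is then reversed. *)
Lemma reflect_step_cases (m : nat) (X : 'rV[R]_d) (v : V) : (0 < m)%N -> lattice m X ->
  (forall j, j != v.2 -> Defs.reflect m (X + dir v) 0 j = X 0 j) /\
  let x := X 0 v.2 in let y := Defs.reflect m (X + dir v) 0 v.2 in
  [\/ 0 <= x + sgv v <= m%:R /\ y = x + sgv v,
      [/\ x = 0, sgv v = -1 & y = 1] |
      [/\ x = m%:R, sgv v = 1 & y = m%:R - 1]].
Proof.
move=> m0 [Xint Xbox]; split=> [j jv|].
  rewrite reflectE add_dirE (negPf jv) mulr0 addr0.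
  by rewrite reflect_inside.
cbv zeta.
have m1 : 1 <= m%:R :> R by rewrite ler1n.
have /andP[x0 xm] := Xbox v.2; have xint := Xint v.2.
rewrite reflectE add_dirE eqxx mulr1.
move: (X 0 v.2) xint x0 xm => x xint x0 xm.
case: v => -[] i /=; rewrite /sgv /=.
  case: (boolP (x + 1 <= m%:R)) => [x1m|]; last rewrite -ltNge => mx1.
    by apply: Or31; rewrite reflect_inside ?x1m ?addr_ge0.
  have xE : x = m%:R.
    apply/eqP; rewrite -subr_eq0; apply/eqP/int_norm_lt1.
      by rewrite rpredB// natr_int.
    by rewrite ler0_norm ?subr_le0//; lra.
  apply: Or33; split => //; rewrite max_r ?addr_ge0// min_l ?ltW//.
  by rewrite xE; ring.
case: (boolP (0 <= x + -1)) => [x1|]; last rewrite -ltNge => x1.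
  have H : 0 <= x + -1 <= m%:R by apply/andP; split => //; lra.
  by apply: Or31; split; [case/andP: H => _ -> | exact: reflect_inside].
have xE : x = 0 by apply: int_norm_lt1 => //; rewrite ger0_norm//; lra.
apply: Or32; split => //; rewrite max_l ?ltW// min_r//.
by rewrite xE; ring.
Qed.

Lemma reflect_lattice (m : nat) (X : 'rV[R]_d) (v : V) : (0 < m)%N -> lattice m X ->
  lattice m (Defs.reflect m (X + dir v)).
Proof.
move=> m0 LX; have [off on] := reflect_step_cases v m0 LX.
have [Xint Xbox] := LX; have m1 : 1 <= m%:R :> R by rewrite ler1n.
have sint : sgv v \is a Num.int by rewrite /sgv; case: v.1; rewrite ?rpredN rpred1.
split=> j; have [->|jv] := eqVneq j v.2; try by rewrite off//; exact: Xbox.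
  case: on => -[].
  - by move=> _ ->; rewrite rpredD// Xint.
  - by move=> _ _ ->; rewrite rpred1.
  - by move=> _ _ ->; rewrite rpredB// ?natr_int ?rpred1.
case: on => -[].
- by move=> H ->.
- by move=> _ _ ->; rewrite ler01 m1.
- by move=> _ _ ->; rewrite subr_ge0 m1 lerBlDr lerDl ler01.
Qed.

Lemma reflect_step_le1 (m : nat) (X : 'rV[R]_d) (v : V) j : (0 < m)%N -> lattice m X ->
  `|Defs.reflect m (X + dir v) 0 j - X 0 j| <= 1.
Proof.
move=> m0 LX; have [off on] := reflect_step_cases v m0 LX.
have [->|jv] := eqVneq j v.2; last by rewrite off// subrr normr0 ler01.
case: on => -[].
- move=> _ ->; rewrite addrAC subrr add0r /sgv; case: v.1; by rewrite ?normrN normr1.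
- by move=> -> _ ->; rewrite subr0 normr1.
- by move=> -> _ ->; rewrite addrAC subrr add0r normrN normr1.
Qed.

Lemma reflect_id (m : nat) (X : 'rV[R]_d) : lattice m X -> Defs.reflect m X = X.
Proof.
move=> [_ Xbox]; apply/matrixP => i j; rewrite (ord1 i) reflectE.
exact: reflect_inside.
Qed.

End Lattice.

Section HittingTime.
Context {R : realType} {d : nat} {E : finType} {disp : measure_display}
  {Omega : measurableType disp}.
Local Notation V := (bool * 'I_d)%type.
Variables (p : 'rV[R]_d -> E -> V -> R) (le : rel V).
Variables (xi : nat -> Omega -> E) (U : nat -> Omega -> R).
Variables (m : nat) (l : R) (x : 'rV[R]_d).
Hypotheses (m_gt0 : (0 < m)%N) (x_lattice : lattice m (m%:R *: x)).

Let X n w := walk le p xi U m (m%:R *: x) n w.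

Lemma walk_lattice n w : lattice m (X n w).
Proof.
elim: n => //= n IH; rewrite /X /= jumpE /odir.
case: jump_index => [v|]; first exact: reflect_lattice.
by rewrite addr0 reflect_id.
Qed.

Lemma walk_step n w j : `|X n.+1 w 0 j - X n w 0 j| <= 1.
Proof.
rewrite /X /= jumpE /odir; have LX := walk_lattice n w.
case: jump_index => [v|]; first exact: reflect_step_le1.
by rewrite addr0 reflect_id// subrr normr0.
Qed.

Definition on_target (y : 'rV[R]_d) : bool := `[< target m l (m%:R^-1 *: y) >].

(** Between two steps the interpolated walk moves along an edge of the lattice, or
    stays put; so it is integral only at a lattice point that it already visited. *)
Lemma target_floor t w : 0 <= t -> target m l (scaled_walk le p xi U m x t w) ->
  on_target (X (Num.truncn (m%:R * t)) w).
Proof.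
move=> t0; rewrite /scaled_walk -/X; set n := Num.truncn _ => T.
have m0 : m%:R != 0 :> R by rewrite pnatr_eq0 -lt0n.
have mt0 : 0 <= m%:R * t by rewrite mulr_ge0.
have scaledE j : (m%:R^-1 *: X n w + (m%:R * t - n%:R) *:
    (m%:R^-1 *: X n.+1 w - m%:R^-1 *: X n w)) 0 j =
    m%:R^-1 * (X n w 0 j + (m%:R * t - n%:R) * (X n.+1 w 0 j - X n w 0 j)).
  by rewrite !mxE; ring.
apply/asboolP; move: (T); congr target; apply/matrixP => i j; rewrite (ord1 i).
have [/(_ j) Tint _ _] := T.
have [/(_ j) Xint _] := walk_lattice n w; have [/(_ j) XSint _] := walk_lattice n.+1 w.
move: Tint; rewrite scaledE [in X in X \is a _ -> _]mxE scaledE mulrA mulfV// mul1r.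
set r := m%:R * t - n%:R => Tint.
have r0 : 0 <= r by rewrite subr_ge0 truncn_le.
have r1 : r < 1 by rewrite ltrBlDr addrC natr1 truncnS_gt.
have rint : r * (X n.+1 w 0 j - X n w 0 j) \is a Num.int.
  rewrite -[X in X \is a _](addKr (X n w 0 j)) addrC.
  exact: rpredB.
rewrite [RHS]mxE; congr (_ * _); rewrite -[RHS]addr0; congr (_ + _).
have [->|d0] := eqVneq (X n.+1 w 0 j - X n w 0 j) 0; first by rewrite mulr0.
apply: int_norm_lt1 => //; rewrite normrM ger0_norm//.
rewrite (le_lt_trans _ r1)// ler_piMr//; exact: walk_step.
Qed.

Lemma deadlock_time_gt t w : 0 <= t ->
  (t%:E < deadlock_time le p xi U m l x w)%E <->
  avoids p le xi U m (m%:R *: x) on_target 0 (Num.truncn (m%:R * t)) w.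
Proof.
have m0 : m%:R != 0 :> R by rewrite pnatr_eq0 -lt0n.
have mpos : 0 < m%:R :> R by rewrite ltr0n.
move=> t0; split=> [tlt j /andP[_]|A].
  rewrite add0n => jt; apply/negP => /asboolP T.
  have jm0 : 0 <= j%:R / m%:R :> R by rewrite divr_ge0.
  have : (deadlock_time le p xi U m l x w <= (j%:R / m%:R)%:E)%E.
    apply: ereal_inf_lbound; exists (j%:R / m%:R) => //; split => //.
    rewrite /scaled_walk mulrCA mulfV// mulr1 natrK subrr scale0r addr0.
    exact: T.
  rewrite leNgt => /negP; apply; apply: le_lt_trans tlt.
  rewrite lee_fin ler_pdivrMr// mulrC (le_trans _ (_ : (Num.truncn (m%:R * t))%:R <= _))//.
    by rewrite ler_nat.
  by rewrite truncn_le mulr_ge0.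
apply: (@lt_le_trans _ _ ((Num.truncn (m%:R * t)).+1%:R / m%:R)%:E).
  by rewrite lte_fin ltr_pdivlMr// mulrC truncnS_gt.
apply: le_ereal_inf_tmp => _ [s [s0 Ts] <-]; rewrite lee_fin ler_pdivrMr// [leRHS]mulrC.
have := target_floor s0 Ts; set n := Num.truncn (m%:R * s) => Sn.
apply: (@le_trans _ _ n%:R); last by rewrite /n truncn_le mulr_ge0.
rewrite ler_nat ltnNge; apply/negP => nt.
by have := A n; rewrite leq0n add0n nt => /(_ isT) /negP; apply.
Qed.

End HittingTime.

(** * The Poisson equation of the environment and the drift at the origin *)

Section Irreducible.
Context {R : realType} {n : nat}.
Variable A : 'M[R]_n.
Hypothesis A_ge0 : forall a b, 0 <= A a b.
Hypothesis A_irr : irreducible_mx A.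

Lemma expmx_ge0 k a b : 0 <= (A ^+ k) a b.
Proof.
elim: k a b => [|k IH] a b; first by rewrite expr0 mxE; case: eqP.
by rewrite exprS mxE sumr_ge0// => c _; rewrite mulr_ge0.
Qed.

Lemma invariant_expmx (v : 'rV[R]_n) k : v *m A = v -> v *m (A ^+ k) = v.
Proof.
move=> vA; elim: k => [|k IH]; first by rewrite expr0 mulmx1.
by rewrite exprS mulmxA vA.
Qed.

(** Mass at b would be transported to a along a path. *)
Lemma invariant_zero (v : 'rV[R]_n) a : v *m A = v -> (forall b, 0 <= v 0 b) ->
  v 0 a = 0 -> v = 0.
Proof.
move=> vA v0 va; apply/matrixP => i b; rewrite (ord1 i) mxE.
have [k kpos] := A_irr b a.
have := congr1 (fun w : 'rV_n => w 0 a) (invariant_expmx k vA).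
rewrite va mxE => /eqP; rewrite psumr_eq0; last first.
  by move=> c _; rewrite mulr_ge0// expmx_ge0.
move/allP => /(_ b); rewrite mem_index_enum => /(_ isT) /=.
by rewrite mulf_eq0 (gt_eqF kpos) orbF => /eqP.
Qed.

(** Subtract the largest multiple of m that leaves a nonnegative vector: the
    difference is invariant and has a zero entry. *)
Lemma invariant_unique (v m : 'rV[R]_n) : v *m A = v -> m *m A = m ->
  (forall b, 0 <= m 0 b) -> m != 0 -> exists t, v = t *: m.
Proof.
move=> vA mA m0 mn0.
have mpos b : 0 < m 0 b.
  rewrite lt_def m0 andbT; apply: contra mn0 => /eqP mb.
  by apply/eqP; exact: (invariant_zero mA m0 mb).
have [[a]|noa] := pselect (exists a : 'I_n, True); last first.
  exists 0; apply/matrixP => i b; exfalso; apply: noa; by exists b.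
move=> _; case: (@arg_minP _ _ _ a xpredT (fun b => v 0 b / m 0 b)) => // c _ cmin.
set t := v 0 c / m 0 c in cmin; exists t.
apply/eqP; rewrite -subr_eq0; apply/eqP; apply: (@invariant_zero _ c).
- by rewrite mulmxBl -scalemxAl vA mA.
- move=> b; rewrite !mxE subr_ge0; have := cmin b isT.
  by rewrite ler_pdivlMr.
- by rewrite !mxE /t mulfVK ?subrr// gt_eqF.
Qed.

End Irreducible.

Section Poisson.
Context {R : realType} {E : finType}.
Variables (P : E -> E -> R) (mu : E -> R).
Hypothesis P_stochastic : stochastic P.
Hypothesis P_irr : irreducible_mx (transition_mx P).
Hypothesis mu_inv : invariant_probability P mu.

Lemma sum_enum_val (F : E -> R) : \sum_(a < #|E|) F (enum_val a) = \sum_i F i.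
Proof. by rewrite [RHS](reindex_onto enum_val enum_rank) => [|i _]; rewrite ?enum_rankK//; apply: eq_bigl => a; rewrite enum_valK eqxx. Qed.

Lemma sum_delta n (a : 'I_n) (F : 'I_n -> R) : \sum_e (e == a)%:R * F e = F a.
Proof.
rewrite (bigD1 a) //= eqxx mul1r big1 ?addr0// => e ea.
by rewrite (negPf ea) mul0r.
Qed.

(** The orthogonal of the range of P - 1 is the line of the invariant measures;
    hence every function with zero mean is in this range. *)
Lemma poisson_equation (g : E -> R) : exists phi : E -> R,
  forall i, \sum_j P i j * phi j - phi i = \sum_j mu j * g j - g i.
Proof.
have [mu0 mu1 muP] := mu_inv; have [P0 P1] := P_stochastic.
set A := transition_mx P.
have A0 a b : 0 <= A a b by rewrite mxE.
pose m : 'rV[R]_#|E| := \row_a mu (enum_val a).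
have mA : m *m A = m.
  apply/matrixP => i b; rewrite !mxE -muP -sum_enum_val.
  by apply: eq_bigr => a _; rewrite !mxE.
have m1 : \sum_a m 0 a = 1.
  by rewrite -mu1 -sum_enum_val; apply: eq_bigr => a _; rewrite mxE.
have mn0 : m != 0.
  apply/eqP => m0; move: m1; rewrite m0 big1; last by move=> a _; rewrite mxE.
  by move/eqP; rewrite eq_sym oner_eq0.
pose M := (A - 1%:M)^T.
have ME a e : M a e = A e a - (e == a)%:R.
  by rewrite /M [LHS]mxE [LHS]mxE; congr (_ + _); rewrite 2!mxE.
pose c := \sum_j mu j * g j.
pose b : 'rV[R]_#|E| := \row_a (c - g (enum_val a)).
have /submxP[D bD] : (b <= M)%MS.
  rewrite submxE; move: (cokermx M) (mulmx_coker M) => C MC.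
  apply/eqP/matrixP => i k; rewrite mxE [RHS]mxE.
  pose v : 'rV[R]_#|E| := \row_a C a k.
  have vA : v *m A = v.
    move/matrixP: MC => H; apply/matrixP => i' a; rewrite (ord1 i') !mxE.
    have := H a k; rewrite mxE [RHS]mxE.
    under eq_bigr do rewrite ME mulrBl.
    rewrite sumrB (sum_delta a (fun e => C e k)).
    move/eqP; rewrite subr_eq0 => /eqP <-.
    by apply: eq_bigr => e _; rewrite [v _ _]mxE mulrC.
  have [t vt] := invariant_unique A0 P_irr vA mA (fun a => ltac:(rewrite mxE; exact: mu0)) mn0.
  have ck a : C a k = t * mu (enum_val a).
    have := congr1 (fun w : 'rV_#|E| => w 0 a) vt; by rewrite !mxE.
  under eq_bigr do rewrite ck mxE mulrCA mulrBl.
  rewrite -mulr_sumr sumrB -mulr_sumr.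
  rewrite (sum_enum_val mu) mu1 mulr1 (sum_enum_val (fun i => g i * mu i)).
  by rewrite /c; under [X in _ - X]eq_bigr do rewrite mulrC; rewrite subrr mulr0.
exists (fun i => D 0 (enum_rank i)) => i.
have := congr1 (fun w : 'rV_#|E| => w 0 (enum_rank i)) bD.
rewrite mxE enum_rankK -/c => ->; rewrite mxE.
under [RHS]eq_bigr do rewrite ME mulrBr.
rewrite sumrB; under [X in _ = _ - X]eq_bigr do rewrite mulrC eq_sym.
rewrite (sum_delta (enum_rank i) (fun e => D 0 e)).
congr (_ - _); rewrite -sum_enum_val; apply: eq_bigr => a _.
by rewrite mxE enum_rankK enum_valK mulrC.
Qed.

End Poisson.

Section DriftAtOrigin.
Context {R : realType} {d : nat}.

(** At the equilibrium 0 the drift is compensated by the reflection term, whose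
    increments are along outward normals of the cube at 0. *)
Lemma drift_origin_le0 (b : 'rV[R]_d -> 'rV[R]_d) (chi : R -> 'rV[R]_d) j :
  rde_solution b 0 chi -> (forall t, 0 <= t -> chi t = 0) -> b 0 0 j <= 0.
Proof.
move=> [_ [k [absk [n [_ _ eqn [_ nrm kn _]]]]]] chi0.
have k1 : k 1 0 j = b 0 0 j.
  have := eqn 1 j ler01; rewrite chi0// !mxE add0r.
  rewrite (_ : (\int[lebesgue_measure]_(s in `[0, 1]) b (chi s) 0 j)%R = b 0 0 j); last first.
    rewrite (@eq_Rintegral _ _ _ _ _ (fun=> b 0 0 j)).
      rewrite Rintegral_cst//= lebesgue_measure_itv /= lte_fin ltr01.
      by rewrite oppr0 adde0 /= mulr1.
    by move=> s; rewrite inE /= in_itv /= => /andP[s0 _]; rewrite chi0.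
  by move/eqP; rewrite eq_sym subr_eq0 => /eqP.
have nle0 s : `[0, 1]%classic s -> n s 0 j <= 0; last first.
  rewrite -k1 -lee_fin kn// integralE [X in (X - _)%E]integral0_eq; last first.
    by move=> s s01; rewrite funeposE max_r// lee_fin nle0.
  by rewrite sub0e oppe_le0 integral_ge0.
rewrite /= in_itv /= => /andP[s0 _].
have bd : cube_boundary (chi s).
  rewrite chi0//; split; first by move=> i; rewrite mxE lexx ler01.
  by exists j; left; rewrite mxE.
have [_ /(_ j)[_ H _]] := nrm s s0 bd.
by apply: H; rewrite chi0// mxE.
Qed.

End DriftAtOrigin.

(** * The Lyapunov function *)

Section Huber.
Context {R : realType}.
Variable eps : R.
Hypothesis eps_gt0 : 0 < eps.

(** The Huber function: a convex C^1 approximation of the identity of the half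
    line, within eps / 2, whose derivative [hweight] vanishes at 0 and is Lipschitz.
    The reflection at 0 has therefore no first order effect on it. *)
Definition huber (r : R) : R :=
  if r <= eps then r ^+ 2 / (2 * eps) else r - eps / 2.

Definition hweight (r : R) : R := if r <= eps then r / eps else 1.

Lemma huber_bounds r : 0 <= r -> r - eps / 2 <= huber r <= r.
Proof.
have e0 := eps_gt0; move=> r0; rewrite /huber; case: ifP => [re|_]; last by apply/andP; split; lra.
have d0 : 0 < 2 * eps by rewrite mulr_gt0.
apply/andP; split; last by rewrite ler_pdivrMr//; nra.
rewrite ler_pdivlMr//; have := sqr_ge0 (r - eps); nra.
Qed.

(** Second order upper bound; the derivative is (1 / eps)-Lipschitz. *)
Lemma huber_quadratic r r' : 0 <= r -> 0 <= r' ->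
  huber r' <= huber r + hweight r * (r' - r) + (r' - r) ^+ 2 / (2 * eps).
Proof.
have e0 := eps_gt0; move=> r0 r'0.
have d0 : 0 < 2 * eps by rewrite mulr_gt0.
have dn0 : eps != 0 by rewrite gt_eqF.
rewrite -subr_ge0 -(pmulr_rge0 _ d0) /huber /hweight.
case: ifP => re; case: ifP => re'; try (move/negbT: re; rewrite -ltNge => re);
  try (move/negbT: re'; rewrite -ltNge => re').
- rewrite (_ : 2 * eps * _ = 0) ?lexx//; field; exact: dn0.
- rewrite (_ : 2 * eps * _ = (r' - eps) ^+ 2) ?sqr_ge0//; field; exact: dn0.
- rewrite (_ : 2 * eps * _ = (r' - r) ^+ 2 - (eps - r') ^+ 2); last by field; exact: dn0.
  nra.
- rewrite (_ : 2 * eps * _ = (r' - r) ^+ 2) ?sqr_ge0//; field; exact: dn0.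
Qed.

Lemma hweight_itv r : 0 <= r -> 0 <= hweight r <= 1.
Proof.
have e0 := eps_gt0; move=> r0; rewrite /hweight; case: ifP => [re|_]; last by rewrite ler01 lexx.
by rewrite divr_ge0 ?(ltW e0)// ler_pdivrMr// mul1r.
Qed.

Lemma hweight0 : hweight 0 = 0.
Proof. by rewrite /hweight ltW// mul0r. Qed.

Lemma hweight_large r : eps <= r -> hweight r = 1.
Proof.
have e0 := eps_gt0; move=> re; rewrite /hweight; case: ifP => // re'.
have -> : r = eps by apply/eqP; rewrite eq_le re re'.
by rewrite divff// gt_eqF.
Qed.

Lemma hweight_lipschitz r r' : `|hweight r' - hweight r| <= `|r' - r| / eps.
Proof.
have e0 := eps_gt0; rewrite ler_pdivlMr// -[X in _ * X](gtr0_norm e0) -normrM mulrBl.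
have E s : hweight s * eps = Num.min s eps.
  rewrite /hweight; case: (leP s eps) => [se|es]; last by rewrite mul1r.
  by rewrite mulfVK// gt_eqF.
rewrite !E; case: (leP r' eps) => ?; case: (leP r eps) => ?.
- by [].
- by rewrite !ler0_norm ?subr_le0//; lra.
- by rewrite !ger0_norm ?subr_ge0//; lra.
- by rewrite subrr normr0.
Qed.

End Huber.

Lemma expR_le_quadratic {R : realType} (s : R) : `|s| <= 2^-1 -> expR s <= 1 + s + 2 * s ^+ 2.
Proof.
rewrite ler_norml => /andP[s1 s2].
have pos : 0 < 1 - s by lra.
have H : expR s * (1 - s) <= 1.
  rewrite -[leRHS](expRxMexpNx_1 s) ler_wpM2l ?expR_ge0//; exact: expR_ge1Dx.
rewrite -(ler_pM2r pos) (le_trans H)//.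
have -> : (1 + s + 2 * s ^+ 2) * (1 - s) = 1 + s ^+ 2 * (1 - 2 * s) by ring.
by rewrite lerDl mulr_ge0 ?sqr_ge0//; lra.
Qed.

Section Thresholding.
Context {R : realType} {d : nat} {E : finType}.
Local Notation V := (bool * 'I_d)%type.
Variables (p : 'rV[R]_d -> E -> V -> R) (K kappa : R).
Hypothesis p_lip : forall x y i v, `|p x i v - p y i v| <= K * enorm (x - y).
Hypothesis kappa_gt0 : 0 < kappa.
Hypothesis contraction : forall x y i, cube x -> cube y ->
     \sum_(u | dotp (x - y) (dir u) == 0) `|p x i u - p y i u|
     + \sum_u (p x i u - p y i u) * Num.sg (dotp (x - y) (dir u))
     <= - kappa * l1norm (x - y).

Lemma enorm_le (z : 'rV[R]_d) (a : R) : 0 <= a -> (forall j, `|z 0 j| <= a) ->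
  enorm z <= d%:R * a.
Proof.
move=> a0 za; rewrite /enorm -[leRHS]ger0_norm ?mulr_ge0// -sqrtr_sqr.
rewrite ler_wsqrtr// /dotp exprMn.
apply: (@le_trans _ _ (\sum_(j < d) a ^+ 2)).
  apply: ler_sum => j _; rewrite -expr2 -real_normK ?num_real//.
  by rewrite lerXn2r ?nnegrE.
rewrite sumr_const card_ord -[leLHS]mulr_natl ler_wpM2r ?sqr_ge0// -natrX ler_nat.
by case: (d) => // n; rewrite -mulnn leq_pmulr.
Qed.

Lemma dotp_dir (z : 'rV[R]_d) (u : V) : dotp z (dir u) = sgv u * z 0 u.2.
Proof.
rewrite /dotp (bigD1 u.2) //= dirE eqxx mulr1 big1 ?addr0 1?mulrC// => j ju.
by rewrite dirE (negPf ju) !mulr0.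
Qed.

Definition smoothing_cost : R := 2 * d%:R * (`|K| * d%:R) + kappa * d%:R.

(** The weights vanish near the faces x_j = 0, where the walk is reflected; the
    contraction between 0 and the point y obtained from x by setting the small
    coordinates to 0 controls exactly this weighted drift, because its first
    sum pays for the coordinates where y vanishes. *)
Lemma weighted_drift (eps : R) (x : 'rV[R]_d) i : 0 < eps -> cube x ->
  \sum_v (p x i v - p 0 i v) * (hweight eps (x 0 v.2) * sgv v)
    <= - kappa * l1norm x + smoothing_cost * eps.
Proof.
move=> e0 cx.
pose y : 'rV[R]_d := \row_j if eps <= x 0 j then x 0 j else 0.
have yE j : y 0 j = if eps <= x 0 j then x 0 j else 0 by rewrite mxE.
have cy : cube y by move=> j; rewrite yE; case: ifP => _; [exact: cx | rewrite lexx ler01].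
have c0 : cube (0 : 'rV[R]_d) by move=> j; rewrite mxE lexx ler01.
have x0 j : 0 <= x 0 j by case/andP: (cx j).
have xyE j : (x - y) 0 j = x 0 j - y 0 j by rewrite [LHS]mxE; congr (_ + _); rewrite [LHS]mxE.
have xy j : `|(x - y) 0 j| <= eps.
  rewrite xyE yE; case: ifPn; first by move=> _; rewrite subrr normr0 ltW.
  by rewrite -ltNge subr0 ger0_norm// => /ltW.
have Kxy : K * enorm (x - y) <= `|K| * d%:R * eps.
  rewrite (le_trans (_ : _ <= `|K| * enorm (x - y)))//.
    by rewrite ler_wpM2r ?sqrtr_ge0// ler_norm.
  by rewrite -mulrA ler_wpM2l// enorm_le// ltW.
have ws v : `|hweight eps (x 0 v.2) * sgv v| <= 1.
  have /andP[h0 h1] := hweight_itv e0 (x0 v.2).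
  by rewrite normrM (ger0_norm h0) /sgv; case: v.1; rewrite ?normrN normr1 mulr1.
have le_abs (a b : R) : `|b| <= 1 -> a * b <= `|a|.
  by move=> b1; rewrite (le_trans (ler_norm _))// normrM ler_piMr.
rewrite (eq_bigr (fun v => (p x i v - p y i v) * (hweight eps (x 0 v.2) * sgv v) +
  (p y i v - p 0 i v) * (hweight eps (x 0 v.2) * sgv v))); last by move=> v _; ring.
rewrite big_split /=.
have part1 : \sum_v (p x i v - p y i v) * (hweight eps (x 0 v.2) * sgv v)
    <= 2 * d%:R * (`|K| * d%:R * eps).
  apply: (@le_trans _ _ (\sum_(v : V) `|K| * d%:R * eps)).
    apply: ler_sum => v _; apply: le_trans (le_abs _ _ (ws v)) _.
    exact: le_trans (p_lip x y i v) Kxy.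
  by rewrite sumr_const card_prod card_bool card_ord -[leLHS]mulr_natl natrM.
have part2 : \sum_v (p y i v - p 0 i v) * (hweight eps (x 0 v.2) * sgv v)
    <= - kappa * l1norm y.
  have := contraction i cy c0; rewrite subr0; apply: le_trans.
  rewrite [X in _ <= X + _]big_mkcond -big_split /=; apply: ler_sum => v _.
  rewrite dotp_dir yE; case: (leP eps (x 0 v.2)) => ex; last first.
    rewrite mulr0 eqxx sgr0 mulr0 addr0; exact/le_abs/ws.
  rewrite (hweight_large e0 ex) mul1r.
  have xpos : 0 < x 0 v.2 by exact: lt_le_trans ex.
  have -> : Num.sg (sgv v * x 0 v.2) = sgv v.
    rewrite sgrM (gtr0_sg xpos) mulr1 /sgv; case: v.1; by rewrite ?sgrN sgr1.
  by rewrite lerDr; case: ifP.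
have yl : l1norm x - d%:R * eps <= l1norm y.
  rewrite lerBlDr /l1norm mulr_natl -[X in eps *+ X](card_ord d) -sumr_const -big_split /=.
  apply: ler_sum => j _; have := xy j; rewrite xyE => xyj.
  have -> : x 0 j = y 0 j + (x 0 j - y 0 j) by ring.
  by rewrite (le_trans (ler_normD _ _))// lerD2l.
rewrite (le_trans (lerD part1 part2))// /smoothing_cost.
have : kappa * (l1norm x - d%:R * eps) <= kappa * l1norm y by rewrite ler_wpM2l// ltW.
by rewrite mulrBr; lra.
Qed.

End Thresholding.
(** A negative drift beats the second order term of the exponential when theta is
    small. *)
Lemma exponential_drift {R : realType} {B : finType} (q D : B -> R) (C g theta : R) :
  (forall b, 0 <= q b) -> \sum_b q b = 1 -> (forall b, `|D b| <= C) ->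
  \sum_b q b * D b <= - g -> 0 <= theta -> theta * C <= 2^-1 ->
  2 * theta * C ^+ 2 <= g / 2 ->
  \sum_b q b * expR (theta * D b) <= expR (- (theta * g / 2)).
Proof.
move=> q0 q1 DC Dg t0 tC tCg.
have C0 (b : B) : 0 <= C by rewrite (le_trans _ (DC b)).
apply: (@le_trans _ _ (\sum_b (q b * (1 + 2 * (theta * C) ^+ 2) + theta * (q b * D b)))).
  apply: ler_sum => b _.
  have -> : q b * (1 + 2 * (theta * C) ^+ 2) + theta * (q b * D b) =
    q b * (1 + theta * D b + 2 * (theta * C) ^+ 2) by ring.
  rewrite ler_wpM2l//.
  have tD : `|theta * D b| <= theta * C by rewrite normrM ger0_norm// ler_wpM2l.
  rewrite (le_trans (expR_le_quadratic (le_trans tD tC)))// lerD2l ler_wpM2l//.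
  by rewrite -real_normK ?num_real// lerXn2r ?nnegrE// mulr_ge0//; exact: C0 b.
rewrite big_split /= -mulr_suml q1 mul1r -mulr_sumr.
apply: le_trans (expR_ge1Dx _).
have : theta * \sum_b q b * D b <= theta * - g by rewrite ler_wpM2l.
have : theta * (2 * theta * C ^+ 2) <= theta * (g / 2) by rewrite ler_wpM2l.
have -> : 2 * (theta * C) ^+ 2 = theta * (2 * theta * C ^+ 2) by ring.
by clear C0; lra.
Qed.

Section Lyapunov.
Context {R : realType} {d : nat} {E : finType}.
Local Notation V := (bool * 'I_d)%type.
Variables (p : 'rV[R]_d -> E -> V -> R) (P : E -> E -> R) (K kappa Cphi : R).
Variable phi : 'I_d -> E -> R.
Hypothesis p_law : jump_law p.
Hypothesis P_stochastic : stochastic P.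
Hypothesis p_lip : forall x y i v, `|p x i v - p y i v| <= K * enorm (x - y).
Hypothesis kappa_gt0 : 0 < kappa.
Hypothesis contraction : forall x y i, cube x -> cube y ->
     \sum_(u | dotp (x - y) (dir u) == 0) `|p x i u - p y i u|
     + \sum_u (p x i u - p y i u) * Num.sg (dotp (x - y) (dir u))
     <= - kappa * l1norm (x - y).
Hypothesis phi_bound : forall j i, `|phi j i| <= Cphi.
Hypothesis phi_corrector : forall j i,
  \sum_i' P i i' * phi j i' - phi j i <= - \sum_v p 0 i v * dir v 0 j.

Local Notation state := ('rV[R]_d * E)%type.

Lemma walk_kernel_ge0 m (z : state) b : 0 <= walk_kernel p P m z b.
Proof.
have [P0 _] := P_stochastic; have [p0 _] := p_law (m%:R^-1 *: z.1) z.2.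
exact: mulr_ge0.
Qed.

Lemma walk_kernel_sum1 m (z : state) : \sum_b walk_kernel p P m z b = 1.
Proof.
have [_ P1] := P_stochastic; have [_ p1] := p_law (m%:R^-1 *: z.1) z.2.
rewrite /walk_kernel -(pair_bigA _ (fun v i' => p (m%:R^-1 *: z.1) z.2 v * P z.2 i')) /=.
by under eq_bigr do rewrite -mulr_sumr P1 mulr1.
Qed.

Lemma lattice_cube m (X : 'rV[R]_d) : (0 < m)%N -> lattice m X -> cube (m%:R^-1 *: X).
Proof.
move=> m0 [_ Xbox] j; have /andP[X0 Xm] := Xbox j; rewrite mxE.
have mpos : 0 < m%:R :> R by rewrite ltr0n.
by rewrite mulr_ge0 ?invr_ge0//= mulrC ler_pdivrMr// mul1r.
Qed.

Lemma l1normZ m (X : 'rV[R]_d) : l1norm (m%:R^-1 *: X) = l1norm X / m%:R.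
Proof.
rewrite /l1norm mulr_suml; apply: eq_bigr => j _.
by rewrite mxE normrM (@ger0_norm _ m%:R^-1) ?invr_ge0// mulrC.
Qed.

Section FixedScale.
Variables (m : nat) (eps : R).
Hypotheses (m_gt0 : (0 < m)%N) (eps_gt0 : 0 < eps).

Let w (X : 'rV[R]_d) j := hweight eps (m%:R^-1 * X 0 j).

(** The smoothed l^1 norm, in lattice units, plus the corrector phi weighted by the
    derivative of the smoothing. *)
Definition potential (z : state) : R :=
  \sum_j (m%:R * huber eps (m%:R^-1 * z.1 0 j) + w z.1 j * phi j z.2).

(** First order part of the variation of the potential in one step. *)
Definition increment (X : 'rV[R]_d) (i : E) (b : V * E) : R :=
  w X b.1.2 * sgv b.1 + \sum_j w X j * (phi j b.2 - phi j i)
  + (2^-1 + Cphi) / (eps * m%:R).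

Let mpos : 0 < m%:R :> R. Proof. rewrite ltr0n; exact: m_gt0. Qed.

(** The step only moves one coordinate.  Its second order effect and the variation
    of the weight of the corrector are of order 1 / (eps m); a reflection can only
    decrease the first order term, which vanishes at x_j = 0. *)
Lemma potential_step X i b : lattice m X ->
  potential (walk_move m (X, i) b) <= potential (X, i) + increment X i b.
Proof.
case: b => v i' LX; rewrite /potential /increment /walk_move /=.
set Y := Defs.reflect m (X + dir v).
have LY : lattice m Y by exact: reflect_lattice.
have e0 := eps_gt0.
have scaled_ge0 (Z : 'rV[R]_d) j : lattice m Z -> 0 <= m%:R^-1 * Z 0 j.
  by case=> _ /(_ j) /andP[Z0 _]; rewrite mulr_ge0 ?invr_ge0.
have [off on] := reflect_step_cases v m_gt0 LX.
rewrite (bigD1 v.2) //= [in leRHS](bigD1 v.2) //= [X in _ + (_ + X + _)](bigD1 v.2) //=.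
have -> : \sum_(j < d | j != v.2)
   (m%:R * huber eps (m%:R^-1 * Y 0 j) + w Y j * phi j i') =
   \sum_(j < d | j != v.2) (m%:R * huber eps (m%:R^-1 * X 0 j) + w X j * phi j i)
   + \sum_(j < d | j != v.2) w X j * (phi j i' - phi j i).
  rewrite -big_split /=; apply: eq_bigr => j jv; rewrite /w off//; ring.
set s1 := \sum_(j < d | _) _; set s2 := \sum_(j < d | _) _.
suff : m%:R * huber eps (m%:R^-1 * Y 0 v.2) + w Y v.2 * phi v.2 i' <=
  m%:R * huber eps (m%:R^-1 * X 0 v.2) + w X v.2 * phi v.2 i + w X v.2 * sgv v +
  w X v.2 * (phi v.2 i' - phi v.2 i) + (2^-1 + Cphi) / (eps * m%:R) by lra.
have hq := huber_quadratic e0 (scaled_ge0 X v.2 LX) (scaled_ge0 Y v.2 LY).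
have hl := hweight_lipschitz e0 (m%:R^-1 * X 0 v.2) (m%:R^-1 * Y 0 v.2).
have XY := reflect_step_le1 v v.2 m_gt0 LX; rewrite -/Y in XY.
have /andP[w0 w1] := hweight_itv e0 (scaled_ge0 X v.2 LX).
have wstep : w X v.2 * (Y 0 v.2 - X 0 v.2) <= w X v.2 * sgv v.
  case: on => -[].
  - by move=> _ ->; rewrite addrAC subrr add0r.
  - by move=> x0 _ _; rewrite /w x0 mulr0 hweight0// !mul0r.
  - by move=> xm -> ->; rewrite ler_wpM2l// xm; lra.
have quad : m%:R * ((m%:R^-1 * Y 0 v.2 - m%:R^-1 * X 0 v.2) ^+ 2 / (2 * eps)) <=
    2^-1 / (eps * m%:R).
  rewrite -mulrBr exprMn.
  have -> : m%:R * (m%:R^-1 ^+ 2 * (Y 0 v.2 - X 0 v.2) ^+ 2 / (2 * eps)) =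
    (Y 0 v.2 - X 0 v.2) ^+ 2 * (2^-1 / (eps * m%:R)).
    by field; rewrite !gt_eqF.
  have sq1 : (Y 0 v.2 - X 0 v.2) ^+ 2 <= 1.
    by rewrite -real_normK ?num_real// exprn_ile1.
  apply: ler_piMl sq1; apply: divr_ge0; first by rewrite invr_ge0.
  exact: ltW (mulr_gt0 e0 mpos).
have lin : m%:R * (w X v.2 * (m%:R^-1 * Y 0 v.2 - m%:R^-1 * X 0 v.2)) =
   w X v.2 * (Y 0 v.2 - X 0 v.2) by field; rewrite gt_eqF.
have wlip : (w Y v.2 - w X v.2) * phi v.2 i' <= Cphi / (eps * m%:R).
  rewrite (le_trans (ler_norm _))// normrM.
  have -> : Cphi / (eps * m%:R) = (m%:R^-1 / eps) * Cphi by rewrite invfM; ring.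
  rewrite ler_pM ?normr_ge0// ?phi_bound// (le_trans hl)//.
  rewrite -mulrBr normrM ger0_norm ?invr_ge0 ?(ltW mpos)//.
  by rewrite ler_wpM2r ?invr_ge0 ?(ltW e0)// ler_piMr ?invr_ge0 ?(ltW mpos).
have : m%:R * huber eps (m%:R^-1 * Y 0 v.2) <= m%:R * huber eps (m%:R^-1 * X 0 v.2) +
    w X v.2 * sgv v + 2^-1 / (eps * m%:R).
  have := hq; rewrite -(ler_pM2l mpos) 2!mulrDr lin => /le_trans; apply.
  by rewrite lerD// lerD.
move: wlip; rewrite mulrBl [in X in _ -> _ -> X](mulrDl 2^-1); lra.
Qed.

(** Averaging over the environment, the corrector turns the weighted drift at
    (x, i) into its difference with the weighted drift at (0, i), which
    [weighted_drift] controls. *)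
Lemma increment_mean X i : lattice m X ->
  \sum_b walk_kernel p P m (X, i) b * increment X i b <=
  - kappa * (l1norm X / m%:R) + @smoothing_cost R d K kappa * eps + (2^-1 + Cphi) / (eps * m%:R).
Proof.
move=> LX; have [P0 P1] := P_stochastic.
have cx := lattice_cube m_gt0 LX; set x := m%:R^-1 *: X in cx.
have [p0 p1] := p_law x i.
have xE j : x 0 j = m%:R^-1 * X 0 j by rewrite mxE.
have w0 j : 0 <= w X j.
  by rewrite /w -xE; case/andP: (hweight_itv eps_gt0 (proj1 (andP (cx j)))).
have wd := weighted_drift p_lip kappa_gt0 contraction i eps_gt0 cx.
rewrite l1normZ in wd.
pose c := (2^-1 + Cphi) / (eps * m%:R).
have split_sum : \sum_b walk_kernel p P m (X, i) b * increment X i b =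
  \sum_v p x i v * (w X v.2 * sgv v) + \sum_j w X j * (\sum_i' P i i' * phi j i' - phi j i) + c.
  transitivity (\sum_v \sum_i' p x i v * P i i' *
     (w X v.2 * sgv v + \sum_j w X j * (phi j i' - phi j i) + c)).
    by rewrite (pair_bigA _ (fun v i' => p x i v * P i i' *
     (w X v.2 * sgv v + \sum_j w X j * (phi j i' - phi j i) + c))).
  have inner v : \sum_i' p x i v * P i i' *
     (w X v.2 * sgv v + \sum_j w X j * (phi j i' - phi j i) + c) =
     p x i v * (w X v.2 * sgv v + \sum_j w X j * (\sum_i' P i i' * phi j i' - phi j i) + c).
    under eq_bigr do rewrite -mulrA.
    rewrite -mulr_sumr; congr (_ * _); under eq_bigr do rewrite 2!mulrDr.
    rewrite !big_split /= -!mulr_suml P1 !mul1r; congr (_ + _ + _).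
    under eq_bigr do rewrite mulr_sumr.
    rewrite exchange_big /=; apply: eq_bigr => j _.
    rewrite -[phi j i in RHS]mul1r -(P1 i) mulr_suml -sumrB mulr_sumr.
    by apply: eq_bigr => i' _; ring.
  under eq_bigr do rewrite inner 2!mulrDr.
  by rewrite !big_split /= -!mulr_suml p1 !mul1r.
rewrite split_sum -/c lerD2r.
have corr : \sum_j w X j * (\sum_i' P i i' * phi j i' - phi j i) <=
   - \sum_v p 0 i v * (w X v.2 * sgv v).
  apply: (@le_trans _ _ (\sum_j w X j * (- \sum_v p 0 i v * dir v 0 j))).
    by apply: ler_sum => j _; rewrite ler_wpM2l.
  under eq_bigr do rewrite mulrN mulr_sumr.
  rewrite sumrN lerN2 exchange_big /= le_eqVlt; apply/orP; left; apply/eqP.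
  apply: eq_bigr => v _; rewrite (bigD1 v.2) //= dirE eqxx mulr1 big1.
    by rewrite addr0; ring.
  by move=> j jv; rewrite dirE (negPf jv) !mulr0.
apply: le_trans wd; rewrite (le_trans (lerD (lexx _) corr))//.
rewrite -sumrN -big_split /= le_eqVlt; apply/orP; left; apply/eqP.
by apply: eq_bigr => v _; rewrite /w xE; ring.
Qed.

Lemma increment_bound X i b : lattice m X -> (2^-1 + Cphi) / (eps * m%:R) <= 1 ->
  `|increment X i b| <= 2 + 2 * Cphi * d%:R.
Proof.
move=> LX c1; have cx := lattice_cube m_gt0 LX.
have w01 j : 0 <= w X j <= 1.
  apply: (hweight_itv eps_gt0); have /andP[+ _] := cx j; by rewrite mxE.
have Cphi0 : 0 <= Cphi by rewrite (le_trans _ (phi_bound b.1.2 i)).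
have c0 : 0 <= (2^-1 + Cphi) / (eps * m%:R).
  by rewrite divr_ge0 ?addr_ge0 ?invr_ge0// mulr_ge0 ?(ltW eps_gt0).
have t1 : `|w X b.1.2 * sgv b.1| <= 1.
  have /andP[h0 h1] := w01 b.1.2.
  by rewrite normrM (ger0_norm h0) /sgv; case: b.1.1; rewrite ?normrN normr1 mulr1.
have t2 : `|\sum_j w X j * (phi j b.2 - phi j i)| <= 2 * Cphi * d%:R.
  rewrite (le_trans (ler_norm_sum _ _ _))//.
  apply: (@le_trans _ _ (\sum_(j < d) 2 * Cphi)).
    apply: ler_sum => j _; have /andP[h0 h1] := w01 j.
    rewrite normrM (ger0_norm h0) (le_trans (_ : _ <= 1 * `|phi j b.2 - phi j i|))//.
      by rewrite ler_wpM2r.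
    rewrite mul1r (le_trans (ler_normB _ _))//.
    by have := phi_bound j b.2; have := phi_bound j i; lra.
  by rewrite sumr_const card_ord mulr_natr.
rewrite /increment (le_trans (ler_normD _ _))// (ger0_norm c0).
have := ler_normD (w X b.1.2 * sgv b.1) (\sum_j w X j * (phi j b.2 - phi j i)).
by lra.
Qed.

Lemma potential_bounds X i : lattice m X ->
  l1norm X - (m%:R * eps / 2 + Cphi) * d%:R <= potential (X, i) <= l1norm X + Cphi * d%:R.
Proof.
move=> LX; have cx := lattice_cube m_gt0 LX; have [_ Xbox] := LX.
have x0 j : 0 <= m%:R^-1 * X 0 j by have /andP[+ _] := cx j; rewrite mxE.
have term j : `|w X j * phi j i| <= Cphi.
  have /andP[h0 h1] := hweight_itv eps_gt0 (x0 j).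
  rewrite normrM (ger0_norm h0) (le_trans _ (phi_bound j i))//.
  by rewrite ler_piMl.
have hub j : X 0 j - m%:R * eps / 2 <= m%:R * huber eps (m%:R^-1 * X 0 j) <= X 0 j.
  have /andP[h1 h2] := huber_bounds eps_gt0 (x0 j).
  have mK : m%:R * (m%:R^-1 * X 0 j) = X 0 j by field; rewrite gt_eqF.
  apply/andP; split; last by rewrite -[leRHS]mK ler_pM2l.
  have : m%:R * (m%:R^-1 * X 0 j - eps / 2) <= m%:R * huber eps (m%:R^-1 * X 0 j).
    by rewrite ler_pM2l.
  by rewrite mulrBr mK mulrA.
have absE j : `|X 0 j| = X 0 j by rewrite ger0_norm//; case/andP: (Xbox j).
have cst (a : R) : a * d%:R = \sum_(j < d) a by rewrite sumr_const card_ord mulr_natr.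
rewrite /l1norm /potential !cst -sumrB -big_split /=.
apply/andP; split; apply: ler_sum => j _; rewrite absE;
  have := term j; rewrite ler_norml => /andP[? ?]; have /andP[? ?] := hub j; lra.
Qed.

End FixedScale.

Hypothesis Cphi_ge0 : 0 <= Cphi.

(** The smoothing level eps is chosen small with respect to kappa delta, so that
    the drift of the potential is below - kappa delta / 2 outside of the ball of
    radius delta m; theta is then small enough for [exponential_drift]. *)
Theorem lyapunov (delta : R) : 0 < delta ->
  exists theta rho C : R, exists m0 : nat,
  [/\ 0 < theta, 0 < rho, 0 <= C & (0 < m0)%N] /\
  forall m, (m0 <= m)%N -> exists W : state -> R, forall X i, lattice m X ->
    [/\ expR (theta * (l1norm X - delta * m%:R - C)) <= W (X, i)
          <= expR (theta * (l1norm X + C)),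
        delta * m%:R <= l1norm X ->
          avg (walk_kernel p P m) (walk_move m) W (X, i) <= expR (- rho) * W (X, i) &
        l1norm X < delta * m%:R ->
          avg (walk_kernel p P m) (walk_move m) W (X, i)
            <= expR (theta * (delta * m%:R + C))].
Proof.
move=> delta0.
have k0 := kappa_gt0; have c0 := Cphi_ge0.
have d0 : 0 <= d%:R :> R by [].
pose S := @smoothing_cost R d K kappa.
have S0 : 0 <= S by rewrite /S /smoothing_cost addr_ge0 ?mulr_ge0// ltW.
have kd0 : 0 < kappa * delta by rewrite mulr_gt0.
pose eps := Num.min (kappa * delta / 4 / (S + 1)) (delta / (d%:R + 1)).
have S1 : 0 < S + 1 by lra.
have d1 : 0 < d%:R + 1 :> R by lra.
have eps0 : 0 < eps by rewrite lt_min !divr_gt0.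
have Seps : S * eps <= kappa * delta / 4.
  have : (S + 1) * eps <= kappa * delta / 4.
    by rewrite mulrC -ler_pdivlMr// ge_min lexx.
  by move: eps0; nra.
have deps : d%:R * eps <= delta.
  have : (d%:R + 1) * eps <= delta by rewrite mulrC -ler_pdivlMr// ge_min lexx orbT.
  by move: eps0; nra.
pose C0 := 2 + 2 * Cphi * d%:R.
have Cd0 : 0 <= Cphi * d%:R by rewrite mulr_ge0.
have C0pos : 0 < C0 by rewrite /C0; lra.
pose g := kappa * delta / 2.
pose theta := Num.min (2 * C0)^-1 (g / 4 / C0 ^+ 2).
have g0 : 0 < g by rewrite divr_gt0.
have theta0 : 0 < theta by rewrite lt_min invr_gt0 !divr_gt0 ?exprn_gt0 ?mulr_gt0.
have tC : theta * C0 <= 2^-1.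
  have : theta * (2 * C0) <= 1.
    by rewrite -ler_pdivlMr ?mulr_gt0// mul1r ge_min lexx.
  by lra.
have tC2 : 2 * theta * C0 ^+ 2 <= g / 2.
  have : theta * C0 ^+ 2 <= g / 4.
    by rewrite -ler_pdivlMr ?exprn_gt0// ge_min lexx orbT.
  by lra.
pose B := (2^-1 + Cphi) / eps / Num.min 1 (kappa * delta / 4).
have min0 : 0 < Num.min 1 (kappa * delta / 4) by rewrite lt_min ltr01 divr_gt0.
have B0 : 0 <= B by rewrite !divr_ge0 ?addr_ge0 ?invr_ge0// ltW.
exists theta, (theta * g / 2), (Cphi * d%:R + C0), (Num.truncn B).+1.
split; first by split => //; rewrite ?divr_gt0 ?mulr_gt0// addr_ge0// ltW.
move=> m mB.
have m0 : (0 < m)%N by exact: leq_ltn_trans mB.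
have mpos : 0 < m%:R :> R by rewrite ltr0n.
have cm : (2^-1 + Cphi) / (eps * m%:R) <= Num.min 1 (kappa * delta / 4).
  rewrite invfM mulrA ler_pdivrMr// [leRHS]mulrC -ler_pdivrMr// -/B.
  by rewrite (le_trans (ltW (truncnS_gt B)))// ler_nat.
have cm1 : (2^-1 + Cphi) / (eps * m%:R) <= 1 by rewrite (le_trans cm)// ge_min lexx.
have cmk : (2^-1 + Cphi) / (eps * m%:R) <= kappa * delta / 4.
  by rewrite (le_trans cm)// ge_min lexx orbT.
pose W z := expR (theta * potential m eps z).
exists W => X i LX.
have /andP[lo up] := potential_bounds m0 eps0 i LX.
have avgW : avg (walk_kernel p P m) (walk_move m) W (X, i) <=
    W (X, i) * \sum_b walk_kernel p P m (X, i) b * expR (theta * increment m eps X i b).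
  rewrite /avg mulr_sumr; apply: ler_sum => b _.
  rewrite mulrCA ler_wpM2l ?walk_kernel_ge0// /W -expRD ler_expR -mulrDr.
  by rewrite ler_pM2l// potential_step.
have incb b := increment_bound m0 eps0 i b LX cm1.
split.
- rewrite /W !ler_expR !ler_pM2l//; apply/andP; split; last by move: up C0pos; lra.
  apply: le_trans lo; rewrite mulrDl.
  have : m%:R * eps / 2 * d%:R <= delta * m%:R.
    have : m%:R * (d%:R * eps) <= m%:R * delta by rewrite ler_pM2l.
    have : 0 <= m%:R * (d%:R * eps) by rewrite !mulr_ge0// ltW.
    by nra.
  by move: C0pos; lra.
- move=> Xd; apply: le_trans avgW _; rewrite mulrC ler_wpM2r ?expR_ge0//.
  apply: exponential_drift incb _ (ltW theta0) tC tC2; try exact: walk_kernel_ge0; try exact: walk_kernel_sum1.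
  apply: le_trans (increment_mean m0 eps0 i LX) _.
  have : kappa * delta <= kappa * (l1norm X / m%:R) by rewrite ler_pM2l// ler_pdivlMr.
  by move: cmk Seps; rewrite /g -/S mulNr; lra.
- move=> Xd; apply: le_trans avgW _.
  apply: (@le_trans _ _ (W (X, i) * expR (theta * C0))).
    rewrite ler_wpM2l ?expR_ge0//.
    rewrite -[leRHS]mul1r -(walk_kernel_sum1 m (X, i)) mulr_suml.
    apply: ler_sum => b _; rewrite ler_wpM2l ?walk_kernel_ge0// ler_expR ler_pM2l//.
    by rewrite (le_trans (ler_norm _))// incb.
  rewrite /W -expRD ler_expR -mulrDr ler_pM2l//.
  by move: up Xd; lra.
Qed.

End Lyapunov.

(** * The exit takes an exponential time *)

Section GenericBounds.
Context {R : realFieldType} {T : Type} {B : finType}.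
Variables (q : T -> B -> R) (st : T -> B -> T).
Hypothesis q_ge0 : forall z b, 0 <= q z b.
Hypothesis q_sum1 : forall z, \sum_b q z b = 1.
Variable D : T -> Prop.
Hypothesis D_st : forall z b, D z -> D (st z b).

(** Markov inequality at each of the times 0, ..., n for a function whose mean
    increases by at most c in one step. *)
Lemma hit_prob_le_lyapunov (S : T -> bool) (W : T -> R) (c w : R) : 0 < w ->
  (forall z, D z -> 0 <= W z) -> 0 <= c ->
  (forall z, D z -> avg q st W z <= W z + c) ->
  (forall z, D z -> S z -> w <= W z) ->
  forall n z, D z -> 1 - surv q st S n z <= (W z + n%:R * c) / w.
Proof.
move=> w0 W0 c0 Wc Ww; elim=> [|n IH] z Dz.
  have [Sz|Sz] := boolP (S z).
    by rewrite surv_in// subr0 mul0r addr0 ler_pdivlMr// mul1r Ww.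
  by rewrite surv0// subrr mul0r addr0 divr_ge0 ?W0// ltW.
have [Sz|Sz] := boolP (S z).
  rewrite surv_in// subr0 ler_pdivlMr// mul1r (le_trans (Ww z Dz Sz))// lerDl.
  by rewrite mulr_ge0.
rewrite survS// -[X in X - _](avg_cst st q_sum1 1 z) -avgB.
apply: (@le_trans _ _ (avg q st (fun y => w^-1 * W y + n%:R * c / w) z)).
  apply: le_avg => // b.
  have -> : w^-1 * W (st z b) + n%:R * c / w = (W (st z b) + n%:R * c) / w by ring.
  exact: IH (D_st b Dz).
rewrite avg_affine// mulrC -mulrDl ler_pM2r ?invr_gt0// -(natr1 n).
have := Wc z Dz; rewrite mulrDl mul1r; lra.
Qed.

Lemma kernel_le1 z b : q z b <= 1.
Proof. by rewrite -(q_sum1 z) (bigD1 b) //= lerDl sumr_ge0. Qed.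

Lemma surv_one_step (S : T -> bool) n z b (a c : R) : 0 <= a -> 0 <= c -> a <= 1 ->
  c <= q z b -> surv q st S n (st z b) <= 1 - a -> surv q st S n.+1 z <= 1 - c * a.
Proof.
move=> a0 c0 a1 cq Ha.
have c1 : c <= 1 by rewrite (le_trans cq)// kernel_le1.
have ca1 : c * a <= 1 by rewrite mulr_ile1.
have [Sz|Sz] := boolP (S z); first by rewrite surv_in// subr_ge0.
rewrite survS// -[X in X - _](q_sum1 z) /avg (bigD1 b) //= [in leRHS](bigD1 b) //=.
have : \sum_(b0 | b0 != b) q z b0 * surv q st S n (st z b0) <= \sum_(b0 | b0 != b) q z b0.
  apply: ler_sum => b0 _; rewrite ler_piMr//; exact: surv_le1.
have : q z b * surv q st S n (st z b) <= q z b * (1 - a) by rewrite ler_wpM2l.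
have : c * a <= q z b * a by rewrite ler_wpM2r.
rewrite mulrBr mulr1; lra.
Qed.

(** A return to the set [small], where the exit set S is met within k steps with
    probability at least c, takes place at a geometric rate. *)
Lemma surv_le_return (S : T -> bool) (small : T -> Prop) (W : T -> R) (k : nat) (c w beta : R) :
  0 <= c <= 1 -> 0 < w -> (forall z, D z -> w <= W z) -> 0 <= beta ->
  (forall z, D z -> small z -> surv q st S k z <= 1 - c) ->
  (forall z, D z -> ~ small z -> avg q st W z <= beta * W z) ->
  forall n z, D z -> surv q st S (n + k) z <= 1 - c + c * (W z * beta ^+ n / w).
Proof.
move=> /andP[c0 c1] w0 Ww b0 Hsmall Hbig.
have term0 n z : D z -> 0 <= c * (W z * beta ^+ n / w).
  move=> Dz; rewrite mulr_ge0 ?divr_ge0 ?mulr_ge0 ?exprn_ge0 ?(ltW w0)//.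
  exact: le_trans (ltW w0) (Ww z Dz).
elim=> [|n IH] z Dz; have [sz|sz] := pselect (small z).
- by rewrite add0n (le_trans (Hsmall z Dz sz))// lerDl term0.
- rewrite (le_trans (surv_le1 st q_ge0 q_sum1 _ _ _))// expr0 mulr1.
  suff : c <= c * (W z / w) by lra.
  by rewrite ler_peMr// ler_pdivlMr// mul1r Ww.
- rewrite (le_trans (surv_anti st q_ge0 q_sum1 _ _ (leq_addl _ _)))//.
  by rewrite (le_trans (Hsmall z Dz sz))// lerDl term0.
- have [Sz|Sz] := boolP (S z).
    by rewrite surv_in// addr_ge0 ?term0// subr_ge0.
  rewrite addSn survS//.
  apply: (@le_trans _ _ (avg q st (fun y => (c * beta ^+ n / w) * W y + (1 - c)) z)).
    apply: le_avg => // b; rewrite addrC.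
    have -> : c * beta ^+ n / w * W (st z b) = c * (W (st z b) * beta ^+ n / w) by ring.
    exact: IH (D_st b Dz).
  rewrite avg_affine// addrC lerD2l.
  have -> : c * (W z * beta ^+ n.+1 / w) = c * beta ^+ n / w * (beta * W z) by rewrite exprS; ring.
  by rewrite ler_wpM2l ?Hbig// divr_ge0 ?mulr_ge0 ?exprn_ge0// ltW.
Qed.

End GenericBounds.

Lemma expRN_le {R : realType} (e y : R) : 0 < e -> e^-1 <= y -> expR (- y) <= e.
Proof.
move=> e0 ey; have y0 : 0 < y by apply: lt_le_trans ey; rewrite invr_gt0.
rewrite expRN invf_ple ?posrE ?expR_gt0//.
by rewrite (le_trans ey)// (le_trans _ (expR_ge1Dx y))// lerDr.
Qed.

Lemma linear_large {R : realType} (a b : R) : 0 < a ->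
  exists m1 : nat, forall m, (m1 <= m)%N -> b <= a * m%:R.
Proof.
move=> a0; exists (Num.truncn (`|b| / a)).+1 => m mm.
rewrite mulrC -ler_pdivrMr//.
apply: (@le_trans _ _ (`|b| / a)); first by rewrite ler_pM2r ?invr_gt0// ler_norm.
by rewrite (le_trans (ltW (truncnS_gt _)))// ler_nat.
Qed.

Section SlowExit.
Context {R : realType} {d : nat} {E : finType}.
Local Notation V := (bool * 'I_d)%type.
Variables (p : 'rV[R]_d -> E -> V -> R) (P : E -> E -> R) (l : R).
Hypothesis p_law : jump_law p.
Hypothesis P_stochastic : stochastic P.
Local Notation state := ('rV[R]_d * E)%type.

(** The conclusion of [lyapunov], as a property of the walk: a function that grows
    like exp (theta |X|_1), up to the error delta m in the exponent, and decreases
    in mean by a constant factor outside of the l^1 ball of radius delta m. *)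
Definition has_lyapunov := forall delta : R, 0 < delta ->
  exists theta rho C : R, exists m0 : nat,
  [/\ 0 < theta, 0 < rho, 0 <= C & (0 < m0)%N] /\
  forall m, (m0 <= m)%N -> exists W : state -> R, forall X i, lattice m X ->
    [/\ expR (theta * (l1norm X - delta * m%:R - C)) <= W (X, i)
          <= expR (theta * (l1norm X + C)),
        delta * m%:R <= l1norm X ->
          avg (walk_kernel p P m) (walk_move m) W (X, i) <= expR (- rho) * W (X, i) &
        l1norm X < delta * m%:R ->
          avg (walk_kernel p P m) (walk_move m) W (X, i)
            <= expR (theta * (delta * m%:R + C))].

Hypothesis lyap : has_lyapunov.

Definition target_state m (z : state) : bool := on_target m l z.1.

Lemma walk_move_lattice m (z : state) b : (0 < m)%N ->
  lattice m z.1 -> lattice m (walk_move m z b).1.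
Proof. by move=> m0 Lz; exact: reflect_lattice. Qed.

Lemma on_target_l1norm m (X : 'rV[R]_d) : (0 < m)%N -> on_target m l X ->
  l1norm X = (Num.floor (m%:R * l))%:~R.
Proof.
move=> m0 /asboolP[_ _]; rewrite l1normZ mulrC.
have : m%:R^-1 != 0 :> R by rewrite invr_eq0 pnatr_eq0 -lt0n.
by move=> mn0 /(mulfI mn0).
Qed.

(** With delta = eta / 4, the Lyapunov function at the start and its mean increase
    inside of the ball are both smaller than on the target by a factor
    exp (- theta eta m / 2), of which n <= exp (theta eta m / 8) steps use only a
    part. *)
Lemma slow_exit (eta : R) : 0 < eta -> eta <= l ->
  exists2 c : R, 0 < c & forall e : R, 0 < e -> exists m1, forall m, (m1 <= m)%N ->
  forall n X i, lattice m X -> l1norm X <= (l - eta) * m%:R -> n%:R <= expR (c * m%:R) ->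
  1 - e <= surv (walk_kernel p P m) (walk_move m) (target_state m) n (X, i).
Proof.
move=> eta0 etal.
have [|theta [rho [C [m0 [[th0 rho0 C0 m00] HW]]]]] := lyap (delta := eta / 4).
  by rewrite divr_gt0.
pose c := theta * eta / 8; have c0 : 0 < c by rewrite divr_gt0 ?mulr_gt0.
exists c => // e e0.
have [m1 Hm1] := @linear_large R c ((e / 2)^-1 + theta * (2 * C + 1)) c0.
exists (maxn m0 m1) => m; rewrite geq_max => /andP[mm0 mm1] n X i LX Xl nc.
have mpos : (0 < m)%N by exact: leq_trans mm0.
have mr0 : 0 < m%:R :> R by rewrite ltr0n.
have [W HWm] := HW m mm0.
set M : R := m%:R in nc Xl HWm mr0 *.
have HWz (z : state) : lattice m z.1 ->
    [/\ expR (theta * (l1norm z.1 - eta / 4 * M - C)) <= W z,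
      W z <= expR (theta * (l1norm z.1 + C)) &
      avg (walk_kernel p P m) (walk_move m) W z <= W z + expR (theta * (eta / 4 * M + C))].
  case: z => Y j /= LY; have [/andP[h1 h2] h3 h4] := HWm Y j LY; split => //.
  have W0 : 0 <= W (Y, j) by exact: le_trans (expR_ge0 _) h1.
  have [Ybig|Ysmall] := leP (eta / 4 * M) (l1norm Y).
    rewrite (le_trans (h3 Ybig))// (le_trans (_ : _ <= W (Y, j)))//; last by rewrite lerDl expR_ge0.
    by rewrite ler_piMl// -expR0 ler_expR oppr_le0 ltW.
  by rewrite (le_trans (h4 Ysmall))// lerDr.
pose w := expR (theta * (l * M - 1 - eta / 4 * M - C)).
have := @hit_prob_le_lyapunov R _ _ (walk_kernel p P m) (walk_move m)
  (walk_kernel_ge0 p_law P_stochastic m) (walk_kernel_sum1 p_law P_stochastic m)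
  (fun z => lattice m z.1) (fun z b => @walk_move_lattice m z b mpos) (target_state m) W
  (expR (theta * (eta / 4 * M + C))) w (expR_gt0 _).
move=> /(_ _ _ _ _ n (X, i) LX) H.
have {}H : 1 - surv (walk_kernel p P m) (walk_move m) (target_state m) n (X, i) <=
   (W (X, i) + n%:R * expR (theta * (eta / 4 * M + C))) / w.
  apply: H.
  - by move=> z Lz; have [h _ _] := HWz z Lz; exact: le_trans (expR_ge0 _) h.
  - exact: expR_ge0.
  - by move=> z Lz; have [_ _] := HWz z Lz.
  - move=> z Lz tz; have [h _ _] := HWz z Lz; apply: le_trans h.
    rewrite ler_expR ler_pM2l//; rewrite !lerB//.
    have := on_target_l1norm mpos tz; move=> ->.
    by have := floorD1_gt (M * l); rewrite intrD /M; lra.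
suff : (W (X, i) + n%:R * expR (theta * (eta / 4 * M + C))) / w <= e by lra.
have [_ hW _] := HWz (X, i) LX.
have s1 : W (X, i) / w <= e / 2.
  rewrite /w -expRN (le_trans (_ : _ <= expR (theta * (l1norm X + C)) * expR (- (theta * (l * M - 1 - eta / 4 * M - C)))))//.
    by rewrite ler_wpM2r ?expR_ge0.
  rewrite -expRD.
  have -> : theta * (l1norm X + C) + - (theta * (l * M - 1 - eta / 4 * M - C)) =
     - (theta * (l * M - 1 - eta / 4 * M - C - l1norm X - C)) by ring.
  apply: expRN_le; first by rewrite divr_gt0.
  have : theta * l1norm X <= theta * ((l - eta) * M) by rewrite ler_pM2l.
  have := Hm1 m mm1; rewrite -/M /c.
  have : 0 <= theta * eta * M by rewrite !mulr_ge0// ltW.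
  by lra.
have s2 : n%:R * expR (theta * (eta / 4 * M + C)) / w <= e / 2.
  apply: (@le_trans _ _ (expR (c * M) * expR (theta * (eta / 4 * M + C)) * expR (- (theta * (l * M - 1 - eta / 4 * M - C))))).
    by rewrite /w -expRN ler_wpM2r ?expR_ge0// ler_wpM2r ?expR_ge0.
  rewrite -!expRD.
  have -> : c * M + theta * (eta / 4 * M + C) + - (theta * (l * M - 1 - eta / 4 * M - C)) =
     - (theta * (l * M - 1 - eta / 4 * M - C - (eta / 4 * M + C)) - c * M) by ring.
  apply: expRN_le; first by rewrite divr_gt0.
  have : theta * eta * M <= theta * l * M by rewrite ler_wpM2r ?(ltW mr0)// ler_pM2l.
  have := Hm1 m mm1; rewrite -/M /c.
  have : 0 <= theta * eta * M by rewrite !mulr_ge0// ltW.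
  by lra.
rewrite mulrDl; lra.
Qed.

End SlowExit.

(** * The atom is reached fast *)

Section JumpLowerBound.
Context {R : realType} {d : nat} {E : finType}.
Local Notation V := (bool * 'I_d)%type.

Lemma positive_lower_bound (T : finType) (Q : T -> R -> Prop) :
  (forall t, exists2 c : R, 0 < c & forall r, Q t r -> c <= r) ->
  exists2 c : R, 0 < c <= 1 & forall t r, Q t r -> c <= r.
Proof.
move=> H.
suff [c c0 Hc] : exists2 c : R, 0 < c & forall t r, t \in enum T -> Q t r -> c <= r.
  exists (Num.min c 1); first by rewrite lt_min c0 ltr01 ge_min lexx orbT.
  by move=> t r Qr; rewrite (le_trans (_ : _ <= c)) ?ge_min ?lexx// (Hc t)// mem_enum.
elim: (enum T) => [|t s [c c0 IH]]; first by exists 1.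
have [c' c'0 Hc'] := H t; exists (Num.min c c'); first by rewrite lt_min c0.
move=> u r; rewrite inE => /orP[/eqP->|us] Qr.
  by rewrite (le_trans (_ : _ <= c')) ?ge_min ?lexx ?orbT// Hc'.
by rewrite (le_trans (_ : _ <= c)) ?ge_min ?lexx// (IH u).
Qed.

Lemma coord_le_norm (z : 'rV[R]_d) j : `|z 0 j| <= `|z|.
Proof.
by rewrite [leRHS]/Num.norm /= mx_normrE; apply/bigmax_geP; right => /=; exists (0, j).
Qed.

(** The jump probabilities are continuous, and the cube is compact. *)
Lemma jump_lower_bound (p : 'rV[R]_d -> E -> V -> R) :
  jump_lipschitz p -> (forall x i v, 0 < p x i v) ->
  exists2 c : R, 0 < c <= 1 & forall x i v, cube x -> c <= p x i v.
Proof.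
move=> [K p_lip] p_pos.
have [|c c01 Hc] := @positive_lower_bound (E * V)%type
  (fun t r => exists2 x, cube x & r = p x t.1 t.2); last first.
  by exists c => // x i v cx; apply: (Hc (i, v)); exists x.
move=> [i v] /=; pose A := [set x : 'rV[R]_d | cube x].
have cA : compact A.
  rewrite (_ : A = [set x : 'rV[R]_d | forall j, x ord0 j \in `[0, 1]]).
    by apply: (@rV_compact _ _ (fun=> `[(0 : R), (1 : R)]%classic)) => j; exact: segment_compact.
  by apply/seteqP; split => x /= H j; have := H j; rewrite /= ?in_itv.
have A0 : A !=set0 by exists 0 => j; rewrite mxE lexx ler01.
have cf : {within A, continuous (fun x : 'rV[R]_d => p x i v)}.
  apply: continuous_subspaceT => x U /nbhs_ballP[e /= e0 eU].
  have D0 : 0 < `|K| * d%:R + 1 by rewrite ltr_wpDl ?mulr_ge0.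
  apply/nbhs_ballP; exists (e / (`|K| * d%:R + 1)); first by rewrite /= divr_gt0.
  move=> y; rewrite -ball_normE /= => xy; apply: eU; rewrite /ball /=; apply: le_lt_trans (p_lip x y i v) _.
  have en : enorm (x - y) <= d%:R * (e / (`|K| * d%:R + 1)).
    apply: enorm_le; first by rewrite divr_ge0 ?ltW.
    by move=> j; rewrite ltW// (le_lt_trans (coord_le_norm _ j)).
  apply: (@le_lt_trans _ _ (`|K| * (d%:R * (e / (`|K| * d%:R + 1))))).
    apply: (@le_trans _ _ (`|K| * enorm (x - y))).
      by rewrite ler_wpM2r ?sqrtr_ge0// ler_norm.
    by rewrite ler_wpM2l.
  have -> : `|K| * (d%:R * (e / (`|K| * d%:R + 1))) = e * (`|K| * d%:R) / (`|K| * d%:R + 1) by ring.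
  by rewrite ltr_pdivrMr// ltr_pM2l// ltrDl.
have [c cA' Hc] := compact_EVT_min A0 cA cf.
exists (p c i v) => // r [x cx ->]; apply: Hc.
by rewrite inE.
Qed.

Lemma transition_lower_bound (P : E -> E -> R) :
  exists2 c : R, 0 < c <= 1 & forall i j, 0 < P i j -> c <= P i j.
Proof.
have [|c c01 Hc] := @positive_lower_bound (E * E)%type
  (fun t r => 0 < r /\ r = P t.1 t.2); last first.
  by exists c => // i j Pij; apply: (Hc (i, j)).
move=> [i j] /=; have [Pij|Pij] := ltP 0 (P i j).
  by exists (P i j) => // r [_ ->].
by exists 1 => // r [+ rE]; rewrite rE ltNge Pij.
Qed.

End JumpLowerBound.

Lemma half_gain {R : realFieldType} (c z : R) : 0 <= c -> z <= 2^-1 ->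
  1 - c + c * z <= 1 - c / 2.
Proof. by nra. Qed.

Section AtomFast.
Context {R : realType} {d : nat} {E : finType}.
Local Notation V := (bool * 'I_d)%type.
Variables (p : 'rV[R]_d -> E -> V -> R) (P : E -> E -> R) (l : R) (i0 : E).
Hypothesis d_gt0 : (0 < d)%N.
Hypothesis p_law : jump_law p.
Hypothesis P_stochastic : stochastic P.
Hypothesis P2_irr : irreducible_mx (transition_mx P ^+ 2).
Hypothesis lyap : has_lyapunov p P.
Variables (cp cP : R).
Hypotheses (cp01 : 0 < cp <= 1) (cP01 : 0 < cP <= 1).
Hypothesis p_low : forall x i v, cube x -> cp <= p x i v.
Hypothesis P_low : forall i j, 0 < P i j -> cP <= P i j.
Local Notation state := ('rV[R]_d * E)%type.

(** The state at which the chain starts afresh. *)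
Definition atom (z : state) : bool := (z.1 == 0) && (z.2 == i0).

Definition target_or_atom m (z : state) : bool := target_state l m z || atom z.

(* Any prescribed move that is possible has at least this probability. *)
Let c := cp * cP.

Lemma c_gt0 : 0 < c.
Proof. by rewrite mulr_gt0//; [case/andP: cp01 | case/andP: cP01]. Qed.

Lemma c_le1 : c <= 1.
Proof.
have /andP[? ?] := cp01; have /andP[? ?] := cP01.
by rewrite /c mulr_ile1// ltW.
Qed.

Local Notation survm m := (surv (walk_kernel p P m) (walk_move m) (target_or_atom m)).

(** If a prescribed path of n moves leads from the successor of (X, i) to S, then
    one of n + 1 moves leads there from (X, i). *)
Lemma surv_extend (S : state -> bool) m n X i v j : (0 < m)%N -> lattice m X -> 0 < P i j ->
  surv (walk_kernel p P m) (walk_move m) S n (Defs.reflect m (X + dir v), j) <= 1 - c ^+ n ->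
  surv (walk_kernel p P m) (walk_move m) S n.+1 (X, i) <= 1 - c ^+ n.+1.
Proof.
move=> m0 LX Pij H; rewrite exprS.
have cpos := c_gt0; have cle := c_le1.
have := @surv_one_step R _ _ (walk_kernel p P m) (walk_move m)
  (walk_kernel_ge0 p_law P_stochastic m) (walk_kernel_sum1 p_law P_stochastic m)
  S n (X, i) (v, j) (c ^+ n) c.
apply; last exact: H.
- by rewrite exprn_ge0// ltW.
- exact: ltW.
- by rewrite exprn_ile1// ltW.
- have /andP[cp0 _] := cp01; have /andP[cP0 _] := cP01.
  rewrite /c /walk_kernel /= ler_pM ?(ltW cp0) ?(ltW cP0) ?P_low//.
  exact/p_low/lattice_cube.
Qed.

Lemma exists_transition i : exists j, 0 < P i j.
Proof.
have [P0 P1] := P_stochastic.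
apply/existsP; apply: contraT => /existsPn none.
have : \sum_j P i j <= 0 by apply: sumr_le0 => k _; rewrite leNgt.
by rewrite P1 leNgt ltr01.
Qed.

Lemma surv_weaken m n k z : (n <= k)%N ->
  survm m n z <= 1 - c ^+ n -> survm m k z <= 1 - c ^+ k.
Proof.
move=> nk H; have cpos := c_gt0; have cle := c_le1.
apply: le_trans (surv_anti _ (walk_kernel_ge0 p_law P_stochastic m)
  (walk_kernel_sum1 p_law P_stochastic m) _ _ nk) _.
by rewrite (le_trans H)// lerD2l lerN2 ler_wiXn2l// ltW.
Qed.

Lemma lattice0 m : lattice m (0 : 'rV[R]_d).
Proof. by split=> j; rewrite mxE ?rpred0// lexx ler0n. Qed.

(** An excursion of length two from the origin lets the environment make two
    steps; so the atom is reached along any path of P^2. *)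
Lemma surv_origin_path m k j : (0 < m)%N ->
  0 < ((transition_mx P ^+ 2) ^+ k) (enum_rank j) (enum_rank i0) ->
  survm m (k.*2) (0, j) <= 1 - c ^+ k.*2.
Proof.
move=> m0; have [P0 _] := P_stochastic.
have A0 a b : 0 <= transition_mx P a b by rewrite mxE.
have A20 a b : 0 <= (transition_mx P ^+ 2) a b by exact: expmx_ge0.
elim: k j => [|k IH] j.
  rewrite expr0 mxE; case: eqP => [/enum_rank_inj ->|_]; last by rewrite ltxx.
  by rewrite surv_in ?expr0 ?subrr// /target_or_atom /atom /= !eqxx orbT.
rewrite exprS mxE => pos.
have [a /andP[a1 a2]] : exists a, (0 < (transition_mx P ^+ 2) (enum_rank j) a) &&
    (0 < ((transition_mx P ^+ 2) ^+ k) a (enum_rank i0)).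
  apply/existsP; move: pos; apply: contraTT => /existsPn none.
  rewrite -leNgt le_eqVlt; apply/orP; left; apply/eqP; apply: big1 => a _.
  have := none a; rewrite negb_and -!leNgt => /orP[h|h].
    have -> : (transition_mx P ^+ 2) (enum_rank j) a = 0.
      by apply/eqP; rewrite eq_le h A20.
    by rewrite mul0r.
  have -> : ((transition_mx P ^+ 2) ^+ k) a (enum_rank i0) = 0.
    by apply/eqP; rewrite eq_le h; exact: expmx_ge0.
  by rewrite mulr0.
have [b /andP[b1 b2]] : exists b : 'I_#|E|, (0 < P j (enum_val b)) && (0 < P (enum_val b) (enum_val a)).
  apply/existsP; move: a1; rewrite expr2 mxE; apply: contraTT => /existsPn none.
  rewrite -leNgt le_eqVlt; apply/orP; left; apply/eqP; apply: big1 => b _.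
  rewrite !mxE enum_rankK; have := none b; rewrite negb_and -!leNgt => /orP[h|h].
    by rewrite (_ : P j _ = 0) ?mul0r//; apply/eqP; rewrite eq_le h P0.
  by rewrite (_ : P (enum_val b) _ = 0) ?mulr0//; apply/eqP; rewrite eq_le h P0.
pose o : 'I_d := Ordinal d_gt0.
have m1 : 1 <= m%:R :> R by rewrite ler1n.
have up : Defs.reflect m (0 + dir (true, o)) = dir (true, o) :> 'rV[R]_d.
  rewrite add0r reflect_id//; split=> i; rewrite dirE /sgv /= mul1r.
    exact: natr_int.
  by rewrite ler0n /=; case: (_ == _).
have down : Defs.reflect m (dir (true, o) + dir (false, o)) = 0 :> 'rV[R]_d.
  have -> : dir (true, o) + dir (false, o) = 0 :> 'rV[R]_d.
    by rewrite /dir /= -scalerDl subrr scale0r.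
  by rewrite reflect_id//; exact: lattice0.
have Lup : lattice m (dir (true, o) : 'rV[R]_d).
  by rewrite -up; apply: reflect_lattice => //; exact: lattice0.
rewrite doubleS.
have ext1 := @surv_extend (target_or_atom m) m k.*2.+1 0 j (true, o) (enum_val b) m0 (lattice0 m) b1.
apply: ext1; rewrite up.
have ext2 := @surv_extend (target_or_atom m) m k.*2 _ _ (false, o) (enum_val a) m0 Lup b2.
apply: ext2; rewrite down.
by apply: IH; rewrite enum_valK.
Qed.

Lemma surv_origin : exists K0, forall m j, (0 < m)%N -> survm m K0 (0, j) <= 1 - c ^+ K0.
Proof.
have H j : exists k, 0 < ((transition_mx P ^+ 2) ^+ k) (enum_rank j) (enum_rank i0).
  exact: P2_irr.
have [f Hf] := choice H.
exists (\max_j (f j).*2)%N => m j m0.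
apply: surv_weaken (surv_origin_path m0 (Hf j)).
exact: (leq_bigmax (F := fun j => (f j).*2)).
Qed.

Lemma lattice_l1norm m (X : 'rV[R]_d) : lattice m X -> exists n : nat, l1norm X = n%:R.
Proof.
move=> [Xint Xbox].
have : l1norm X \is a Num.int.
  by rewrite rpred_sum// => j _; rewrite ger0_norm//; case/andP: (Xbox j).
have : 0 <= l1norm X by rewrite sumr_ge0.
by move=> h /intrP [z zE]; move: h; rewrite zE ler0z; case: z {zE} => // n _; exists n.
Qed.

Lemma l1norm_step_down m (X : 'rV[R]_d) j : (0 < m)%N -> lattice m X -> X 0 j != 0 ->
  l1norm (Defs.reflect m (X + dir (false, j))) + 1 = l1norm X.
Proof.
move=> m0 LX Xj; have [off] := reflect_step_cases (false, j) m0 LX.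
have [Xint Xbox] := LX.
cbv zeta; rewrite /= /sgv /= => on.
have -> : l1norm X = `|X 0 j| + \sum_(k | k != j) `|X 0 k|.
  by rewrite /l1norm (bigD1 j).
rewrite /l1norm (bigD1 j) //=.
rewrite (eq_bigr (fun k => `|X 0 k|)); last by move=> k kj; rewrite off.
case: on => -[].
- move=> /andP[x1 _] ->; rewrite !ger0_norm//; last by case/andP: (Xbox j).
  by ring.
- by move=> x0; rewrite x0 eqxx in Xj.
- by move=> _ /eqP; rewrite lt_eqF// (lt_trans _ (@ltr01 R))// oppr_lt0 ltr01.
Qed.

(** Walk down to the origin, one unit of the l^1 norm at a time. *)
Lemma surv_near_origin K0 :
  (forall m j, (0 < m)%N -> survm m K0 (0, j) <= 1 - c ^+ K0) ->
  forall m n X i, (0 < m)%N -> lattice m X -> l1norm X = n%:R ->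
  survm m (n + K0) (X, i) <= 1 - c ^+ (n + K0).
Proof.
move=> H0 m; elim=> [|n IH] X i m0 LX Xn.
  suff -> : X = 0 by exact: H0.
  move: Xn => /eqP; rewrite /l1norm psumr_eq0// => /allP all0.
  apply/matrixP => a j; rewrite (ord1 a) mxE; apply/eqP; rewrite -normr_eq0.
  by apply: all0; rewrite mem_index_enum.
have [j Xj] : exists j, X 0 j != 0.
  apply/existsP; apply: contraT => /existsPn none.
  move: Xn; rewrite /l1norm big1 => [/esym/eqP|j _]; first by rewrite pnatr_eq0.
  by have := none j; rewrite negbK => /eqP ->; rewrite normr0.
have [i' Pi] := exists_transition i.
have ext := @surv_extend (target_or_atom m) m (n + K0) X i (false, j) i' m0 LX Pi.
rewrite addSn; apply: ext.
apply: IH => //; first exact: reflect_lattice.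
by have := l1norm_step_down m0 LX Xj; rewrite Xn -(natr1 n) => /addIr.
Qed.

Lemma l1norm_step_up m (X : 'rV[R]_d) j : (0 < m)%N -> lattice m X -> X 0 j != m%:R ->
  l1norm (Defs.reflect m (X + dir (true, j))) = l1norm X + 1.
Proof.
move=> m0 LX Xj; have [off] := reflect_step_cases (true, j) m0 LX.
have [Xint Xbox] := LX.
cbv zeta; rewrite /= /sgv /= => on.
have -> : l1norm X = `|X 0 j| + \sum_(k | k != j) `|X 0 k|.
  by rewrite /l1norm (bigD1 j).
rewrite /l1norm (bigD1 j) //=.
rewrite (eq_bigr (fun k => `|X 0 k|)); last by move=> k kj; rewrite off.
case: on => -[].
- move=> /andP[x1 _] ->; rewrite !ger0_norm//; last by case/andP: (Xbox j).
  by ring.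
- by move=> _ /eqP; rewrite gt_eqF// (lt_trans _ (@ltr01 R))// oppr_lt0 ltr01.
- by move=> xm; rewrite xm eqxx in Xj.
Qed.

Lemma on_target_lattice m (X : 'rV[R]_d) (n : nat) : (0 < m)%N -> lattice m X ->
  Num.floor (m%:R * l) = n -> l1norm X = n%:R -> on_target m l X.
Proof.
move=> m0 LX fl Xn; have mn0 : m%:R != 0 :> R by rewrite pnatr_eq0 -lt0n.
apply/asboolP; split.
- by have [Xint _] := LX; move=> j; rewrite scalerA mulfV// scale1r.
- exact: lattice_cube.
- by rewrite l1normZ Xn fl mulrC.
Qed.

(** From every lattice point the target level can be reached by monotone steps;
    so the exit time is almost surely finite. *)
Lemma exit_path m (n L : nat) X i : (0 < m)%N -> Num.floor (m%:R * l) = L ->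
  (L <= d * m)%N -> lattice m X -> l1norm X = L%:R + n%:R \/ l1norm X + n%:R = L%:R ->
  surv (walk_kernel p P m) (walk_move m) (target_state l m) n (X, i) <= 1 - c ^+ n.
Proof.
move=> m0 fl Ldm; elim: n X i => [|n IH] X i LX.
  rewrite !addr0 => H; have Xn : l1norm X = L%:R by case: H.
  by rewrite surv_in ?expr0 ?subrr//; exact: on_target_lattice LX fl Xn.
have [i' Pi] := exists_transition i; case=> Xn.
  have [j Xj] : exists j, X 0 j != 0.
    apply/existsP; apply: contraT => /existsPn none.
    move: Xn; rewrite /l1norm big1 => [/esym/eqP|j _]; first by rewrite -natrD pnatr_eq0 addnS.
    by have := none j; rewrite negbK => /eqP ->; rewrite normr0.
  have ext := @surv_extend (target_state l m) m n X i (false, j) i' m0 LX Pi.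
  apply: ext; apply: IH; first exact: reflect_lattice.
  left; have := l1norm_step_down m0 LX Xj; rewrite Xn -(natr1 n); lra.
have [j Xj] : exists j, X 0 j != m%:R.
  apply/existsP; apply: contraT => /existsPn none.
  have : l1norm X = (d * m)%:R.
    rewrite /l1norm (eq_bigr (fun=> m%:R)) => [|k _]; first by rewrite sumr_const card_ord -[LHS]mulr_natl natrM.
    by have := none k; rewrite negbK => /eqP ->; rewrite normr_nat.
  by move=> E'; move: Ldm; rewrite -(ler_nat R) -Xn E' gerDl lern0.
have ext := @surv_extend (target_state l m) m n X i (true, j) i' m0 LX Pi.
apply: ext; apply: IH; first exact: reflect_lattice.
right; rewrite l1norm_step_up// -addrA [X in _ + X]addrC natr1; exact: Xn.
Qed.

Lemma exit_time_finite m : (0 < m)%N -> 0 < l < d%:R -> forall e : R, 0 < e ->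
  exists n, surv (walk_kernel p P m) (walk_move m) (target_state l m) n (0, i0) <= e.
Proof.
move=> m0 /andP[l0 ld] e e0.
have cpos := c_gt0; have cle := c_le1.
have ml0 : 0 <= m%:R * l by rewrite mulr_ge0// ltW.
have [L fl] : exists L : nat, Num.floor (m%:R * l) = L.
  have : 0 <= Num.floor (m%:R * l) by rewrite floor_ge0.
  by case: (Num.floor _) => // n _; exists n.
have Ldm : (L <= d * m)%N.
  rewrite -(ler_nat R) natrM mulrC (le_trans (_ : L%:R <= m%:R * l))//.
    by rewrite -[L%:R]/((L : int)%:~R) -fl floor_le_tmp.
  by rewrite ler_wpM2l// ltW.
pose M := (d * m)%N.
have block (z : state) : lattice m z.1 ->
    surv (walk_kernel p P m) (walk_move m) (target_state l m) M z <= 1 - c ^+ M.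
  case: z => X i /= LX; have [n0 Xn] := lattice_l1norm LX.
  have n0M : (n0 <= M)%N.
    rewrite -(ler_nat R) -Xn /M natrM.
    have -> : d%:R * m%:R = \sum_(k < d) m%:R :> R by rewrite sumr_const card_ord mulr_natl.
    by have [_ Ybox] := LX; apply: ler_sum => k _; have /andP[Y0 YM] := Ybox k; rewrite ger0_norm.
  have [n nM Hn] : exists2 n, (n <= M)%N & l1norm X = L%:R + n%:R \/ l1norm X + n%:R = L%:R.
    have [Ln|nL] := leqP L n0.
      exists (n0 - L)%N; first exact: leq_trans (leq_subr _ _) n0M.
      by left; rewrite Xn -natrD subnKC.
    exists (L - n0)%N; first exact: leq_trans (leq_subr _ _) Ldm.
    by right; rewrite Xn -natrD subnKC// ltnW.
  have H := exit_path i m0 fl Ldm LX Hn.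
  apply: le_trans (surv_anti _ (walk_kernel_ge0 p_law P_stochastic m)
    (walk_kernel_sum1 p_law P_stochastic m) _ _ nM) _.
  by rewrite (le_trans H)// lerD2l lerN2 ler_wiXn2l// ltW.
have cM0 : 0 < c ^+ M by rewrite exprn_gt0.
have cM1 : c ^+ M <= 1 by rewrite exprn_ile1// ltW.
have [J HJ] := linear_large e^-1 cM0.
exists (J * M)%N.
have := @surv_iter R _ _ (walk_kernel p P m) (walk_move m)
    (walk_kernel_ge0 p_law P_stochastic m) (walk_kernel_sum1 p_law P_stochastic m)
    (fun z => lattice m z.1) (fun z b' => @walk_move_lattice R d E m z b' m0)
    (target_state l m) M _ block J (0, i0) (lattice0 m).
move=> /le_trans; apply.
apply: (@le_trans _ _ (expR (- (c ^+ M)) ^+ J)).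
  rewrite lerXn2r ?nnegrE ?expR_ge0 ?subr_ge0//; exact: expR_ge1Dx.
rewrite -expRM_natl mulrN; apply: expRN_le => //.
by rewrite mulrC; exact: HJ.
Qed.

(** Trials of N1 + N2 = O(m) steps: the first N2 steps bring the walk to the ball
    of radius delta m with probability at least 1/2, and from there a prescribed
    path of N1 steps, close to delta m, leads to the atom.  For delta small a trial
    succeeds with probability at least exp (- b m / 2) up to a constant, and
    exp (b m) steps contain enough trials. *)
Theorem atom_fast (b : R) : 0 < b -> forall e : R, 0 < e ->
  exists m1, forall m, (m1 <= m)%N -> forall n X i, lattice m X ->
  expR (b * m%:R) <= n%:R -> survm m n (X, i) <= e.
Proof.
move=> b0 e e0; have cpos := c_gt0; have cle := c_le1.
pose lam := - ln c.
have lam0 : 0 <= lam by rewrite oppr_ge0 ln_le0.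
have cE N : c ^+ N = expR (- (lam * N%:R)).
  by rewrite -mulNr opprK mulrC expRM_natl lnK// posrE.
pose delta := b / (2 * (lam + 1)).
have lam1 : 0 < 2 * (lam + 1) by lra.
have delta0 : 0 < delta by rewrite divr_gt0.
have lamd : lam * delta <= b / 2.
  have : delta * (2 * (lam + 1)) = b by rewrite mulfVK// gt_eqF.
  by nra.
have [theta [rho [C [m0 [[th0 rho0 C0 m00] HW]]]]] := lyap delta0.
have [K0 HK0] := surv_origin.
pose a1 := delta + theta * (d%:R + delta) / rho.
pose a2 := 2 + K0%:R + (2 * (theta * C) + 2) / rho.
pose A := a2 + 4 * a1 / b.
have d0 : 0 <= d%:R :> R by [].
have K00 : 0 <= K0%:R :> R by [].
have a10 : 0 <= a1 by rewrite addr_ge0 ?(ltW delta0)// divr_ge0 ?mulr_ge0 ?addr_ge0// ltW.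
have a20 : 0 < a2.
  have q0 : 0 <= (2 * (theta * C) + 2) / rho.
    by rewrite divr_ge0 ?(ltW rho0)// addr_ge0// !mulr_ge0// ltW.
  by rewrite /a2; lra.
have A0 : 0 < A by rewrite ltr_wpDr// divr_ge0 ?mulr_ge0// ltW.
pose c' := lam * (1 + K0%:R).
have b40 : 0 < b / 4 by rewrite divr_gt0.
have [m1 Hm1] := @linear_large R (b / 4) (A * (2 * e^-1 + 1) + c') b40.
exists (maxn m0 m1) => m; rewrite geq_max => /andP[mm0 mm1] n X i LX nb.
have mpos : (0 < m)%N by exact: leq_trans mm0.
have [W HWm] := HW m mm0; have mlarge := Hm1 m mm1.
have mr0 : 0 <= m%:R :> R by [].
set M : R := m%:R in nb HWm mlarge mr0 *.
have dM0 : 0 <= delta * M by rewrite mulr_ge0// ltW.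
have [N1 N1le N1ge] : exists2 N1 : nat, N1%:R <= delta * M + 1 + K0%:R &
    ((Num.truncn (delta * M)).+1 + K0 <= N1)%N.
  exists ((Num.truncn (delta * M)).+1 + K0)%N => //.
  by rewrite natrD lerD2r -natr1 lerD2r truncn_le.
pose y := (theta * ((d%:R + delta) * M + 2 * C) + 2) / rho.
have y0 : 0 <= y.
  rewrite divr_ge0 ?(ltW rho0)// addr_ge0// mulr_ge0 ?(ltW th0)// addr_ge0 ?mulr_ge0//.
  by rewrite addr_ge0// ltW.
have [N2 N2ge N2le] : exists2 N2 : nat, y <= N2%:R & N2%:R <= y + 1.
  exists (Num.truncn y).+1; first exact: ltW (truncnS_gt y).
  by rewrite -natr1 lerD2r truncn_le.
have small_ok (z : state) : lattice m z.1 -> l1norm z.1 < delta * M ->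
    survm m N1 z <= 1 - c ^+ N1.
  case: z => Y j /= LY Ysmall; have [n0 Yn] := lattice_l1norm LY.
  apply: (@surv_weaken m (n0 + K0) N1); last exact: surv_near_origin HK0 _ _ _ _ mpos LY Yn.
  apply: leq_trans N1ge.
  by rewrite leq_add2r leqW// truncn_ge_nat// -Yn ltW.
pose w := expR (theta * (- (delta * M) - C)).
have Ww (z : state) : lattice m z.1 -> w <= W z.
  case: z => Y j /= LY; have [/andP[h _] _ _] := HWm Y j LY; apply: le_trans h.
  rewrite ler_expR ler_pM2l// lerB//.
  have : 0 <= l1norm Y by rewrite sumr_ge0.
  by lra.
have cc01 : 0 <= c ^+ N1 <= 1 by rewrite exprn_ge0 ?exprn_ile1// ltW.
have block z : lattice m z.1 -> survm m (N2 + N1) z <= 1 - c ^+ N1 / 2.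
  move=> Lz.
  have := @surv_le_return R _ _ (walk_kernel p P m) (walk_move m)
    (walk_kernel_ge0 p_law P_stochastic m) (walk_kernel_sum1 p_law P_stochastic m)
    (fun z => lattice m z.1) (fun z b => @walk_move_lattice R d E m z b mpos) (target_or_atom m)
    (fun z => l1norm z.1 < delta * M) W N1 (c ^+ N1) w (expR (- rho)) cc01 (expR_gt0 _)
    Ww (expR_ge0 _) small_ok.
  move=> /(_ _ N2 z Lz) H; apply: le_trans (H _) _.
    case=> Y j /= LY /negP; rewrite -leNgt => Ybig.
    by have [_ h _] := HWm Y j LY; exact: h.
  suff : W z * expR (- rho) ^+ N2 / w <= 2^-1.
    have /andP[cc0 _] := cc01.
    exact: half_gain.
  case: z Lz {H} => Y j LY; have [/andP[_ h] _ _] := HWm Y j LY.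
  have Yd : l1norm Y <= d%:R * M.
    have -> : d%:R * M = \sum_(k < d) M by rewrite sumr_const card_ord mulr_natl.
    have [_ Ybox] := LY; apply: ler_sum => k _.
    by have /andP[Y0 YM] := Ybox k; rewrite ger0_norm.
  apply: (@le_trans _ _ (expR (theta * (d%:R * M + C)) * expR (- rho) ^+ N2 / w)).
    rewrite ler_wpM2r ?invr_ge0 ?expR_ge0// ler_wpM2r ?exprn_ge0 ?expR_ge0//.
    by rewrite (le_trans h)// ler_expR ler_pM2l// lerD2r.
  rewrite -expRM_natl /w -expRN -!expRD.
  have -> : theta * (d%:R * M + C) + N2%:R * - rho + - (theta * (- (delta * M) - C)) =
    - (N2%:R * rho - theta * ((d%:R + delta) * M + 2 * C)) by ring.
  apply: expRN_le => //; rewrite invrK.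
  by rewrite lerBrDl -ler_pdivrMr.
pose N := (N2 + N1)%N; pose J := (n %/ N)%N.
have N0 : (0 < N)%N.
  by rewrite /N addn_gt0 orbC (leq_trans _ N1ge)// addSn.
have /andP[cc0 cc1] := cc01.
have surv_J : survm m n (X, i) <= (1 - c ^+ N1 / 2) ^+ J.
  apply: le_trans (surv_anti _ (walk_kernel_ge0 p_law P_stochastic m)
    (walk_kernel_sum1 p_law P_stochastic m) _ _ (leq_divM n N)) _.
  exact: (@surv_iter R _ _ (walk_kernel p P m) (walk_move m)
    (walk_kernel_ge0 p_law P_stochastic m) (walk_kernel_sum1 p_law P_stochastic m)
    (fun z => lattice m z.1) (fun z b' => @walk_move_lattice R d E m z b' mpos)
    (target_or_atom m) (N2 + N1) _ block J (X, i) LX).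
rewrite (le_trans surv_J)//.
apply: (@le_trans _ _ (expR (- (c ^+ N1 / 2)) ^+ J)).
  rewrite lerXn2r ?nnegrE ?expR_ge0//; first by lra.
  exact: expR_ge1Dx.
rewrite -expRM_natl mulrN; apply: expRN_le => //.
have Nle : N%:R <= A * expR (b / 4 * M).
  apply: (@le_trans _ _ (A * (1 + b / 4 * M))); last first.
    by rewrite ler_pM2l// expR_ge1Dx.
  have -> : A * (1 + b / 4 * M) = a1 * M + a2 + (a2 * (b / 4) * M + 4 * a1 / b).
    by rewrite /A; field; rewrite gt_eqF.
  apply: (@le_trans _ _ (a1 * M + a2)).
    rewrite /N natrD.
    have -> : a1 * M + a2 = (y + 1) + (delta * M + 1 + K0%:R).
      by rewrite /a1 /a2 /y; field; rewrite gt_eqF.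
    exact: lerD.
  rewrite lerDl addr_ge0 ?divr_ge0 ?mulr_ge0// ltW//.
have Jn : n%:R <= J.+1%:R * N%:R :> R by rewrite -natrM ler_nat ltnW// ltn_ceil.
have JA : expR (3 / 4 * b * M) <= J.+1%:R * A.
  rewrite -(ler_pM2r (expR_gt0 (b / 4 * M))) -expRD.
  have -> : 3 / 4 * b * M + b / 4 * M = b * M by field.
  apply: le_trans nb _; apply: le_trans Jn _.
  by rewrite -[leRHS]mulrA; apply: ler_wpM2l.
have ccge : expR (- (b / 2 * M) - c') <= c ^+ N1.
  rewrite cE ler_expR.
  have : lam * N1%:R <= lam * (delta * M + 1 + K0%:R) by rewrite ler_wpM2l.
  have : lam * delta * M <= b / 2 * M by rewrite ler_wpM2r.
  by rewrite /c'; lra.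
have key : 1 + (b / 4 * M - c') <= J.+1%:R * A * c ^+ N1.
  apply: le_trans (expR_ge1Dx _) _.
  have -> : b / 4 * M - c' = 3 / 4 * b * M + (- (b / 2 * M) - c') by field.
  by rewrite expRD; apply: ler_pM JA ccge; exact: expR_ge0.
have : A * (2 * e^-1 + 1) <= A * (J.+1%:R * c ^+ N1).
  have -> : A * (J.+1%:R * c ^+ N1) = J.+1%:R * A * c ^+ N1 by ring.
  by apply: le_trans key; rewrite addrC -lerBlDr; move: mlarge; lra.
rewrite ler_pM2l// -(natr1 J) mulrDl mul1r; lra.
Qed.

End AtomFast.

(** * The exponential law of the deadlock time *)

Section SurvivalAsymptotics.
Context {R : realType} {d : nat} {E : finType}.
Local Notation V := (bool * 'I_d)%type.
Variables (p : 'rV[R]_d -> E -> V -> R) (P : E -> E -> R) (l : R) (i : E).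
Hypothesis d_gt0 : (0 < d)%N.
Hypothesis p_law : jump_law p.
Hypothesis P_stochastic : stochastic P.
Hypothesis P2_irr : irreducible_mx (transition_mx P ^+ 2).
Hypothesis lyap : has_lyapunov p P.
Hypothesis A1 : jump_lipschitz p.
Hypothesis A2 : forall x i v, 0 < p x i v.
Hypothesis l_bounds : 0 < l < d%:R.

Definition survival m n (X : 'rV[R]_d) : R :=
  surv (walk_kernel p P m) (walk_move m) (target_state l m) n (X, i).

Let f m n := survival m n 0.

(** The quantile of the exit time, in steps; the exit time being almost surely
    finite, the default value 0 only matters for m = 0. *)
Definition quantile_step m : nat :=
  if pselect (exists n, f m n <= expR (-1)) is left h then ex_minn h else 0.

Lemma expRN1_half : expR (-1) <= 2^-1 :> R.
Proof.
rewrite expRN lef_pV2 ?posrE ?expR_gt0//; have := expR_ge1Dx (1 : R); lra.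
Qed.

Lemma survival_itv m n X : 0 <= survival m n X <= 1.
Proof. by apply: surv_itv; [exact: walk_kernel_ge0 | exact: walk_kernel_sum1]. Qed.

Lemma survival_anti m X n k : (n <= k)%N -> survival m k X <= survival m n X.
Proof. by apply: surv_anti; [exact: walk_kernel_ge0 | exact: walk_kernel_sum1]. Qed.

Lemma quantile_stepP m n : (0 < m)%N -> (f m n <= expR (-1)) = (quantile_step m <= n)%N.
Proof.
move=> m0; rewrite /quantile_step; case: pselect => [h|none]; last first.
  exfalso; apply: none.
  have [cp cp01 p_low] := jump_lower_bound A1 A2.
  have [cP cP01 P_low] := transition_lower_bound P.
  exact: (exit_time_finite i p_law P_stochastic cp01 cP01 p_low P_low m0 l_bounds (expR_gt0 _)).
case: ex_minnP => N fN Nmin; apply/idP/idP; first exact: Nmin.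
by move=> Nn; apply: le_trans fN; exact: survival_anti.
Qed.

Variables (x_ : nat -> 'rV[R]_d) (eta : R).
Hypotheses (eta_gt0 : 0 < eta) (eta_le : eta <= l).
Hypothesis x_lattice : forall m, (0 < m)%N -> lattice m (m%:R *: x_ m).
Hypothesis x_inside : \forall m \near \oo, l1norm (x_ m) <= l - eta.

Let g m n := survival m n (m%:R *: x_ m).

(** Used with u = exp (c m / 2): the relaxation time is about u, and the exit takes
    at least about u ^ 2 steps. *)
Lemma two_scales (u : R) (K : nat) : K%:R + 3 <= u ->
  ((Num.truncn u).+1 + (Num.truncn u).+1 + K <= Num.truncn (u ^+ 2)%R)%N.
Proof.
move=> Ku; have K0 : 0 <= K%:R :> R by [].
have u0 : 0 <= u by lra.
rewrite truncn_ge_nat ?sqr_ge0// !natrD -natr1.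
have : (Num.truncn u)%:R <= u by rewrite truncn_le.
nra.
Qed.

Lemma relaxation : exists r S : nat -> nat,
  (forall K, \forall m \near \oo, (r m + r m + K <= S m)%N) /\
  forall e, 0 < e -> \forall m \near \oo,
    [/\ (0 < m)%N,
       forall X j, lattice m X -> surv (walk_kernel p P m) (walk_move m) (target_or_atom l i m) (r m) (X, j) <= e,
       1 - e <= f m (S m) & 1 - e <= g m (S m)].
Proof.
have [cp cp01 p_low] := jump_lower_bound A1 A2.
have [cP cP01 P_low] := transition_lower_bound P.
have [c c0 slow] := slow_exit p_law P_stochastic lyap eta_gt0 eta_le.
have c20 : 0 < c / 2 by rewrite divr_gt0.
have fast := atom_fast l i d_gt0 p_law P_stochastic P2_irr lyap cp01 cP01 p_low P_low c20.
pose u m : R := expR (c / 2 * m%:R).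
exists (fun m => (Num.truncn (u m)).+1), (fun m => Num.truncn (u m ^+ 2)); split.
  move=> K; have [m1 Hm1] := linear_large (K%:R + 3) c20.
  exists m1 => // m /= mm1; apply: two_scales.
  by rewrite (le_trans (Hm1 m mm1))// (le_trans _ (expR_ge1Dx _))// lerDr.
have u2 m : u m ^+ 2 = expR (c * m%:R).
  by rewrite /u -expRM_natl; congr expR; field.
move=> e e0; have [m1 Hslow] := slow e e0; have [m2 Hfast] := fast e e0.
near=> m.
have m0 : (0 < m)%N by near: m; exists 1%N.
have mm1 : (m1 <= m)%N by near: m; exists m1.
have mm2 : (m2 <= m)%N by near: m; exists m2.
have Sle : (Num.truncn (u m ^+ 2))%:R <= expR (c * m%:R).
  by rewrite -u2 truncn_le sqr_ge0.
split => //.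
- move=> X j LX; apply: (Hfast m mm2 _ X j LX); exact: ltW (truncnS_gt _).
- apply: (Hslow m mm1) => //; first exact: lattice0.
  rewrite /l1norm big1 => [|j _]; last by rewrite mxE normr0.
  by rewrite mulr_ge0// subr_ge0.
- apply: (Hslow m mm1) => //; first exact: x_lattice.
  have -> : l1norm (m%:R *: x_ m) = l1norm (x_ m) * m%:R.
    rewrite /l1norm mulr_suml; apply: eq_bigr => j _.
    by rewrite mxE normrM normr_nat mulrC.
  by rewrite ler_wpM2r//; near: m.
Unshelve. all: by end_near. Qed.

Let atom_surv m : forall z n, atom i z ->
  surv (walk_kernel p P m) (walk_move m) (target_state l m) n z = f m n.
Proof. by move=> [X j] n /andP[/eqP /= -> /eqP ->]. Qed.

Lemma quantile_pos : \forall m \near \oo, (0 < quantile_step m)%N.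
Proof.
have [r [S [rS H]]] := relaxation.
have e0 : 0 < 4^-1 :> R by rewrite invr_gt0.
near=> m.
have [m0 _ fS _] : [/\ (0 < m)%N,
       forall X j, lattice m X -> surv (walk_kernel p P m) (walk_move m) (target_or_atom l i m) (r m) (X, j) <= 4^-1,
       1 - 4^-1 <= f m (S m) & 1 - 4^-1 <= g m (S m)] by near: m; exact: H.
rewrite ltnNge -quantile_stepP// -ltNge.
have := survival_anti m 0 (leq0n (S m)); rewrite -/(f m 0) -/(f m (S m)).
have := expRN1_half; lra.
Unshelve. all: by end_near. Qed.

(** Starting from x_m, the atom is met within r steps and before the exit, up to a
    small probability; hence g - f tends to 0 uniformly, and f is treated by
    [exponential_limit]. *)
Theorem survival_exponential (s : R) : 0 <= s ->
  g m (Num.truncn (s * (quantile_step m)%:R)) @[m --> \oo] --> expR (- s).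
Proof.
move=> s0; have [r [S [rS H]]] := relaxation.
have f_itv m n : 0 <= f m n <= 1 by exact: survival_itv.
have f_anti m n k : (n <= k)%N -> f m k <= f m n by exact: survival_anti.
have main e : 0 < e -> \forall m \near \oo,
  [/\ 0 <= e, forall n k, f m (n + (r m + k)) <= (f m k + e) * f m n,
      forall n k, f m k * (f m (n + r m) - e * f m n) <= f m (n + k) &
      1 - e <= f m (S m)].
  move=> e0; near=> m.
  have [m0 fast fS gS] : [/\ (0 < m)%N,
       forall X j, lattice m X -> surv (walk_kernel p P m) (walk_move m) (target_or_atom l i m) (r m) (X, j) <= e,
       1 - e <= f m (S m) & 1 - e <= g m (S m)] by near: m; exact: H.
  have fast' z : lattice m z.1 -> surv (walk_kernel p P m) (walk_move m)
      (fun z => target_state l m z || atom i z) (r m) z <= e by case: z => X j; exact: fast.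
  have st z b : lattice m z.1 -> lattice m (walk_move m z b).1 :=
    @walk_move_lattice R d E m z b m0.
  split => //; first exact: ltW.
  - move=> n k.
    exact: (surv_submul (walk_kernel_ge0 p_law P_stochastic m)
      (walk_kernel_sum1 p_law P_stochastic m) st (@atom_surv m) fast' n k (z := (0, i)) (lattice0 m)).
  - move=> n k.
    exact: (surv_supmul (walk_kernel_ge0 p_law P_stochastic m)
      (walk_kernel_sum1 p_law P_stochastic m) st (@atom_surv m) fast' n k (z := (0, i)) (lattice0 m)).
have f_slow (e : R) (k : nat -> nat) : 0 < e -> (\forall m \near \oo, (k m + r m <= S m)%N) ->
    \forall m \near \oo, forall n, f m n - 2 * e <= f m (n + k m).
  move=> e0 kS; near=> m => n.
  have [e0' sub sup long] : [/\ 0 <= e, forall n k, f m (n + (r m + k)) <= (f m k + e) * f m n,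
      forall n k, f m k * (f m (n + r m) - e * f m n) <= f m (n + k) &
      1 - e <= f m (S m)] by near: m; exact: main.
  apply: (slowly_varying e0' (f_itv m) (f_anti m) sup long).
  by near: m.
have f_mul (e : R) : 0 < e -> \forall m \near \oo,
    forall n k, `|f m (n + k) - f m n * f m k| <= e.
  move=> e0; have e30 : 0 < e / 3 by rewrite divr_gt0.
  near=> m => n k.
  have [e0' sub sup long] : [/\ 0 <= e / 3, forall n k, f m (n + (r m + k)) <= (f m k + e / 3) * f m n,
      forall n k, f m k * (f m (n + r m) - e / 3 * f m n) <= f m (n + k) &
      1 - e / 3 <= f m (S m)] by near: m; exact: main.
  have -> : e = 3 * (e / 3) by field.
  apply: (almost_multiplicative e0' (f_itv m) (f_anti m) sub sup long).
  near: m; apply: filterS (rS 0%N) => m; by rewrite addn0.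
have const_small (k : nat) : \forall m \near \oo, (k + r m <= S m)%N.
  apply: filterS (rS k) => m; apply: leq_trans.
  by rewrite addnC leq_add2r leq_addr.
have f_slow_cst (e : R) (k : nat) : 0 < e ->
    \forall m \near \oo, forall n, f m n - e <= f m (n + k).
  move=> e0; have e20 : 0 < e / 2 by rewrite divr_gt0.
  have := f_slow (e / 2) (fun=> k) e20 (const_small k).
  apply: filterS => m + n => /(_ n); lra.
have f_N : f m (quantile_step m) @[m --> \oo] --> expR (-1 : R).
  apply/cvgrPdist_le => e e0; near=> m.
  have m0 : (0 < m)%N by near: m; exists 1%N.
  have N0 : (0 < quantile_step m)%N by near: m; exact: quantile_pos.
  have up : f m (quantile_step m) <= expR (-1) by rewrite quantile_stepP.
  have low : expR (-1) < f m (quantile_step m).-1.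
    by rewrite ltNge quantile_stepP// -ltnNge prednK.
  have slow : forall n, f m n - e <= f m (n + 1) by near: m; exact: f_slow_cst.
  have := slow (quantile_step m).-1; rewrite addn1 prednK// => sl.
  rewrite ler_distl; apply/andP; split; lra.
have f_lim := exponential_limit f_itv f_anti f_mul f_slow_cst f_N s0.
apply/cvgrPdist_le => e e0; have e80 : 0 < e / 8 by rewrite divr_gt0.
near=> m.
have lim : `|expR (- s) - f m (Num.truncn (s * (quantile_step m)%:R))| <= e / 2.
  by near: m; move/cvgrPdist_le : f_lim; apply; rewrite divr_gt0.
move: (Num.truncn _) lim => k lim.
have [m0 fast fS gS] : [/\ (0 < m)%N,
     forall X j, lattice m X -> surv (walk_kernel p P m) (walk_move m) (target_or_atom l i m) (r m) (X, j) <= e / 8,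
     1 - e / 8 <= f m (S m) & 1 - e / 8 <= g m (S m)] by near: m; exact: H.
have rrS : (r m + r m <= S m)%N.
  near: m; apply: filterS (rS 0%N) => m; by rewrite addn0.
have slow : forall n, f m n - 2 * (e / 8) <= f m (n + r m).
  by near: m; apply: f_slow => //; apply: filterS (rS 0%N) => m; rewrite addn0.
have /andP[fk0 fk1] := f_itv m k.
have /andP[gk0 gk1] := survival_itv m k (m%:R *: x_ m); rewrite -/(g m k) in gk0 gk1.
suff : `|f m k - g m k| <= e / 2.
  by move: lim; rewrite !ler_distl => /andP[? ?] /andP[? ?]; apply/andP; split; lra.
have fastx := fast (m%:R *: x_ m) i (x_lattice m0).
have [kr|rk] := ltnP k (r m).
  have kS : (k <= S m)%N by rewrite (leq_trans (ltnW kr))// (leq_trans _ rrS)// leq_addr.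
  have := f_anti m _ _ kS; have := survival_anti m (m%:R *: x_ m) kS.
  rewrite -/(g m k) -/(g m (S m)) => h1 h2.
  by rewrite ler_distl; apply/andP; split; lra.
have upper : g m k <= f m k + 3 * (e / 8).
  have := surv_le_atom (walk_kernel_ge0 p_law P_stochastic m)
    (walk_kernel_sum1 p_law P_stochastic m) (@atom_surv m) (r m) (k - r m) (m%:R *: x_ m, i).
  rewrite subnKC// -/(g m k) => h1.
  have := slow (k - r m)%N; rewrite subnK// => h2.
  have h3 : f m (k - r m) <= f m k + 2 * (e / 8) by lra.
  apply: (le_trans h1); apply: le_trans (lerD h3 fastx) _; lra.
have lower : f m k - 2 * (e / 8) <= g m k.
  have := surv_ge_atom (walk_kernel_ge0 p_law P_stochastic m)
    (walk_kernel_sum1 p_law P_stochastic m) (@atom_surv m) (r m) k (m%:R *: x_ m, i).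
  rewrite -/(g m k) -/(f m k) => h1.
  have h4 : 1 - e / 8 <= surv (walk_kernel p P m) (walk_move m) (target_state l m) (r m) (m%:R *: x_ m, i).
    apply: le_trans gS _; apply: survival_anti.
    by rewrite (leq_trans _ rrS)// leq_addr.
  apply: le_trans h1; apply: le_trans (_ : (1 - e / 8 - e / 8) * f m k <= _); first by nra.
  by rewrite ler_wpM2r//; apply: lerB.
by rewrite ler_distl; apply/andP; split; lra.
Unshelve. all: by end_near. Qed.

End SurvivalAsymptotics.

Lemma l1norm_le_near {R : realType} {d : nat} (x_ : nat -> 'rV[R]_d) (x : 'rV[R]_d) (e : R) :
  (0 < d)%N -> 0 < e -> x_ @ \oo --> x ->
  \forall m \near \oo, l1norm (x_ m) <= l1norm x + e.
Proof.
move=> d0 e0 xcv; have dpos : 0 < d%:R :> R by rewrite ltr0n.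
have ed : 0 < e / d%:R by rewrite divr_gt0.
have : \forall m \near \oo, ball x (e / d%:R) (x_ m).
  by apply: xcv; exact: nbhsx_ballx.
apply: filterS => m; rewrite -ball_normE /= => xm.
have -> : e = \sum_(j < d) e / d%:R.
  by rewrite sumr_const card_ord -[RHS]mulr_natl mulrCA mulfV ?mulr1// gt_eqF.
rewrite /l1norm -big_split /=; apply: ler_sum => j _.
have -> : x_ m 0 j = x 0 j - (x - x_ m) 0 j by rewrite !mxE; ring.
rewrite (le_trans (ler_normB _ _))// lerD2l (le_trans (coord_le_norm _ j))//.
exact: ltW.
Qed.

Lemma lattice_scaled {R : realType} {d : nat} m (x : 'rV[R]_d) : (0 < m)%N ->
  cube x -> integral_vector (m%:R *: x) -> lattice m (m%:R *: x).
Proof.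
move=> m0 cx ix; split=> // j; rewrite mxE; have /andP[x0 x1] := cx j.
by rewrite mulr_ge0//= ler_piMr.
Qed.

(** The corrector solves the Poisson equation for the drift at 0, whose average
    is nonpositive. *)
Lemma has_lyapunov_of_contraction {R : realType} {d : nat} {E : finType}
  (P : E -> E -> R) (mu : E -> R) (p : 'rV[R]_d -> E -> bool * 'I_d -> R) (kappa : R) :
  stochastic P -> jump_law p -> jump_lipschitz p -> irreducible_mx (transition_mx P) ->
  invariant_probability P mu -> (forall j, drift p mu 0 0 j <= 0) -> 0 < kappa ->
  (forall x y i, cube x -> cube y ->
     \sum_(u | dotp (x - y) (dir u) == 0) `|p x i u - p y i u|
     + \sum_u (p x i u - p y i u) * Num.sg (dotp (x - y) (dir u))
     <= - kappa * l1norm (x - y)) ->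
  has_lyapunov p P.
Proof.
move=> Pst plaw [K p_lip] P_irr mu_inv drift0 kappa0 contraction.
pose mean j i := \sum_v p 0 i v * dir v 0 j.
have [phi Hphi] := choice (fun j => poisson_equation Pst P_irr mu_inv (mean j)).
pose Cphi := \sum_j \sum_i `|phi j i|.
have phi_bound j i : `|phi j i| <= Cphi.
  rewrite /Cphi (bigD1 j) //= (bigD1 i) //= -addrA lerDl addr_ge0 ?sumr_ge0// => k _.
  exact: sumr_ge0.
have Cphi0 : 0 <= Cphi by apply: sumr_ge0 => j _; exact: sumr_ge0.
have corr j i : \sum_i' P i i' * phi j i' - phi j i <= - \sum_v p 0 i v * dir v 0 j.
  rewrite Hphi lerBlDr addNr; have := drift0 j.
  rewrite /drift summxE (_ : \sum_v _ = \sum_i mu i * mean j i)//.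
  under eq_bigr do rewrite mxE mulr_suml.
  rewrite exchange_big /=; apply: eq_bigr => k _; rewrite /mean mulr_sumr.
  by apply: eq_bigr => v _; rewrite mulrA.
move=> delta delta0.
exact: (lyapunov plaw Pst p_lip kappa0 contraction phi_bound corr Cphi0 delta0).
Qed.

Section ProbabilisticBridge.
Context {R : realType} {d : nat} {E : finType} {disp : measure_display}
  {Omega : measurableType disp}.
Variables (p : 'rV[R]_d -> E -> bool * 'I_d -> R) (P : E -> E -> R)
  (le : rel (bool * 'I_d)).
Variables (Pr : probability Omega R) (xi : nat -> Omega -> E) (U : nat -> Omega -> R).
Variables (i : E) (l : R).
Hypothesis p_law : jump_law p.
Hypotheses (le_total : total le) (le_trans : transitive le) (le_anti : antisymmetric le).
Hypothesis xi_markov : markov_chain Pr xi P i.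
Hypothesis U_iid : iid_uniform Pr U.
Hypothesis xi_U_indep : independent_processes Pr xi U.

Lemma deadlock_time_law m (x : 'rV[R]_d) t : (0 < m)%N -> lattice m (m%:R *: x) -> 0 <= t ->
  let A := [set w | (t%:E < deadlock_time le p xi U m l x w)%E] in
  measurable A /\
  Pr A = (survival p P l i m (Num.truncn (m%:R * t)) (m%:R *: x))%:E.
Proof.
move=> m0 Lx t0 A.
have -> : A = avoids p le xi U m (m%:R *: x) (on_target m l) 0 (Num.truncn (m%:R * t)).
  by apply/seteqP; split => w /=; move/(deadlock_time_gt p le xi U l m0 Lx w t0).
exact: (Pr_avoids p_law le_total le_trans le_anti xi_markov U_iid xi_U_indep).
Qed.

Lemma deadlock_time_ge0 m (x : 'rV[R]_d) w : (0 <= deadlock_time le p xi U m l x w)%E.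
Proof. by apply: le_ereal_inf_tmp => _ [t [t0 _] <-]; rewrite lee_fin. Qed.

(** The tail of the deadlock time only jumps at the multiples of 1 / m. *)
Lemma tail_quantileE m (N : nat) : (0 < m)%N -> (0 < N)%N ->
  (forall n, (survival p P l i m n 0 <= expR (-1)) = (N <= n)%N) ->
  tail_quantile Pr (deadlock_time le p xi U m l 0) = N%:R / m%:R.
Proof.
move=> m0 N0 HN; have mpos : 0 < m%:R :> R by rewrite ltr0n.
rewrite /tail_quantile.
have L0 : lattice m (m%:R *: (0 : 'rV[R]_d)) by rewrite scaler0; exact: lattice0.
have -> : [set t : R | 0 < t /\ (Pr [set w | (t%:E < deadlock_time le p xi U m l 0 w)%E]
      <= (expR (- 1))%:E)%E] = [set t | N%:R / m%:R <= t].
  apply/seteqP; split => t /=.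
    move=> [t0]; have [_ ->] := deadlock_time_law m0 L0 (ltW t0).
    rewrite scaler0 lee_fin HN => Nt; rewrite ler_pdivrMr// mulrC.
    by rewrite -truncn_ge_nat// mulr_ge0// ltW.
  move=> Nt; have t0 : 0 < t by apply: lt_le_trans Nt; rewrite divr_gt0// ltr0n.
  split=> //; have [_ ->] := deadlock_time_law m0 L0 (ltW t0).
  rewrite scaler0 lee_fin HN truncn_ge_nat ?mulr_ge0 ?(ltW t0)//.
  by rewrite mulrC -ler_pdivrMr.
apply/eqP; rewrite eq_le; apply/andP; split.
  by apply: ge_inf => /=; [exists (N%:R / m%:R) => t|].
by apply: lb_le_inf; [exists (N%:R / m%:R) => /= | move=> t].
Qed.

End ProbabilisticBridge.

Theorem theorem4p9 (R : realType) (d : nat) (E : finType)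
  (P : E -> E -> R) (mu : E -> R)
  (p : 'rV[R]_d -> E -> bool * 'I_d -> R)
  (le : rel (bool * 'I_d))
  (disp : measure_display) (Omega : measurableType disp)
  (Pr : E -> probability Omega R)
  (xi : nat -> Omega -> E) (U : nat -> Omega -> R)
  (chi : 'rV[R]_d -> R -> 'rV[R]_d)
  (l kappa : R)
  (d_gt0 : (0 < d)%N)
  (P_stochastic : stochastic P)
  (p_law : jump_law p)
  (le_total : total le) (le_trans : transitive le) (le_anti : antisymmetric le)
  (xi_markov : forall i, markov_chain (Pr i) xi P i)
  (U_iid : forall i, iid_uniform (Pr i) U)
  (xi_U_indep : forall i, independent_processes (Pr i) xi U)
  (A1 : jump_lipschitz p)
  (A2 : forall x i v, 0 < p x i v)
  (A3 : irreducible_mx (transition_mx P))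
  (mu_invariant : invariant_probability P mu)
  (chi_rde : forall x0, cube x0 -> rde_solution (drift p mu) x0 (chi x0))
  (l_bounds : 0 < l < d%:R)
  (A4_equilibrium : forall x0, cube x0 ->
     ((forall t, 0 <= t -> chi x0 t = x0) <-> x0 = 0))
  (A4_stable : forall x0 t, cube x0 -> l1norm x0 <= l -> 0 < t ->
     cube (chi x0 t) /\ l1norm (chi x0 t) < l)
  (A4_attracts : forall x0, cube x0 -> l1norm x0 <= l ->
     chi x0 t @[t --> +oo] --> (0 : 'rV[R]_d))
  (P2_irreducible : irreducible_mx (transition_mx P ^+ 2))
  (kappa_gt0 : 0 < kappa)
  (contraction : forall x y i, cube x -> cube y ->
     \sum_(u | dotp (x - y) (dir u) == 0) `|p x i u - p y i u|
     + \sum_u (p x i u - p y i u) * Num.sg (dotp (x - y) (dir u))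
     <= - kappa * l1norm (x - y)) :
  forall (i : E) (x_ : nat -> 'rV[R]_d) (x : 'rV[R]_d),
    (forall m, (0 < m)%N ->
       [/\ cube (x_ m), l1norm (x_ m) < l & integral_vector (m%:R *: x_ m)]) ->
    cube x -> l1norm x < l ->
    x_ @ \oo --> x ->
    cvg_in_law (Pr i)
      (fun m w => (deadlock_time le p xi U m l (x_ m) w
         * ((tail_quantile (Pr i) (deadlock_time le p xi U m l 0))^-1)%:E)%E)
      (exponential_prob 1).
Proof.
move=> i x_ x x_ok cx xl xcv.
have cube0 : cube (0 : 'rV[R]_d) by move=> j; rewrite mxE lexx ler01.
have drift0 j : drift p mu 0 0 j <= 0.
  apply: drift_origin_le0 (chi_rde 0 cube0) _.
  by apply/(A4_equilibrium 0 cube0).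
have lyap := has_lyapunov_of_contraction P_stochastic p_law A1 A3 mu_invariant
  drift0 kappa_gt0 contraction.
have x0 : 0 <= l1norm x by rewrite sumr_ge0.
pose eta := (l - l1norm x) / 2.
have eta0 : 0 < eta by rewrite divr_gt0// subr_gt0.
have etal : eta <= l by rewrite /eta; have /andP[l0 _] := l_bounds; lra.
have x_lat m : (0 < m)%N -> lattice m (m%:R *: x_ m).
  by move=> m0; have [cm _ im] := x_ok m m0; exact: lattice_scaled.
have x_in : \forall m \near \oo, l1norm (x_ m) <= l - eta.
  have -> : l - eta = l1norm x + eta by rewrite /eta; field.
  exact: l1norm_le_near.
pose N := quantile_step p P l i.
have Npos := quantile_pos i d_gt0 p_law P_stochastic P2_irreducible lyap A1 A2
  l_bounds eta0 etal x_lat x_in.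
have lim := survival_exponential i d_gt0 p_law P_stochastic P2_irreducible lyap A1 A2
  l_bounds eta0 etal x_lat x_in.
pose T m := tail_quantile (Pr i) (deadlock_time le p xi U m l 0).
have TE : \forall m \near \oo, T m = (N m)%:R / m%:R /\ 0 < T m.
  near=> m.
  have m0 : (0 < m)%N by near: m; exists 1%N.
  have N0 : (0 < N m)%N by near: m; exact: Npos.
  have HT : T m = (N m)%:R / m%:R.
    apply: (tail_quantileE p_law le_total le_trans le_anti (xi_markov i) (U_iid i)
      (xi_U_indep i)) => // n.
    exact: quantile_stepP.
  by split; rewrite HT// divr_gt0// ltr0n.
have upperE m s : 0 < T m ->
   upper (fun w => (deadlock_time le p xi U m l (x_ m) w * ((T m)^-1)%:E)%E) s =
   [set w | ((s * T m)%:E < deadlock_time le p xi U m l (x_ m) w)%E].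
  move=> T0; apply/seteqP; split => w /=; rewrite /upper /= lte_pdivlMr//.
apply: weak_convergence_of_tails.
  near=> m.
  have m0 : (0 < m)%N by near: m; exists 1%N.
  have [_ T0] : T m = (N m)%:R / m%:R /\ 0 < T m by near: m.
  have tau0 := deadlock_time_ge0 p le xi U l m (x_ m).
  split=> [w|s].
    apply: (@lt_le_trans _ _ 0%E); first exact: ltNyr.
    by rewrite mule_ge0// lee_fin invr_ge0 ltW.
  rewrite upperE//; have [s0|s0] := leP 0 (s * T m).
    by have [] := deadlock_time_law l p_law le_total le_trans le_anti (xi_markov i)
      (U_iid i) (xi_U_indep i) m0 (x_lat m m0) s0.
  rewrite (_ : [set w | _] = setT) //; apply/seteqP; split => // w _ /=.
  by rewrite (lt_le_trans _ (tau0 w))// lte_fin.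
move=> s s0.
apply: cvg_trans (lim s s0); apply: near_eq_cvg; near=> m.
have m0 : (0 < m)%N by near: m; exists 1%N.
have [HT T0] : T m = (N m)%:R / m%:R /\ 0 < T m by near: m.
rewrite /tail upperE//.
have sT : 0 <= s * T m by rewrite mulr_ge0// ltW.
have [_ ->] := deadlock_time_law l p_law le_total le_trans le_anti (xi_markov i)
      (U_iid i) (xi_U_indep i) m0 (x_lat m m0) sT.
rewrite /= HT; congr (survival _ _ _ _ _ (Num.truncn _) _).
by rewrite -/N; field; rewrite pnatr_eq0 -lt0n.
Unshelve. all: by end_near. Qed.
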